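(* Let $a\in[\frac{2\pi}{5},\frac{\pi}{2})$ be fixed. For any fixed $r\in(0,\frac{1}{2})$, there exists a constant $C_{r}>0$, depending only on $r$, such that for any two potential matrices $Q$ and $\widetilde Q$ of the form described in the context (with entries $q,p$ and $\widetilde q,\widetilde p$), with $\{\lambda_{n,2,j}\}_{n\in\mathbb{Z}}$ and $\{\widetilde\lambda_{n,2,j}\}_{n\in\mathbb{Z}}$ the spectra of $B_{2,j}(Q)$ and $B_{2,j}(\widetilde Q)$, $j=1,2$, the estimate $$\|q-\widetilde{q}\|_{L_{2}(a,\pi)}+\|p-\widetilde{p}\|_{L_{2}(a,\pi)}\leq C_{r}\Big(\|\{\lambda_{n,2,1}-\widetilde{\lambda}_{n,2,1}\}_{n\in\mathbb{Z}}\|_{l_{2}}+\|\{\lambda_{n,2,2}-\widetilde{\lambda}_{n,2,2}\}_{n\in\mathbb{Z}}\|_{l_{2}}\Big)$$ is fulfilled as soon as $\|\{\lambda_{n,2,j}-n+\frac{j}{2}\}_{n\in\mathbb{Z}}\|_{l_{2}}\leq r$ and $\|\{\widetilde{\lambda}_{n,2,j}-n+\frac{j}{2}\}_{n\in\mathbb{Z}}\|_{l_{2}}\leq r$ for $j=1,2$.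
   Context: Consider the Dirac-type system with constant delay $a$: $$By'(x)+Q(x)y(x-a)=\lambda y(x),\quad x\in(0,\pi),$$ where $$B=\begin{bmatrix} 0 & 1 \\ -1 & 0 \end{bmatrix},\quad Q(x)=\begin{bmatrix} q(x) & p(x) \\ p(x) & -q(x) \end{bmatrix},\quad y(x)=\begin{bmatrix} y_1(x) \\ y_2(x) \end{bmatrix},$$ $q,p$ are complex-valued functions in $L_2(0,\pi)$, and $Q(x)=0$ on $(0,a)$ (so the values of $y$ at negative arguments play no role). For $\nu,j\in\{1,2\}$, $B_{\nu,j}(Q)$ denotes the boundary value problem for this system with boundary conditions $y_\nu(0)=0$, $y_j(\pi)=0$. The problem $B_{\nu,j}(\widetilde Q)$ has the same form (same $a$), with $\widetilde Q=\begin{bmatrix} \widetilde q & \widetilde p \\ \widetilde p & -\widetilde q \end{bmatrix}$ satisfying the same assumptions. Let $Y(x,\lambda)=[y_{k,l}(x,\lambda)]_{k,l=1,2}$ be the fundamental matrix solution of the system with $Y(0,\lambda)$ equal to the identity matrix. The eigenvalues of $B_{\nu,j}(Q)$ are the zeros of its characteristic function, the entire function $\Delta_{\nu,j}(\lambda)=y_{j,3-\nu}(\pi,\lambda)$. The spectrum $\{\lambda_{n,\nu,j}\}_{n\in\mathbb{Z}}$ of $B_{\nu,j}(Q)$ is the sequence of these zeros, counted with multiplicity and numbered so that $$\lambda_{n,\nu,j}=n+\frac{2-\nu-j}{2}+\kappa_{n,\nu,j},\quad\{\kappa_{n,\nu,j}\}_{n\in\mathbb{Z}}\in l_2$$ (such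 a numbering always exists). *)

(* Defs.v *)
From HB Require Import structures.
From mathcomp Require Import all_boot all_order all_algebra.
From mathcomp Require Import complex.
From mathcomp Require Import all_classical all_reals all_analysis.

Set Implicit Arguments.
Unset Strict Implicit.
Unset Printing Implicit Defensive.

Import Order.TTheory GRing.Theory Num.Theory.
Import numFieldNormedType.Exports.
Import Normc.

Local Open Scope classical_set_scope.
Local Open Scope complex_scope.
Local Open Scope ring_scope.

Section Norms.
Context {R : realType}.
Implicit Types (f : R -> R[i]) (D : set R) (u : int -> R[i]).

Definition L2norm D f : \bar R :=
  Lnorm (@lebesgue_measure R) 2%:E (EFin \o (fun x => normc (f x)) \_ D).

Definition in_L2 D f : Prop :=
  [/\ measurable_fun D (fun x : R => complex.Re (f x)),
      measurable_fun D (fun x : R => complex.Im (f x)) &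
      (L2norm D f < +oo)%E].

Definition l2norm u : \bar R :=
  ((\esum_(n in [set: int]) (normc (u n) ^+ 2)%:E) `^ 2^-1)%E.

Definition in_l2 u : Prop := (l2norm u < +oo)%E.

End Norms.

Section Dirac_delay.
Context {R : realType}.
Local Notation C := R[i].
Local Notation mu := (@lebesgue_measure R).

Definition mx22 (x y z t : C) : 'M[C]_2 :=
  \matrix_(k < 2, l < 2) nth 0 (nth [::] [:: [:: x; y]; [:: z; t]] k) l.

Definition Bmx : 'M[C]_2 := mx22 0 1 (-1) 0.

Definition Qmx (q p : R -> C) (x : R) : 'M[C]_2 :=
  mx22 (q x) (p x) (p x) (- q x).

(* The coefficients are L_2-classes, so they vanish on (0, a) only almost
   everywhere; their values outside (0, pi) are never used. *)
Definition admissible (a : R) (q p : R -> C) : Prop :=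
  [/\ in_L2 `]0, pi[ q, in_L2 `]0, pi[ p &
      {ae mu, forall x : R, 0 < x < a -> q x = 0 /\ p x = 0}].

(* Absolute continuity on [0, b]: f is an indefinite Lebesgue integral. *)
Definition abs_continuous (b : R) (f : R -> R) : Prop :=
  exists2 g : R -> R, mu.-integrable `[0, b] (EFin \o g) &
    forall x, 0 <= x <= b -> f x = f 0 + \int[mu]_(t in `[0, x]) g t.

Definition abs_continuousC (b : R) (f : R -> C) : Prop :=
  abs_continuous b (fun x => complex.Re (f x)) /\
  abs_continuous b (fun x => complex.Im (f x)).

(* Derivative of a complex-valued function of a real variable. *)
Definition derivC (f : R -> C) (x : R) : C :=
  derive1 (fun t => complex.Re (f t)) x +i* derive1 (fun t => complex.Im (f t)) x.

(* Matrix solutions of  B Y'(x) + Q(x) Y(x - a) = lambda Y(x)  on (0, pi):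
   absolutely continuous on [0, pi], the equation holding almost everywhere.
   The values of Y at negative arguments are multiplied by Q = 0. *)
Definition is_solution (a : R) (q p : R -> C) (lambda : C)
    (Y : R -> 'M[C]_2) : Prop :=
  (forall k l, abs_continuousC pi (fun x => Y x k l)) /\
  {ae mu, forall x : R, 0 < x < pi ->
     Bmx *m (\matrix_(k, l) derivC (fun t => Y t k l) x)
       + Qmx q p x *m Y (x - a) = lambda *: Y x}.

Definition is_fundamental_solution (a : R) (q p : R -> C)
    (Y : R -> C -> 'M[C]_2) : Prop :=
  forall lambda, is_solution a q p lambda (Y ^~ lambda) /\ Y 0 lambda = 1%:M.

(* Delta_{nu,j}(lambda) = y_{j,3-nu}(pi, lambda) for nu, j in {1, 2};
   matrix indices start from 0 here. *)
Definition charfun (Y : R -> C -> 'M[C]_2) (nu j : nat) (lambda : C) : C :=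
  Y pi lambda (inord (j - 1)) (inord (3 - nu - 1)).

(* C^o is C as a normed space over itself, so derive1n is the complex
   derivative; charfun is entire, so its derivatives all exist. *)
Definition zero_order (f : C -> C) (z : C) (m : nat) : Prop :=
  (forall k, (k < m)%N -> derive1n k (f : C -> C^o) z = 0) /\
  derive1n m (f : C -> C^o) z != 0.

(* lam lists the zeros of f counted with multiplicity. *)
Definition lists_zeros (f : C -> C) (lam : int -> C) : Prop :=
  forall z, exists2 m, zero_order f z m & ([set n | lam n = z] #= `I_m)%card.

Definition is_spectrum (a : R) (q p : R -> C) (nu j : nat)
    (lam : int -> C) : Prop :=
  (exists2 Y, is_fundamental_solution a q p Y & lists_zeros (charfun Y nu j) lam)
  /\ in_l2 (fun n => lam n - (n%:~R + (2 - nu%:R - j%:R) / 2)).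

End Dirac_delay.

(* Main.v *)
Require Import Defs.
From HB Require Import structures.
From mathcomp Require Import all_boot all_order all_algebra.
From mathcomp Require Import complex.
From mathcomp Require Import all_classical all_reals all_analysis.
From mathcomp Require Import ring lra.
From mathcomp Require Import measurable_realfun.

(** The combinations W = y1 + i y2 and Z = y1 - i y2 turn the system into
    W' = i lambda W + alpha Z(. - a), Z' = - i lambda Z + beta W(. - a) with
    alpha = p - i q and beta = p + i q.  As a >= 2 pi / 5, solving by steps stops
    at the second order: W(pi) = e^(i lambda pi) + int v(t) e^(i lambda (pi + a - 2t)) dt,
    where v - alpha is a convolution-type product of alpha near pi and beta near a,
    places where v = alpha and where the kernel of Z equals beta.  Hence potentials
    and kernels determine each other in a Lipschitz way.

    The characteristic functions are c_j + F_j, where c_j is cos or sin (of pi lambda)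
    and F_j(lambda) = int u_j(t) e^(i lambda (pi + a - 2t)) dt.  At the eigenvalues
    F_j = - c_j is known, and F_j - F~_j is of size |lambda_n - lambda~_n|.  No
    infinite product is needed, because u_j lives on an interval of length
    pi - a <= 3 pi / 5 only: for eigenvalues at l2-distance at most 1/2 from the
    unperturbed ones, the values F_j(lambda_n) control the L2-norm of u_j, by a crude
    perturbation of Parseval's identity (the relative error is below 1 thanks to the
    short interval and pi <= 10/3).  Only the lower bound in Parseval is used; it
    follows by duality from the pointwise convergence of Fourier series of Lipschitz
    functions and Lebesgue differentiation. *)

Set Implicit Arguments.
Unset Strict Implicit.
Unset Printing Implicit Defensive.

Import Order.TTheory GRing.Theory Num.Theory.
Import numFieldNormedType.Exports.
Import Normc.

Local Open Scope classical_set_scope.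
Local Open Scope complex_scope.
Local Open Scope ring_scope.

(** * Complex numbers and the complex exponential *)

Section Complex.
Context {R : realType}.
Local Notation C := R[i].
Local Notation Re := complex.Re.
Local Notation Im := complex.Im.
Implicit Types (z w : C) (x y : R).

Lemma cReD z w : Re (z + w) = Re z + Re w. Proof. by case: z; case: w. Qed.
Lemma cImD z w : Im (z + w) = Im z + Im w. Proof. by case: z; case: w. Qed.
Lemma cReN z : Re (- z) = - Re z. Proof. by case: z. Qed.
Lemma cImN z : Im (- z) = - Im z. Proof. by case: z. Qed.
Lemma cReM z w : Re (z * w) = Re z * Re w - Im z * Im w.
Proof. by case: z; case: w. Qed.
Lemma cImM z w : Im (z * w) = Re z * Im w + Im z * Re w.
Proof. by case: z => a b; case: w. Qed.
Lemma eq_ReIm z w : Re z = Re w -> Im z = Im w -> z = w.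
Proof. by case: z => a b; case: w => c d /= -> ->. Qed.

Lemma normc_sqr z : normc z ^+ 2 = Re z ^+ 2 + Im z ^+ 2.
Proof. by case: z => a b; rewrite /= sqr_sqrtr// addr_ge0// sqr_ge0. Qed.
Lemma normc_ge0 z : 0 <= normc z.
Proof. by case: z => a b; exact: sqrtr_ge0. Qed.
Lemma Re_le_normc z : `|Re z| <= normc z.
Proof.
rewrite -(@ler_pXn2r _ 2)// ?nnegrE ?normc_ge0// normc_sqr real_normK ?num_real//.
by rewrite lerDl sqr_ge0.
Qed.
Lemma Im_le_normc z : `|Im z| <= normc z.
Proof.
rewrite -(@ler_pXn2r _ 2)// ?nnegrE ?normc_ge0// normc_sqr real_normK ?num_real//.
by rewrite lerDr sqr_ge0.
Qed.
Lemma normc_le z : normc z <= `|Re z| + `|Im z|.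
Proof.
rewrite -(@ler_pXn2r _ 2)// ?nnegrE ?normc_ge0 ?addr_ge0// normc_sqr.
rewrite sqrrD !real_normK ?num_real//.
have : 0 <= `|Re z| * `|Im z| by rewrite mulr_ge0.
by rewrite -(mulr_natl (_ * _)); nra.
Qed.
Lemma normc_real x : normc x%:C = `|x|.
Proof. by rewrite /= expr0n/= addr0 sqrtr_sqr. Qed.
Lemma normcB z w : normc (z - w) = normc (w - z).
Proof. by rewrite -normcN opprB. Qed.
Lemma ler_normcB z w : normc z - normc w <= normc (z - w).
Proof. by rewrite lerBlDr -{1}(subrK w z) le_normcD. Qed.
Lemma normc_conj z : normc z^* = normc z.
Proof. by case: z => a b; rewrite /= sqrrN. Qed.
Lemma mulcJ z : z * z^* = (normc z ^+ 2)%:C.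
Proof. by case: z => a b; apply: eq_ReIm; rewrite normc_sqr /=; ring. Qed.
Lemma normc_sum I (r : seq I) (F : I -> C) :
  normc (\sum_(i <- r) F i) <= \sum_(i <- r) normc (F i).
Proof.
elim: r => [|i r IH]; first by rewrite !big_nil normc0.
by rewrite !big_cons (le_trans (le_normcD _ _))// lerD2l.
Qed.

Definition cexp z : C := expR (Re z) * cos (Im z) +i* (expR (Re z) * sin (Im z)).

Lemma cexpD z w : cexp (z + w) = cexp z * cexp w.
Proof.
apply: eq_ReIm; rewrite /cexp ?(cReM, cImM)/= cReD cImD expRD ?cosD ?sinD; ring.
Qed.
Lemma cexp0 : cexp 0 = 1.
Proof. by apply: eq_ReIm; rewrite /= expR0 ?cos0 ?sin0 mul1r. Qed.
Lemma normc_cexp z : normc (cexp z) = expR (Re z).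
Proof.
apply/eqP; rewrite -(@eqrXn2 _ 2)// ?normc_ge0 ?expR_ge0// normc_sqr/=.
by rewrite !exprMn -mulrDr cos2Dsin2 mulr1.
Qed.
Lemma normc_cexp_im x : normc (cexp ('i * x%:C)) = 1.
Proof. by rewrite normc_cexp cReM/= mul0r mulr0 subrr expR0. Qed.

Lemma cos_ge1B x : 1 - x ^+ 2 / 2 <= cos x.
Proof.
have := cosD (x / 2) (x / 2); rewrite -splitr => ->.
have := cos2Dsin2 (x / 2).
suff : sin (x / 2) ^+ 2 <= (x / 2) ^+ 2 by rewrite -!expr2; lra.
wlog x0 : x / 0 <= x => [hw|].
  have [/hw//|x0] := leP 0 x.
  by have := hw (- x); rewrite mulNr sinN !sqrrN; apply; lra.
suff H (t : R) : 0 <= t -> `|sin t| <= t.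
  rewrite -(real_normK (num_real (sin _))) ler_sqr ?nnegrE//; last lra.
  by apply: H; lra.
move=> t0; rewrite ler_norml.
have [->|tn0] := eqVneq t 0; first by rewrite sin0; lra.
have tp : 0 < t by rewrite lt0r tn0.
have [c _ ] : exists2 c, c \in `]0, t[%R & sin t - sin 0 = cos c * (t - 0).
  apply: MVT => //.
  by apply: continuous_subspaceT => u; exact: continuous_sin.
rewrite sin0 !subr0 => ->.
have := cos_geN1 c; have := cos_le1 c => h1 h2; apply/andP; split; nra.
Qed.

Lemma expRB1_le x : `|expR x - 1| <= `|x| * expR `|x|.
Proof.
have h1 := expR_ge1Dx x; have h2 := expR_ge1Dx (- x).
have e0 := expR_gt0 x.
have [x0|x0] := leP 0 x.
  rewrite (ger0_norm x0) ger0_norm; last lra.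
  have : expR x * (1 - x) <= expR x * expR (- x).
    by rewrite ler_pM2l//; lra.
  by rewrite expRxMexpNx_1; lra.
have : 1 <= expR (- x) by lra.
have e1 : expR x < 1 by rewrite expR_lt1.
by rewrite (ltr0_norm x0) ler0_norm; nra.
Qed.

Lemma normc_cexpB1_sqr z :
  normc (cexp z - 1) ^+ 2 <= (expR (Re z) - 1) ^+ 2 + expR (Re z) * Im z ^+ 2.
Proof.
rewrite normc_sqr cReD cImD cReN cImN/= oppr0 addr0.
have := cos2Dsin2 (Im z); have := cos_ge1B (Im z); have := expR_gt0 (Re z).
move: (expR _) (cos _) (sin _) => e c s e0 hc hs.
suff : 0 <= e * (c - (1 - Im z ^+ 2 / 2)) by nra.
by rewrite mulr_ge0; lra.
Qed.

Lemma normc_cexpB1 z : normc (cexp z - 1) <= normc z * expR (normc z).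
Proof.
rewrite -(@ler_pXn2r _ 2)// ?nnegrE ?normc_ge0 ?mulr_ge0 ?normc_ge0 ?expR_ge0//.
apply: (le_trans (normc_cexpB1_sqr z)).
rewrite exprMn normc_sqr.
have a1 : (expR (Re z) - 1) ^+ 2 <= Re z ^+ 2 * expR (normc z) ^+ 2.
  rewrite -exprMn -(real_normK (num_real (_ - 1))).
  rewrite -[leRHS](real_normK (num_real _)) ler_sqr ?nnegrE//.
  apply: (le_trans (expRB1_le _)); rewrite normrM ler_wpM2l//.
  by rewrite ger0_norm ?expR_ge0// ler_expR Re_le_normc.
have e1 : 1 <= expR (normc z) by rewrite -expR0 ler_expR normc_ge0.
have a2 : expR (Re z) <= expR (normc z) ^+ 2.
  apply: (@le_trans _ _ (expR (normc z))).
    by rewrite ler_expR (le_trans _ (Re_le_normc z))// ler_norm.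
  by rewrite expr2 ler_peMr// expR_ge0.
rewrite mulrDl; apply: lerD => //.
by rewrite [leRHS]mulrC; apply: ler_wpM2r => //; exact: sqr_ge0.
Qed.

Lemma expR1_le3 : expR 1 <= 3 :> R.
Proof.
have h : expR 1 = expR (8^-1 : R) ^+ 8.
  by rewrite -expRM_natl mulfV.
have h2 : expR (8^-1 : R) <= 8 / 7.
  have := expR_ge1Dx (- 8^-1 : R); rewrite expRN => h3.
  have e0 := expR_gt0 (8^-1 : R).
  have : (1 - 8^-1) * expR 8^-1 <= (expR 8^-1)^-1 * expR 8^-1 :> R.
    by rewrite ler_pM2r//; lra.
  by rewrite mulVf ?gt_eqF//; lra.
rewrite h; apply: (@le_trans _ _ ((8 / 7) ^+ 8)).
  by rewrite lerXn2r ?nnegrE ?expR_ge0//; lra.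
by rewrite exprMn -[leRHS]mul1r; lra.
Qed.

Lemma expR_le1D2 x : 0 <= x <= 1 -> expR x <= 1 + 2 * x.
Proof.
move=> /andP[x0 x1].
pose t : {i01 R} := Itv01 x0 x1.
have := @convex_expR R t 1 0.
rewrite !convRE/= expR0 mulr0 addr0 !mulr1 => h; apply: (le_trans h).
have := expR1_le3; rewrite /unstable.onem => h3; nra.
Qed.

Lemma normc_cexpB1_small z : normc z <= 1 -> normc (cexp z - 1) <= 2 * normc z.
Proof.
move=> z1.
rewrite -(@ler_pXn2r _ 2)// ?nnegrE ?normc_ge0 ?mulr_ge0 ?normc_ge0//.
apply: (le_trans (normc_cexpB1_sqr z)).
rewrite exprMn normc_sqr.
have : `|Re z| <= 1 by rewrite (le_trans (Re_le_normc z)).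
rewrite ler_norml => /andP[r1 r2].
have e0 := expR_gt0 (Re z).
have e3 : expR (Re z) <= 3 by rewrite (le_trans _ expR1_le3)// ler_expR.
have : (expR (Re z) - 1) ^+ 2 <= 4 * Re z ^+ 2.
  have h1 := expR_ge1Dx (Re z).
  have [x0|x0] := leP 0 (Re z).
    have : expR (Re z) <= 1 + 2 * Re z by rewrite expR_le1D2// x0.
    by nra.
  have : expR (Re z) < 1 by rewrite expR_lt1.
  by nra.
have : 0 <= Im z ^+ 2 by exact: sqr_ge0.
by nra.
Qed.

Lemma sin_ge_mulcos x : 0 <= x <= pi -> x * cos x <= sin x.
Proof.
move=> /andP[]; rewrite le_eqVlt => /predU1P[<-|x0] xpi.
  by rewrite mul0r sin0.
pose f (t : R) := sin t - t * cos t.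
have df (t : R) : is_derive t 1 f (t * sin t).
  rewrite /f; apply: is_derive_eq.
  by rewrite /GRing.scale/=; ring.
have [c ] : exists2 c, c \in `]0, x[%R & f x - f 0 = (c * sin c) * (x - 0).
  apply: MVT => //.
  apply: derivable_within_continuous => t _.
  exact: ex_derive.
rewrite in_itv/= => /andP[c0 cx].
have sc : 0 <= sin c by apply: sin_ge0_pi; lra.
rewrite /f sin0 mul0r !subr0 => h.
by rewrite -subr_ge0 h !mulr_ge0//; lra.
Qed.

Lemma sin_ge_half x : 0 <= x <= pi / 2 -> x / 2 * (1 + cos x) <= sin x.
Proof.
move=> /andP[x0 xpi]; have pi0 := pi_gt0 R.
have h : 0 <= x / 2 <= pi by lra.
have := sin_ge_mulcos h.
have cp : 0 <= cos (x / 2) by apply: cos_ge0_pihalf; lra.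
have sE : sin x = 2 * (sin (x / 2) * cos (x / 2)).
  by have := sinD (x / 2) (x / 2); rewrite -splitr; lra.
have cE : cos x = cos (x / 2) ^+ 2 - sin (x / 2) ^+ 2.
  by have := cosD (x / 2) (x / 2); rewrite -splitr -!expr2.
have cs := cos2Dsin2 (x / 2).
rewrite sE; move: (cos (x/2)) (sin (x/2)) cs cE cp => c s cs -> c0 hs.
have -> : 1 + (c ^+ 2 - s ^+ 2) = 2 * (c * c) by rewrite -expr2; lra.
have -> : x / 2 * (2 * (c * c)) = 2 * ((x / 2 * c) * c) by ring.
by rewrite ler_pM2l// ler_wpM2r.
Qed.

Lemma pi_le : pi <= 10 / 3 :> R.
Proof.
have pi0 := pi_gt0 R.
have h : 0 <= (pi / 4 : R) <= pi / 2 by lra.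
have := sin_ge_half h.
have sc : sin (pi / 4) = cos (pi / 4) :> R.
  have := tan_piquarter R; rewrite /tan => t1.
  have c0 : cos (pi / 4) != 0 :> R.
    by apply/eqP => c0; move: t1; rewrite c0 invr0 mulr0 => /eqP; rewrite eq_sym oner_eq0.
  by rewrite -[LHS](divfK c0) t1 mul1r.
have cs := cos2Dsin2 (pi / 4 : R).
have c0 : 0 <= cos (pi / 4) :> R by apply: cos_ge0_pihalf; lra.
rewrite sc in cs *; move: (cos _) c0 cs => c c0 cs hc.
have c1 : c <= 10 / 14 by rewrite leNgt; apply/negP => hh; nra.
have c2 : 7 / 10 <= c by rewrite leNgt; apply/negP => hh; nra.
nra.
Qed.

Lemma sin_ge_dist x : 0 <= x <= pi -> Num.min x (pi - x) / 2 <= sin x.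
Proof.
move=> /andP[x0 xpi]; have pi0 := pi_gt0 R.
suff H (y : R) : 0 <= y <= pi / 2 -> y / 2 <= sin y.
  have [h|h] := leP x (pi - x); first by apply: H; lra.
  have -> : sin x = sin (pi - x) by rewrite sinB sinpi cospi; lra.
  by apply: H; lra.
move=> yh; apply: le_trans (sin_ge_half yh).
rewrite ler_peMr//; first lra.
by rewrite lerDl; apply: cos_ge0_pihalf; lra.
Qed.

Lemma normc_cexp2B1 x : normc (cexp ('i * (2 * x)%:C) - 1) ^+ 2 = 4 * sin x ^+ 2.
Proof.
rewrite normc_sqr cReD cImD cReN cImN /cexp cReM cImM/= !(mul0r, mulr0, mul1r, add0r, addr0, subr0, oppr0, expR0).
have -> : 2 * x = x + x by lra.
rewrite cosD sinD; have := cos2Dsin2 x; move: (cos x) (sin x) => c s cs.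
have c2 : c * c = 1 - s * s by rewrite -!expr2; lra.
have -> : c * c - s * s - 1 = - (2 * (s * s)) by rewrite c2; lra.
have -> : s * c + c * s = 2 * (s * c) by ring.
have -> : (2 * (s * c)) ^+ 2 = 4 * (c * c) * (s * s) by ring.
rewrite c2; ring.
Qed.

End Complex.

Local Arguments normc : simpl never.

(** * Measurable and integrable complex functions *)

Section ComplexMeasurable.
Context {R : realType} {d : measure_display} {T : measurableType d}.
Local Notation C := R[i].
Local Notation Re := complex.Re.
Local Notation Im := complex.Im.
Implicit Types (f g : T -> C) (h : T -> R).

Definition cmeas f : Prop :=
  measurable_fun setT (fun x => Re (f x)) /\
  measurable_fun setT (fun x => Im (f x)).

Lemma cmeas_cst (c : C) : cmeas (fun=> c).
Proof. by split; exact: measurable_cst. Qed.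

Lemma cmeas_real h : measurable_fun setT h -> cmeas (fun x => (h x)%:C).
Proof. by move=> mh; split => //=; exact: measurable_cst. Qed.

Lemma cmeasD f g : cmeas f -> cmeas g -> cmeas (fun x => f x + g x).
Proof.
move=> [f1 f2] [g1 g2]; split.
  rewrite (_ : (fun _ => _) = (fun x => Re (f x) + Re (g x))).
    exact: measurable_funD.
  by apply/funext => x; rewrite cReD.
rewrite (_ : (fun _ => _) = (fun x => Im (f x) + Im (g x))).
  exact: measurable_funD.
by apply/funext => x; rewrite cImD.
Qed.

Lemma cmeasM f g : cmeas f -> cmeas g -> cmeas (fun x => f x * g x).
Proof.
move=> [f1 f2] [g1 g2]; split.
  rewrite (_ : (fun _ => _) = (fun x => Re (f x) * Re (g x) - Im (f x) * Im (g x))).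
    by apply: measurable_funB; apply: measurable_funM.
  by apply/funext => x; rewrite cReM.
rewrite (_ : (fun _ => _) = (fun x => Re (f x) * Im (g x) + Im (f x) * Re (g x))).
  by apply: measurable_funD; apply: measurable_funM.
by apply/funext => x; rewrite cImM.
Qed.

Lemma cmeasZ (c : C) f : cmeas f -> cmeas (fun x => c * f x).
Proof. by move=> mf; apply: cmeasM => //; exact: cmeas_cst. Qed.

Lemma cmeasN f : cmeas f -> cmeas (fun x => - f x).
Proof.
by move=> /(cmeasZ (-1)); under eq_fun do rewrite mulN1r.
Qed.

Lemma cmeasB f g : cmeas f -> cmeas g -> cmeas (fun x => f x - g x).
Proof. by move=> mf mg; apply: cmeasD => //; exact: cmeasN. Qed.

Lemma cmeas_sum I (r : seq I) (F : I -> T -> C) :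
  (forall i, cmeas (F i)) -> cmeas (fun x => \sum_(i <- r) F i x).
Proof.
move=> mF; elim: r => [|i r IH].
  by under eq_fun do rewrite big_nil; exact: cmeas_cst.
by under eq_fun do rewrite big_cons; apply: cmeasD.
Qed.

Lemma cmeas_conj f : cmeas f -> cmeas (fun x => (f x)^*).
Proof.
move=> [f1 f2]; split.
  rewrite (_ : (fun _ => _) = (fun x => Re (f x)))//.
  by apply/funext => x; case: (f x).
rewrite (_ : (fun _ => _) = (fun x => - Im (f x))).
  exact: measurableT_comp.
by apply/funext => x; case: (f x).
Qed.

Lemma cmeas_cexp f : cmeas f -> cmeas (fun x => cexp (f x)).
Proof.
move=> [f1 f2]; split => /=; apply: measurable_funM.
- by apply: measurableT_comp f1.
- by apply: measurableT_comp f2; apply: continuous_measurable_fun; exact: continuous_cos.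
- by apply: measurableT_comp f1.
- by apply: measurableT_comp f2; apply: continuous_measurable_fun; exact: continuous_sin.
Qed.

Lemma measurable_normc f : cmeas f -> measurable_fun setT (fun x => normc (f x)).
Proof.
move=> [f1 f2].
rewrite (_ : (fun _ => _) = (fun x => Num.sqrt (Re (f x) ^+ 2 + Im (f x) ^+ 2))).
  apply: measurableT_comp.
    by apply: continuous_measurable_fun; exact: sqrt_continuous.
  by apply: measurable_funD; exact: measurable_funX.
by apply/funext => x; case: (f x).
Qed.

Lemma measurable_normc_sqr f : cmeas f ->
  measurable_fun setT (fun x => normc (f x) ^+ 2).
Proof. by move=> mf; apply: measurable_funX; exact: measurable_normc. Qed.

End ComplexMeasurable.

Lemma cmeas_comp {R : realType} {d d' : measure_display} {T : measurableType d}
    {T' : measurableType d'} (f : T -> R[i]) (h : T' -> T) :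
  measurable_fun setT h -> cmeas f -> cmeas (fun x => f (h x)).
Proof. by move=> mh [f1 f2]; split; [exact: measurableT_comp f1 mh|exact: measurableT_comp f2 mh]. Qed.

Section ComplexIntegral.
Context {R : realType}.
Local Notation C := R[i].
Local Notation Re := complex.Re.
Local Notation Im := complex.Im.
Local Notation mu := (@lebesgue_measure R).
Implicit Types (f g : R -> C) (h k : R -> R) (D : set R).

Definition cind D (x : R) : C := (\1_D x : R)%:C.

Lemma cindE D x : cind D x = if x \in D then 1 else 0.
Proof. by rewrite /cind indicE; case: (_ \in _). Qed.

Lemma cind1 D x : D x -> cind D x = 1.
Proof. by move=> Dx; rewrite cindE mem_set. Qed.

Lemma cind0 D x : ~ D x -> cind D x = 0.
Proof. by move=> Dx; rewrite cindE memNset. Qed.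

Lemma cmeas_ind D : measurable D -> cmeas (cind D).
Proof. by move=> mD; apply: cmeas_real; exact: measurable_indic. Qed.

Lemma normc_ind_le D x : normc (cind D x) <= 1.
Proof. by rewrite cindE; case: ifP => _; rewrite ?normc1// normc0. Qed.

Definition cintble f : Prop :=
  cmeas f /\ mu.-integrable setT (fun x => (normc (f x))%:E).

Definition cint f : C :=
  (\int[mu]_x Re (f x)) +i* (\int[mu]_x Im (f x)).

Lemma cintble_le f h : cmeas f -> mu.-integrable setT (EFin \o h) ->
  (forall x, normc (f x) <= h x) -> cintble f.
Proof.
move=> mf ih fh; split=> //.
apply: (le_integrable measurableT _ _ ih).
  by apply/measurable_EFinP; exact: measurable_normc.
move=> x _; rewrite /= lee_fin ger0_norm ?normc_ge0//.
by rewrite (le_trans (fh x))// ler_norm.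
Qed.

Lemma cintble_Re f : cintble f -> mu.-integrable setT (EFin \o (fun x => Re (f x))).
Proof.
move=> [[f1 f2] ih]; apply: (le_integrable measurableT _ _ ih).
  exact/measurable_EFinP.
by move=> x _; rewrite /= lee_fin (ger0_norm (normc_ge0 _)) Re_le_normc.
Qed.

Lemma cintble_Im f : cintble f -> mu.-integrable setT (EFin \o (fun x => Im (f x))).
Proof.
move=> [[f1 f2] ih]; apply: (le_integrable measurableT _ _ ih).
  exact/measurable_EFinP.
by move=> x _; rewrite /= lee_fin (ger0_norm (normc_ge0 _)) Im_le_normc.
Qed.

Lemma cintble_norm f : cintble f -> mu.-integrable setT (EFin \o (fun x => normc (f x))).
Proof. by case. Qed.

Lemma cintbleP f : mu.-integrable setT (EFin \o (fun x => Re (f x))) ->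
  mu.-integrable setT (EFin \o (fun x => Im (f x))) -> cintble f.
Proof.
move=> f1 f2; apply: (@cintble_le _ (fun x => `|Re (f x)| + `|Im (f x)|)).
- by split; apply/measurable_EFinP; [exact: measurable_int f1|exact: measurable_int f2].
- exact: (integrableD measurableT (integrable_norm f1) (integrable_norm f2)).
- by move=> x; exact: normc_le.
Qed.

Lemma eq_cint f g : f =1 g -> cint f = cint g.
Proof. by move=> /funext ->. Qed.

Lemma cint_cst0 : cint (fun=> 0) = 0.
Proof. by apply: eq_ReIm => /=; rewrite /Rintegral integral0. Qed.

Lemma cintbleD f g : cintble f -> cintble g -> cintble (fun x => f x + g x).
Proof.
move=> [mf f1] [mg g1]; apply: (@cintble_le _ (fun x => normc (f x) + normc (g x))).
- exact: cmeasD.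
- exact: (integrableD measurableT f1 g1).
- by move=> x; exact: le_normcD.
Qed.

Lemma cintD f g : cintble f -> cintble g ->
  cint (fun x => f x + g x) = cint f + cint g.
Proof.
move=> hf hg; apply: eq_ReIm => /=.
  under eq_Rintegral do rewrite cReD.
  by rewrite RintegralD//; exact: cintble_Re.
under eq_Rintegral do rewrite cImD.
by rewrite RintegralD//; exact: cintble_Im.
Qed.

Lemma cintbleZ (c : C) f : cintble f -> cintble (fun x => c * f x).
Proof.
move=> [mf f1]; apply: (@cintble_le _ (fun x => normc c * normc (f x))).
- exact: cmeasZ.
- exact: (integrableZl measurableT (normc c) f1).
- by move=> x; rewrite normcM.
Qed.

Lemma cintZ (c : C) f : cintble f -> cint (fun x => c * f x) = c * cint f.
Proof.
move=> hf; have f1 := cintble_Re hf; have f2 := cintble_Im hf.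
have i1 (r : R) := integrableZl measurableT r f1.
have i2 (r : R) := integrableZl measurableT r f2.
apply: eq_ReIm; rewrite ?(cReM, cImM)/=.
  under eq_Rintegral do rewrite cReM.
  by rewrite RintegralB// ?RintegralZl//; [exact: i1|exact: i2].
under eq_Rintegral do rewrite cImM.
by rewrite RintegralD// ?RintegralZl//; [exact: i2|exact: i1].
Qed.

Lemma cintbleN f : cintble f -> cintble (fun x => - f x).
Proof. by move=> /(cintbleZ (-1)); under eq_fun do rewrite mulN1r. Qed.

Lemma cintN f : cintble f -> cint (fun x => - f x) = - cint f.
Proof. by move=> /(cintZ (-1)); under eq_cint do rewrite mulN1r; rewrite mulN1r. Qed.

Lemma cintbleB f g : cintble f -> cintble g -> cintble (fun x => f x - g x).
Proof. by move=> hf hg; apply: cintbleD => //; exact: cintbleN. Qed.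

Lemma cintB f g : cintble f -> cintble g ->
  cint (fun x => f x - g x) = cint f - cint g.
Proof. by move=> hf hg; rewrite cintD ?cintN//; exact: cintbleN. Qed.

Lemma cintble_sum I (r : seq I) (F : I -> R -> C) :
  (forall i, cintble (F i)) -> cintble (fun x => \sum_(i <- r) F i x).
Proof.
move=> iF; elim: r => [|i r IH].
  under eq_fun do rewrite big_nil.
  by apply: cintbleP => /=; exact: integrable0.
by under eq_fun do rewrite big_cons; apply: cintbleD.
Qed.

Lemma cint_sum I (r : seq I) (F : I -> R -> C) : (forall i, cintble (F i)) ->
  cint (fun x => \sum_(i <- r) F i x) = \sum_(i <- r) cint (F i).
Proof.
move=> iF; elim: r => [|i r IH].
  by rewrite big_nil; under eq_cint do rewrite big_nil; exact: cint_cst0.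
rewrite big_cons -IH -cintD//; last exact: cintble_sum.
by apply: eq_cint => x; rewrite big_cons.
Qed.

Lemma normc_cint f : cintble f -> normc (cint f) <= \int[mu]_x normc (f x).
Proof.
move=> hf; have [->|nz] := eqVneq (cint f) 0.
  by rewrite normc0 Rintegral_ge0// => x _; exact: normc_ge0.
have n0 : normc (cint f) != 0 by apply: contra nz => /eqP/eq0_normc ->.
pose c := (cint f)^* / (normc (cint f))%:C.
have cE : c * cint f = (normc (cint f))%:C.
  rewrite /c mulrAC [_^* * _]mulrC mulcJ -(@rmorphV R) ?unitfE//.
  by rewrite -rmorphM/= expr2 mulfK.
have c1 : normc c = 1.
  by rewrite /c normcM normc_conj normcV normc_real ger0_norm ?normc_ge0// divff.
have -> : normc (cint f) = Re (cint (fun x => c * f x)) by rewrite cintZ// cE.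
apply: le_Rintegral => //.
- by apply: cintble_Re; exact: cintbleZ.
- exact: cintble_norm.
- move=> x _; apply: (le_trans (ler_norm _)); apply: (le_trans (Re_le_normc _)).
  by rewrite normcM c1 mul1r.
Qed.

Lemma ae_imp (P Q : R -> Prop) : (forall x, P x -> Q x) ->
  {ae mu, forall x, P x} -> {ae mu, forall x, Q x}.
Proof.
by move=> PQ; apply: filterS => //; exact: (ae_filter_ringOfSetsType mu).
Qed.

Lemma ae_imp2 (P Q S : R -> Prop) : (forall x, P x -> Q x -> S x) ->
  {ae mu, forall x, P x} -> {ae mu, forall x, Q x} -> {ae mu, forall x, S x}.
Proof.
by move=> PQ; apply: filterS2 => //; exact: (ae_filter_ringOfSetsType mu).
Qed.

Lemma ae_eq_cint f g : cmeas f -> cmeas g -> {ae mu, forall x, f x = g x} ->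
  cint f = cint g.
Proof.
move=> [f1 f2] [g1 g2] fg; apply: eq_ReIm => /=; congr fine; apply: ae_eq_integral => //.
- exact/measurable_EFinP.
- exact/measurable_EFinP.
- by move: fg; apply: ae_imp => x ->.
- exact/measurable_EFinP.
- exact/measurable_EFinP.
- by move: fg; apply: ae_imp => x ->.
Qed.

Lemma Rdominated_cvg (f_ : nat -> R -> R) (f h : R -> R) :
  (forall n, measurable_fun setT (f_ n)) -> measurable_fun setT f ->
  {ae mu, forall x, f_ n x @[n --> \oo] --> f x} ->
  mu.-integrable setT (EFin \o h) ->
  (forall n x, `|f_ n x| <= h x) ->
  (\int[mu]_x f_ n x) @[n --> \oo] --> \int[mu]_x f x.
Proof.
move=> mf_ mf cf ih fh.
have m1 n : measurable_fun setT (EFin \o f_ n) by exact/measurable_EFinP.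
have m2 : measurable_fun setT (EFin \o f) by exact/measurable_EFinP.
have c1 : {ae mu, forall x, setT x -> ((EFin \o f_ n) x @[n --> \oo] --> (EFin \o f) x)%E}.
  by move: cf; apply: ae_imp => x fx _; apply: cvg_EFin => //; exact: nearW.
have c2 : {ae mu, forall x n, setT x -> (`|(EFin \o f_ n) x| <= (EFin \o h) x)%E}.
  by apply: aeW => x n _; rewrite /= lee_fin.
have [fi _ h2] := @dominated_convergence _ _ _ mu setT measurableT _ _ _ m1 m2 c1 ih c2.
have fin : (\int[mu]_x (f x)%:E \is a fin_num)%E by exact: integrable_fin_num.
apply: fine_cvg; rewrite fineK//.
Qed.

Lemma cdominated_cvg (f_ : nat -> R -> C) f h :
  (forall n, cmeas (f_ n)) -> cmeas f ->
  {ae mu, forall x, normc (f_ n x - f x) @[n --> \oo] --> 0} ->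
  mu.-integrable setT (EFin \o h) ->
  (forall n x, normc (f_ n x) <= h x) ->
  normc (cint (f_ n) - cint f) @[n --> \oo] --> 0.
Proof.
move=> mf_ mf cf ih fh.
have hR : \int[mu]_x Re (f_ n x) @[n --> \oo] --> \int[mu]_x Re (f x).
  apply: (@Rdominated_cvg _ _ h) => //.
  - by move=> n; exact: (mf_ n).1.
  - exact: mf.1.
  - move: cf; apply: ae_imp => x fx; apply/cvgrPdist_le => e e0.
    move/cvgrPdist_le : fx => /(_ _ e0); apply: filterS => n.
    rewrite sub0r normrN; apply: le_trans.
    rewrite (ger0_norm (normc_ge0 _)) distrC.
    by have := Re_le_normc (f_ n x - f x); rewrite cReD cReN.
  - by move=> n x; apply: le_trans (fh n x); exact: Re_le_normc.
have hI : \int[mu]_x Im (f_ n x) @[n --> \oo] --> \int[mu]_x Im (f x).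
  apply: (@Rdominated_cvg _ _ h) => //.
  - by move=> n; exact: (mf_ n).2.
  - exact: mf.2.
  - move: cf; apply: ae_imp => x fx; apply/cvgrPdist_le => e e0.
    move/cvgrPdist_le : fx => /(_ _ e0); apply: filterS => n.
    rewrite sub0r normrN; apply: le_trans.
    rewrite (ger0_norm (normc_ge0 _)) distrC.
    by have := Im_le_normc (f_ n x - f x); rewrite cImD cImN.
  - by move=> n x; apply: le_trans (fh n x); exact: Im_le_normc.
apply: (@squeeze_cvgr _ _ _ _ (fun=> 0)
  (fun n => `|\int[mu]_x Re (f_ n x) - \int[mu]_x Re (f x)| +
            `|\int[mu]_x Im (f_ n x) - \int[mu]_x Im (f x)|)).
- apply: nearW => n; rewrite normc_ge0 andTb.
  by have := normc_le (cint (f_ n) - cint f); rewrite cReD cImD cReN cImN.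
- exact: cvg_cst.
- rewrite -[X in _ --> X](addr0 0); apply: cvgD.
    rewrite -(@normr0 _ R); apply: cvg_norm.
    by rewrite -(subrr (\int[mu]_x Re (f x))); apply: cvgB => //; exact: cvg_cst.
  rewrite -(@normr0 _ R); apply: cvg_norm.
  by rewrite -(subrr (\int[mu]_x Im (f x))); apply: cvgB => //; exact: cvg_cst.
Qed.

End ComplexIntegral.

(** * Reflection, Fubini and square-integrable functions *)

Section Reflection.
Context {R : realType}.
Local Notation C := R[i].
Local Notation mu := (@lebesgue_measure R).

Lemma measurable_refl (c : R) : measurable_fun setT (fun x : R => c - x).
Proof. by apply: measurable_funB => //; exact: measurable_cst. Qed.

Lemma lebesgue_measure_refl (c : R) (A : set R) : measurable A ->
  pushforward mu ((fun x : R => c - x) : _ -> measurableTypeR R) A = mu A.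
Proof.
move=> mA; apply/esym/lebesgue_measure_unique => //=.
  exact: measurable_refl.
move=> mr _ [[a b]] _ <-.
rewrite /pushforward/=.
rewrite (_ : _ @^-1` _ = `[c - b, c - a[%classic); last first.
  apply/seteqP; split => x /=; rewrite !in_itv/= => /andP[h1 h2]; apply/andP; split; lra.
rewrite !lebesgue_measure_itv/= !lte_fin.
rewrite (_ : (c - b < c - a) = (a < b)); last by apply/idP/idP; lra.
by case: ifP => // _; rewrite -!EFinD; congr EFin; lra.
Qed.

Lemma ge0_integral_refl (c : R) (f : R -> \bar R) : measurable_fun setT f ->
  (forall x, (0 <= f x)%E) ->
  (\int[mu]_x f (c - x)%R = \int[mu]_x f x)%E.
Proof.
move=> mf f0.
have <- := @ge0_integral_pushforward _ _ (measurableTypeR R) (measurableTypeR R)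
  R (fun x => c - x) (measurable_refl c) mu setT f measurableT mf (fun x _ => f0 x).
apply: eq_measure_integral => /= [|_ A mA _]; first exact: measurable_refl.
exact: lebesgue_measure_refl.
Qed.

Lemma integral_refl (c : R) (f : R -> \bar R) : measurable_fun setT f ->
  (\int[mu]_x f (c - x)%R = \int[mu]_x f x)%E.
Proof.
move=> mf; rewrite integralE [RHS]integralE.
congr (_ - _)%E.
  rewrite -(ge0_integral_refl c (measurable_funepos mf) (fun x => funepos_ge0 _ _)).
  by apply: eq_integral => x _; rewrite !funeposE.
rewrite -(ge0_integral_refl c (measurable_funeneg mf) (fun x => funeneg_ge0 _ _)).
by apply: eq_integral => x _; rewrite !funenegE.
Qed.

Lemma Rintegral_refl (c : R) (f : R -> R) : measurable_fun setT f ->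
  \int[mu]_x f (c - x) = \int[mu]_x f x.
Proof.
by move=> mf; rewrite /Rintegral (integral_refl c (f := EFin \o f))//; exact/measurable_EFinP.
Qed.

Lemma cint_refl (c : R) (f : R -> C) : cmeas f ->
  cint (fun x => f (c - x)) = cint f.
Proof.
move=> [f1 f2]; apply: eq_ReIm => /=.
  exact: (Rintegral_refl c f1).
exact: (Rintegral_refl c f2).
Qed.

Lemma integrable_refl (c : R) (f : R -> R) : mu.-integrable setT (EFin \o f) ->
  mu.-integrable setT (EFin \o (fun x => f (c - x))).
Proof.
move=> /integrableP[mf i]; have {}mf : measurable_fun setT f by exact/measurable_EFinP.
apply/integrableP; split.
  by apply/measurable_EFinP; exact: measurableT_comp mf (measurable_refl c).
rewrite /= (ge0_integral_refl c (f := fun x => `|(EFin \o f) x|%E))//.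
by apply: measurableT_comp => //; exact/measurable_EFinP.
Qed.

Lemma cintble_refl (c : R) (f : R -> C) : cintble f -> cintble (fun x => f (c - x)).
Proof.
move=> [mf i]; split; first exact: cmeas_comp (measurable_refl c) mf.
exact: (integrable_refl c i).
Qed.

End Reflection.

Section Fubini.
Context {R : realType}.
Local Notation C := R[i].
Local Notation Re := complex.Re.
Local Notation Im := complex.Im.
Local Notation mu := (@lebesgue_measure R).

Section real.
Variables (f : R -> R -> R) (k : R -> R).
Hypothesis mf : measurable_fun setT (fun z : R * R => f z.1 z.2).
Hypothesis ik : mu.-integrable setT (EFin \o k).
Hypothesis fk : forall x, (\int[mu]_y `|(f x y)%:E| <= (k x)%:E)%E.

Let F (z : measurableTypeR R * measurableTypeR R) := (f z.1 z.2)%:E.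

Let mF : measurable_fun setT F.
Proof. exact/measurable_EFinP. Qed.

Let iF : (mu \x mu)%E.-integrable setT F.
Proof.
apply/(@integrable12ltyP _ _ (measurableTypeR R) (measurableTypeR R) R mu mu F mF).
move/integrableP : ik => [mk]; apply: le_lt_trans; apply: ge0_le_integral => //.
- by move=> x _; exact: integral_ge0.
- apply: (measurable_fun_fubini_tonelli_F (m2 := mu) (abse \o F)) => //=.
  exact: measurableT_comp.
- exact: measurableT_comp.
- by move=> x _; rewrite (le_trans (fk x))// lee_abs.
Qed.

Lemma Rintegrable_slice x : mu.-integrable setT (EFin \o f x).
Proof.
apply/integrableP; split; last exact: le_lt_trans (fk x) (ltry _).
exact: (measurableT_comp mF (pair1_measurable x)).
Qed.

Lemma measurable_Rint1 : measurable_fun setT (fun x => \int[mu]_y f x y).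
Proof.
exact: (measurableT_comp (fine_measurable measurableT) (measurable_fubini_F iF)).
Qed.

Lemma measurable_Rint2 : measurable_fun setT (fun y => \int[mu]_x f x y).
Proof.
exact: (measurableT_comp (fine_measurable measurableT) (measurable_fubini_G iF)).
Qed.

Lemma Rfubini :
  \int[mu]_x \int[mu]_y f x y = \int[mu]_y \int[mu]_x f x y.
Proof.
rewrite /Rintegral; congr fine.
under eq_integral => x _.
  rewrite fineK; last exact: (integrable_fin_num measurableT (Rintegrable_slice x)).
  over.
rewrite (@Fubini _ _ _ _ _ mu mu F iF).
apply: ae_eq_integral => //.
- exact: measurable_fubini_G iF.
- by apply/measurable_EFinP; exact: measurable_Rint2.
- have := ae_integrable2 iF; apply: ae_imp => y iy _.
  by rewrite fineK//; exact: (integrable_fin_num measurableT iy).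
Qed.

End real.

Variables (K : R -> R -> C) (k : R -> R).
Hypothesis mK : cmeas (fun z : R * R => K z.1 z.2).
Hypothesis ik : mu.-integrable setT (EFin \o k).
Hypothesis Kk : forall x, (\int[mu]_y (normc (K x y))%:E <= (k x)%:E)%E.

Let mK1 x : cmeas (K x).
Proof. exact: (cmeas_comp (pair1_measurable x) mK). Qed.

Let KRe x : (\int[mu]_y `|(Re (K x y))%:E| <= (k x)%:E)%E.
Proof.
apply: le_trans (Kk x); apply: ge0_le_integral => //.
- by apply: measurableT_comp => //; apply/measurable_EFinP; exact: (mK1 x).1.
- by apply/measurable_EFinP; exact: measurable_normc (mK1 x).
- by move=> y _; rewrite lee_fin Re_le_normc.
Qed.

Let KIm x : (\int[mu]_y `|(Im (K x y))%:E| <= (k x)%:E)%E.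
Proof.
apply: le_trans (Kk x); apply: ge0_le_integral => //.
- by apply: measurableT_comp => //; apply/measurable_EFinP; exact: (mK1 x).2.
- by apply/measurable_EFinP; exact: measurable_normc (mK1 x).
- by move=> y _; rewrite lee_fin Im_le_normc.
Qed.

Lemma cintble_slice x : cintble (K x).
Proof.
apply: cintbleP.
- exact: (Rintegrable_slice mK.1 KRe).
- exact: (Rintegrable_slice mK.2 KIm).
Qed.

Lemma cmeas_cint1 : cmeas (fun x => cint (K x)).
Proof.
split.
- exact: (measurable_Rint1 mK.1 ik KRe).
- exact: (measurable_Rint1 mK.2 ik KIm).
Qed.

Lemma cmeas_cint2 : cmeas (fun y => cint (K ^~ y)).
Proof.
split.
- exact: (measurable_Rint2 mK.1 ik KRe).
- exact: (measurable_Rint2 mK.2 ik KIm).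
Qed.

Lemma cfubini : cint (fun x => cint (K x)) = cint (fun y => cint (K ^~ y)).
Proof.
apply: eq_ReIm => /=.
- exact: (Rfubini mK.1 ik KRe).
- exact: (Rfubini mK.2 ik KIm).
Qed.

Lemma normc_cint1 x : normc (cint (K x)) <= k x.
Proof.
apply: (le_trans (normc_cint (cintble_slice x))).
rewrite -lee_fin /Rintegral fineK//.
exact: (integrable_fin_num measurableT (cintble_slice x).2).
Qed.

Lemma cintble_cint1 : cintble (fun x => cint (K x)).
Proof. exact: (cintble_le cmeas_cint1 ik normc_cint1). Qed.

End Fubini.

Section L2.
Context {R : realType}.
Local Notation C := R[i].
Local Notation mu := (@lebesgue_measure R).
Implicit Types (f g : R -> C).

Definition cL2 f : Prop :=
  cmeas f /\ mu.-integrable setT (EFin \o (fun x => normc (f x) ^+ 2)).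

Definition sqn f : R := \int[mu]_x (normc (f x) ^+ 2).

Lemma sqn_ge0 f : 0 <= sqn f.
Proof. by apply: Rintegral_ge0 => x _; exact: sqr_ge0. Qed.

Lemma cL2_le f (h : R -> R) : cmeas f -> mu.-integrable setT (EFin \o h) ->
  (forall x, normc (f x) ^+ 2 <= h x) -> cL2 f.
Proof.
move=> mf ih fh; split=> //; apply: (le_integrable measurableT _ _ ih).
  by apply/measurable_EFinP; exact: measurable_normc_sqr.
move=> x _; rewrite /= lee_fin ger0_norm ?sqr_ge0//.
by rewrite (le_trans (fh x))// ler_norm.
Qed.

Lemma le_sqn f (h : R -> R) : cL2 f -> mu.-integrable setT (EFin \o h) ->
  (forall x, normc (f x) ^+ 2 <= h x) -> sqn f <= \int[mu]_x h x.
Proof. by move=> [mf jf] ih fh; apply: le_Rintegral. Qed.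

Lemma cL2_bnd (M : R) f g : cmeas f -> cL2 g ->
  (forall x, normc (f x) <= M * normc (g x)) -> cL2 f.
Proof.
move=> mf [mg ig] fg; apply: (@cL2_le _ (fun x => M ^+ 2 * normc (g x) ^+ 2)) => //.
  exact: (integrableZl measurableT (M ^+ 2) ig).
move=> x; rewrite -exprMn lerXn2r ?nnegrE ?normc_ge0//.
by rewrite (le_trans _ (fg x))// normc_ge0.
Qed.

Lemma sqn_bnd (M : R) f g : cL2 f -> cL2 g ->
  (forall x, normc (f x) <= M * normc (g x)) -> sqn f <= M ^+ 2 * sqn g.
Proof.
move=> hf hg fg; rewrite /sqn -RintegralZl//; last exact: hg.2.
apply: le_sqn => //; first exact: (integrableZl measurableT (M ^+ 2) hg.2).
move=> x; rewrite -exprMn lerXn2r ?nnegrE ?normc_ge0//.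
by rewrite (le_trans _ (fg x))// normc_ge0.
Qed.

Lemma eq_sqn f g : (forall x, normc (f x) = normc (g x)) -> sqn f = sqn g.
Proof. by move=> fg; apply: eq_Rintegral => x _; rewrite fg. Qed.

Lemma cL2Mb (M : R) f g : cmeas f -> (forall x, normc (f x) <= M) -> cL2 g ->
  cL2 (fun x => f x * g x).
Proof.
move=> mf fM hg; apply: (cL2_bnd (M := M) _ hg); first exact: cmeasM hg.1.
by move=> x; rewrite normcM ler_wpM2r// normc_ge0.
Qed.

Lemma cL2Z (c : C) f : cL2 f -> cL2 (fun x => c * f x).
Proof. by apply: (@cL2Mb (normc c)) => //; exact: cmeas_cst. Qed.

Lemma sqnZ (c : C) f : cL2 f -> sqn (fun x => c * f x) = normc c ^+ 2 * sqn f.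
Proof.
move=> [mf jf]; rewrite /sqn -RintegralZl//.
by apply: eq_Rintegral => x _; rewrite normcM exprMn.
Qed.

Lemma normcD_sqr (z w : C) : normc (z + w) ^+ 2 <= 2 * normc z ^+ 2 + 2 * normc w ^+ 2.
Proof.
have h := le_normcD z w; have h0 := normc_ge0 (z + w).
apply: (@le_trans _ _ ((normc z + normc w) ^+ 2)).
  by rewrite lerXn2r ?nnegrE ?addr_ge0 ?normc_ge0.
by have := sqr_ge0 (normc z - normc w); lra.
Qed.

Lemma cL2D f g : cL2 f -> cL2 g -> cL2 (fun x => f x + g x).
Proof.
move=> [mf jf] [mg ig].
apply: (@cL2_le _ (fun x => 2 * normc (f x) ^+ 2 + 2 * normc (g x) ^+ 2)).
- exact: cmeasD.
- exact: (integrableD measurableT (integrableZl measurableT 2 jf) (integrableZl measurableT 2 ig)).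
- by move=> x; exact: normcD_sqr.
Qed.

Lemma sqnD f g : cL2 f -> cL2 g ->
  sqn (fun x => f x + g x) <= 2 * sqn f + 2 * sqn g.
Proof.
move=> hf hg; have [mf jf] := hf; have [mg ig] := hg.
have i1 := integrableZl measurableT 2 jf.
have i2 := integrableZl measurableT 2 ig.
rewrite /sqn -!RintegralZl// -RintegralD//.
apply: le_sqn; first exact: cL2D.
  exact: (integrableD measurableT i1 i2).
by move=> x; exact: normcD_sqr.
Qed.

Lemma cL2N f : cL2 f -> cL2 (fun x => - f x).
Proof. by move=> /(cL2Z (-1)); under eq_fun do rewrite mulN1r. Qed.

Lemma cL2B f g : cL2 f -> cL2 g -> cL2 (fun x => f x - g x).
Proof. by move=> hf hg; apply: cL2D => //; exact: cL2N. Qed.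

Lemma sqnB f g : cL2 f -> cL2 g ->
  sqn (fun x => f x - g x) <= 2 * sqn f + 2 * sqn g.
Proof.
move=> hf hg; apply: (le_trans (sqnD hf (cL2N hg))).
by rewrite (@eq_sqn (fun x => - g x) g)// => x; rewrite normcN.
Qed.

Lemma cintbleM f g : cL2 f -> cL2 g -> cintble (fun x => f x * g x).
Proof.
move=> [mf jf] [mg ig].
apply: (@cintble_le _ _ (fun x => 2^-1 * (normc (f x) ^+ 2 + normc (g x) ^+ 2))).
- exact: cmeasM.
- exact: (integrableZl measurableT 2^-1 (integrableD measurableT jf ig)).
- by move=> x; rewrite normcM; have := sqr_ge0 (normc (f x) - normc (g x)); lra.
Qed.

Lemma normc_cintM_le (t : R) f g : 0 < t -> cL2 f -> cL2 g ->
  normc (cint (fun x => f x * g x)) <= 2^-1 * (t * sqn f + t^-1 * sqn g).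
Proof.
move=> t0 hf hg; have [mf jf] := hf; have [mg ig] := hg.
apply: (le_trans (normc_cint (cintbleM hf hg))).
have i1 := integrableZl measurableT t jf.
have i2 := integrableZl measurableT t^-1 ig.
have i3 := integrableD measurableT i1 i2.
rewrite /sqn -!RintegralZl// -RintegralD// -RintegralZl//.
apply: le_Rintegral => //.
- exact: (cintble_norm (cintbleM hf hg)).
- exact: (integrableZl measurableT 2^-1 i3).
- move=> x _ /=; rewrite normcM; move: (normc (f x)) (normc (g x)) => u v.
  have h : 0 <= t * (u - t^-1 * v) ^+ 2 by rewrite mulr_ge0 ?sqr_ge0// ltW.
  suff : t * (u - t^-1 * v) ^+ 2 = t * u ^+ 2 + t^-1 * v ^+ 2 - 2 * (u * v) by lra.
  by field; rewrite gt_eqF.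
Qed.

Lemma normc_cintM_sqr f g : cL2 f -> cL2 g ->
  normc (cint (fun x => f x * g x)) ^+ 2 <= sqn f * sqn g.
Proof.
move=> hf hg; have H t := @normc_cintM_le t f g ^~ hf ^~ hg.
have A0 := sqn_ge0 f; have B0 := sqn_ge0 g.
move: (normc_ge0 (cint (fun x => f x * g x))) H.
move: (normc _) (sqn f) (sqn g) A0 B0 => I A B A0 B0.
rewrite le_eqVlt => /predU1P[<- _|I0 H].
  by rewrite expr0n mulr_ge0.
have {}H t : 0 < t -> 2 * I <= t * A + t^-1 * B by move=> /H; lra.
have [A00|An0] := eqVneq A 0.
  have t0 : 0 < (B + 1) / I by rewrite divr_gt0//; lra.
  have := H _ t0; rewrite A00 mulr0 add0r invf_div => h.
  have : 2 * I * (B + 1) <= I / (B + 1) * B * (B + 1) by rewrite ler_pM2r//; lra.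
  have -> : I / (B + 1) * B * (B + 1) = I * B by field; lra.
  nra.
have Ap : 0 < A by rewrite lt0r An0.
have := H (I / A) (divr_gt0 I0 Ap); rewrite divfK// invf_div => h.
have : 2 * I * I <= (I + A / I * B) * I by rewrite ler_pM2r.
have -> : (I + A / I * B) * I = I ^+ 2 + A * B by field; rewrite gt_eqF.
nra.
Qed.

Lemma cL2_refl (c : R) f : cL2 f -> cL2 (fun x => f (c - x)).
Proof.
move=> [mf jf]; split; first exact: cmeas_comp (measurable_refl c) mf.
exact: (integrable_refl c jf).
Qed.

Lemma sqn_refl (c : R) f : cmeas f -> sqn (fun x => f (c - x)) = sqn f.
Proof.
by move=> mf; rewrite /sqn (Rintegral_refl c (measurable_normc_sqr mf)).
Qed.

Lemma cL2_itv (a b : R) : cL2 (cind `]a, b[).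
Proof.
apply: (@cL2_le _ (\1_`]a, b[)).
- by apply: cmeas_ind.
- exact: integrable_indic_itv.
- by move=> x; rewrite normc_real indicE; case: (_ \in _); rewrite ?normr1 ?normr0 ?expr1n ?expr0n.
Qed.

Lemma sqn_itv (a b : R) : a <= b -> sqn (cind `]a, b[) = b - a.
Proof.
move=> ab; rewrite /sqn.
under eq_Rintegral => x _.
  rewrite (_ : _ ^+ 2 = \1_`]a, b[ x); last first.
    by rewrite normc_real indicE; case: (_ \in _); rewrite ?normr1 ?normr0 ?expr1n ?expr0n.
  over.
rewrite /Rintegral integral_indic// setIT.
have h := @lebesgue_measure_itv R `]a, b[; rewrite [X in fine X]h /= lte_fin.
by case: ltP => //= ba; lra.
Qed.

Lemma cintble_itv (a b : R) f : cL2 f -> cintble (fun x => cind `]a, b[ x * f x).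
Proof. by move=> hf; apply: cintbleM => //; exact: cL2_itv. Qed.

End L2.

(** * Integrals of exponentials and trigonometric polynomials *)

Section ExponentialIntegral.
Context {R : realType}.
Local Notation C := R[i].
Local Notation Re := complex.Re.
Local Notation Im := complex.Im.
Local Notation mu := (@lebesgue_measure R).

Lemma Re_cexpM (c : C) (t : R) :
  Re (cexp (c * t%:C)) = expR (Re c * t) * cos (Im c * t).
Proof. by rewrite /cexp /= cReM cImM/= !mulr0 subr0 add0r. Qed.

Lemma Im_cexpM (c : C) (t : R) :
  Im (cexp (c * t%:C)) = expR (Re c * t) * sin (Im c * t).
Proof. by rewrite /cexp /= cReM cImM/= !mulr0 subr0 add0r. Qed.

Lemma Rintegral_ind (a b : R) (f : R -> R) : measurable_fun setT f ->
  \int[mu]_x (\1_`]a, b[ x * f x) = \int[mu]_(x in `[a, b]) f x.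
Proof.
move=> mf; transitivity (\int[mu]_(x in `]a, b[) f x).
  rewrite [RHS]Rintegral_mkcond; apply: eq_Rintegral => x _.
  by rewrite indicE patchE; case: (_ \in _); rewrite ?mul1r ?mul0r.
rewrite /Rintegral; congr fine.
have m1 D : measurable_fun D (EFin \o f).
  by apply/measurable_EFinP; exact: measurable_funTS.
by rewrite [RHS]integral_itv_bndoo; [|exact: m1].
Qed.

Lemma RFTC (a b : R) (f F : R -> R) : a <= b -> continuous f ->
  (forall x : R, is_derive x (1 : R) F (f x)) ->
  \int[mu]_x (\1_`]a, b[ x * f x) = F b - F a.
Proof.
move=> ab cf dF; rewrite Rintegral_ind; last exact: continuous_measurable_fun.
move: ab; rewrite le_eqVlt => /predU1P[->|ab].
  by rewrite subrr set_itv1 Rintegral_set1.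
have cF : continuous F.
  move=> x; apply: differentiable_continuous; apply/derivable1_diffP.
  exact: ex_derive.
rewrite /Rintegral (@continuous_FTC2 _ f F)//.
- exact: continuous_subspaceT.
- split => //.
  + by apply: cvg_at_right_filter; exact: cF.
  + by apply: cvg_at_left_filter; exact: cF.
- by move=> x _; rewrite derive1E derive_val.
Qed.

Lemma cmeas_cexpM (c : C) : cmeas (fun t : R => cexp (c * t%:C)).
Proof. by apply: cmeas_cexp; apply: cmeasZ; exact: cmeas_real. Qed.

Lemma cint_cexp (c : C) (a b : R) : a <= b ->
  cint (fun t => cind `]a, b[ t * (c * cexp (c * t%:C))) =
  cexp (c * b%:C) - cexp (c * a%:C).
Proof.
move=> ab; pose p := Re c; pose q := Im c.
have ccos : continuous (fun t : R => cos (q * t)).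
  move=> t; apply: continuous_comp; last exact: continuous_cos.
  exact: mulrl_continuous.
have csin : continuous (fun t : R => sin (q * t)).
  move=> t; apply: continuous_comp; last exact: continuous_sin.
  exact: mulrl_continuous.
have cexp' : continuous (fun t : R => expR (p * t)).
  move=> t; apply: continuous_comp; last exact: continuous_expR.
  exact: mulrl_continuous.
have dcos (t : R) : is_derive t (1 : R) (fun t : R => expR (p * t) * cos (q * t))
    (p * (expR (p * t) * cos (q * t)) - q * (expR (p * t) * sin (q * t))).
  by apply: is_derive_eq; rewrite /GRing.scale/=; ring.
have dsin (t : R) : is_derive t (1 : R) (fun t : R => expR (p * t) * sin (q * t))
    (p * (expR (p * t) * sin (q * t)) + q * (expR (p * t) * cos (q * t))).
  by apply: is_derive_eq; rewrite /GRing.scale/=; ring.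
have c1 : continuous (fun t : R => p * (expR (p * t) * cos (q * t)) - q * (expR (p * t) * sin (q * t))).
  by move=> t; apply: cvgB; apply: cvgMl_tmp; apply: cvgM; [exact: cexp'|exact: ccos|exact: cexp'|exact: csin].
have c2 : continuous (fun t : R => p * (expR (p * t) * sin (q * t)) + q * (expR (p * t) * cos (q * t))).
  by move=> t; apply: cvgD; apply: cvgMl_tmp; apply: cvgM; [exact: cexp'|exact: csin|exact: cexp'|exact: ccos].
apply: eq_ReIm; rewrite ?(cReD, cImD, cReN, cImN, Re_cexpM, Im_cexpM).
  have <- := RFTC ab c1 dcos.
  by apply: eq_Rintegral => t _; rewrite !cReM cImM Re_cexpM Im_cexpM mul0r subr0.
have <- := RFTC ab c2 dsin.
by apply: eq_Rintegral => t _; rewrite !cImM cReM Re_cexpM Im_cexpM mul0r addr0.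
Qed.

End ExponentialIntegral.

Section Trigonometric.
Context {R : realType}.
Local Notation C := R[i].
Local Notation Re := complex.Re.
Local Notation Im := complex.Im.
Local Notation mu := (@lebesgue_measure R).
Implicit Types (m n : int) (t : R) (u w g : R -> C).

Definition en n t : C := cexp ('i * (2 * n%:~R * t)%:C).

Lemma enD m n t : en (m + n) t = en m t * en n t.
Proof.
by rewrite /en -cexpD -mulrDr -rmorphD/= intrD; congr (cexp (_ * _%:C)); ring.
Qed.

Lemma en0 t : en 0 t = 1.
Proof. by rewrite /en mulr0z mulr0 mul0r mulr0 cexp0. Qed.

Lemma normc_en n t : normc (en n t) = 1.
Proof. exact: normc_cexp_im. Qed.

Lemma Re_en n t : Re (en n t) = cos (2 * n%:~R * t).
Proof. by rewrite /en Re_cexpM/= mul0r expR0 !mul1r. Qed.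

Lemma Im_en n t : Im (en n t) = sin (2 * n%:~R * t).
Proof. by rewrite /en Im_cexpM/= mul0r expR0 !mul1r. Qed.

Lemma en_conj n t : (en n t)^* = en (- n) t.
Proof.
have h : 2 * (- n)%:~R * t = - (2 * n%:~R * t) by rewrite intrN mulrN mulNr.
apply: eq_ReIm; rewrite ?(Re_en, Im_en) h ?(cosN, sinN) -?Re_en -?Im_en.
  by case: (en n t).
by case: (en n t).
Qed.

Lemma en_pi n : en n pi = 1.
Proof.
have e1 : en 1 pi = 1.
  by apply: eq_ReIm; rewrite ?(Re_en, Im_en) mulr1 [2 * pi]mulrC mulr_natr ?(cos2pi, sin2pi).
elim/int_rec: n => [|n IH|n IH]; first exact: en0.
  by rewrite -addn1 PoszD enD IH e1 mulr1.
have h : en (- (n.+1)%:Z) pi * en 1 pi = 1.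
  by rewrite -[RHS]IH -enD; congr (en _ pi); rewrite -addn1 PoszD opprD subrK.
by move: h; rewrite e1 mulr1.
Qed.

Lemma cmeas_en n : cmeas (en n).
Proof.
rewrite /en; apply: cmeas_cexp; apply: cmeasZ; apply: cmeas_real.
by apply: measurable_funM => //; exact: measurable_cst.
Qed.

Local Notation I0 := (`]0, (pi : R)[%classic).

Lemma cL2_indM (a b M : R) g : cmeas g -> (forall t, normc (g t) <= M) ->
  cL2 (fun t => cind `]a, b[ t * g t).
Proof.
move=> mg gM; apply: (cL2_bnd (M := M) _ (cL2_itv a b)).
  by apply: cmeasM => //; apply: cmeas_ind.
by move=> t; rewrite normcM mulrC ler_wpM2r// normc_ge0.
Qed.

Lemma cintble_indM (a b M : R) g : cmeas g -> (forall t, normc (g t) <= M) ->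
  cintble (fun t => cind `]a, b[ t * g t).
Proof.
move=> mg gM; have := cintbleM (cL2_itv a b) (cL2_indM a b mg gM).
rewrite (_ : (fun t => _ * (_ * _)) = (fun t => cind `]a, b[ t * g t))//.
by apply/funext => t; rewrite cindE; case: ifP; rewrite ?mul1r ?mul0r.
Qed.

Lemma cint_ind (a b : R) : a <= b -> cint (fun t => cind `]a, b[ t) = (b - a)%:C.
Proof.
move=> ab; apply: eq_ReIm => /=; last by rewrite /Rintegral integral0.
rewrite -(sqn_itv ab); apply: eq_Rintegral => t _.
by rewrite normc_real indicE; case: (_ \in _); rewrite ?normr1 ?normr0 ?expr1n ?expr0n.
Qed.

Lemma cint_en n : cint (fun t => cind I0 t * en n t) = if n == 0 then pi%:C else 0.
Proof.
have pi0 := pi_ge0 R.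
have [->|n0] := eqVneq n 0.
  rewrite -[in RHS](subr0 pi) -cint_ind//.
  by apply: eq_cint => t; rewrite en0 mulr1.
pose c : C := 'i * (2 * n%:~R)%:C.
have c0 : c != 0.
  rewrite mulf_eq0; apply/norP; split.
    by apply/eqP => /(congr1 (@Im R)) /= /eqP; rewrite oner_eq0.
  apply/eqP => /(congr1 (@Re R)) /= /eqP; rewrite mulf_eq0 intr_eq0 (negPf n0) orbF.
  by rewrite pnatr_eq0.
have enE t : en n t = cexp (c * t%:C) by rewrite /en rmorphM/= mulrA.
have := @cint_cexp R c 0 pi pi0; rewrite -!enE en_pi.
rewrite (_ : en n 0 = 1); last by rewrite /en !mulr0 cexp0.
rewrite subrr => h.
apply: (mulfI c0); rewrite mulr0 -h -cintZ.
  by apply: eq_cint => t; rewrite enE mulrCA.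
by apply: (@cintble_indM _ _ 1) => [|t]; [exact: cmeas_en|rewrite normc_en].
Qed.

Lemma sqn_cint g : cL2 g -> (sqn g)%:C = cint (fun t => g t * (g t)^*).
Proof.
move=> [mg _]; apply: eq_ReIm => /=.
  by apply: eq_Rintegral => t _; rewrite mulcJ.
by rewrite /Rintegral; under eq_integral do rewrite mulcJ/=; rewrite integral0.
Qed.

Definition trigpoly (s : seq int) (b : int -> C) (t : R) : C :=
  \sum_(n <- s) b n * en n t.

Lemma cmeas_trigpoly s b : cmeas (trigpoly s b).
Proof. by apply: cmeas_sum => n; apply: cmeasZ; exact: cmeas_en. Qed.

Lemma normc_trigpoly s b t : normc (trigpoly s b t) <= \sum_(n <- s) normc (b n).
Proof.
apply: (le_trans (normc_sum _ _)).
by apply: ler_sum => n _; rewrite normcM normc_en mulr1.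
Qed.

Lemma sqn_trigpoly s b : uniq s ->
  sqn (fun t => cind I0 t * trigpoly s b t) = pi * \sum_(n <- s) normc (b n) ^+ 2.
Proof.
move=> us; apply: complexI.
rewrite sqn_cint; last exact: cL2_indM (cmeas_trigpoly s b) (normc_trigpoly s b).
transitivity (cint (fun t => \sum_(n <- s) \sum_(m <- s)
    b n * (b m)^* * (cind I0 t * en (n - m) t))).
  apply: eq_cint => t; rewrite rmorphM/= mulrACA.
  have -> : cind I0 t * (cind I0 t)^* = cind I0 t.
    by rewrite cindE; case: ifP => _; rewrite ?mul0r// mul1r rmorph1.
  rewrite /trigpoly rmorph_sum/= mulr_suml mulr_sumr; apply: eq_bigr => n _.
  rewrite !mulr_sumr; apply: eq_bigr => m _.
  by rewrite rmorphM/= en_conj enD; ring.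
have i1 (n m : int) : cintble (fun t => b n * (b m)^* * (cind I0 t * en (n - m) t)).
  apply: cintbleZ; apply: (@cintble_indM _ _ 1) => [|t]; first exact: cmeas_en.
  by rewrite normc_en.
rewrite cint_sum; last by move=> n; apply: cintble_sum => m.
rewrite rmorphM rmorph_sum/= mulr_sumr; apply: eq_big_seq => n ns.
rewrite cint_sum// (bigD1_seq n)//= big1 ?addr0 => [|m mn].
  rewrite cintZ; last first.
    apply: (@cintble_indM _ _ 1) => [|t]; first exact: cmeas_en.
    by rewrite normc_en.
  by rewrite cint_en subrr eqxx mulcJ mulrC.
rewrite cintZ; last first.
  apply: (@cintble_indM _ _ 1) => [|t]; first exact: cmeas_en.
  by rewrite normc_en.
by rewrite cint_en subr_eq0 eq_sym (negPf mn) mulr0.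
Qed.

Lemma cint_trigpoly u s b : cL2 u ->
  cint (fun t => u t * (cind I0 t * trigpoly s b t)) =
  \sum_(n <- s) b n * cint (fun t => u t * (cind I0 t * en n t)).
Proof.
move=> hu.
have i1 n : cintble (fun t => u t * (cind I0 t * en n t)).
  apply: cintbleM => //; apply: (@cL2_indM _ _ 1) => [|t]; first exact: cmeas_en.
  by rewrite normc_en.
transitivity (\sum_(n <- s) cint (fun t => b n * (u t * (cind I0 t * en n t)))).
  rewrite -cint_sum => [|n]; last exact: cintbleZ.
  apply: eq_cint => t; rewrite /trigpoly !mulr_sumr; apply: eq_bigr => n _; ring.
by apply: eq_bigr => n _; rewrite cintZ.
Qed.

Definition fcoef u n : C := cint (fun t => u t * (cind I0 t * en n t)).

Lemma bessel g s : cL2 g -> uniq s ->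
  \sum_(n <- s) normc (fcoef g n) ^+ 2 <= pi * sqn g.
Proof.
move=> hg us; have pi0 := pi_gt0 R.
pose b n := (fcoef g n)^*.
have h := cint_trigpoly s b hg.
have hP := cL2_indM 0 pi (cmeas_trigpoly s b) (normc_trigpoly s b).
have := normc_cintM_le pi0 hg hP; rewrite sqn_trigpoly// h mulKf ?gt_eqF//.
set S := \sum_(n <- s) normc (fcoef g n) ^+ 2.
have -> : \sum_(n <- s) b n * cint (fun t => g t * (cind I0 t * en n t)) = S%:C.
  rewrite rmorph_sum/=; apply: eq_bigr => n _.
  by rewrite /b mulrC mulcJ.
have -> : \sum_(n <- s) normc (b n) ^+ 2 = S.
  by apply: eq_bigr => n _; rewrite normc_conj.
rewrite normc_real => H; have := ler_norm S; lra.
Qed.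

Lemma cvg0_sum_bounded (a : nat -> R) (B : R) : (forall k, 0 <= a k) ->
  (forall N, \sum_(0 <= k < N) a k <= B) -> a k @[k --> \oo] --> 0.
Proof.
move=> a0 aB; apply: cvg_series_cvg_0; apply: nondecreasing_is_cvgn.
  by apply: nondecreasing_series => k _ _; exact: a0.
by exists B => _ [N _ <-]; exact: aB.
Qed.

Lemma fcoef_cvg0 g (f : nat -> int) : cL2 g -> injective f ->
  normc (fcoef g (f k)) @[k --> \oo] --> 0.
Proof.
move=> hg fI.
have h : normc (fcoef g (f k)) ^+ 2 @[k --> \oo] --> 0.
  apply: (@cvg0_sum_bounded _ (pi * sqn g)) => [k|N]; first exact: sqr_ge0.
  have us : uniq (map f (iota 0 N)) by rewrite map_inj_uniq// iota_uniq.
  have := bessel hg us; rewrite big_map => H.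
  by rewrite /index_iota subn0.
rewrite -sqrtr0 (_ : (fun _ => _) = Num.sqrt \o (fun k => normc (fcoef g (f k)) ^+ 2)).
  by apply: continuous_cvg => //; exact: sqrt_continuous.
by apply/funext => k /=; rewrite sqrtr_sqr ger0_norm// normc_ge0.
Qed.

Definition symmetric_range (N : nat) : seq int := [seq k%:Z - N%:Z | k <- iota 0 (2 * N).+1].

Lemma symmetric_range_uniq N : uniq (symmetric_range N).
Proof. by rewrite map_inj_uniq ?iota_uniq// => x y /addIr []. Qed.

Lemma mem0_symmetric_range N : 0 \in symmetric_range N.
Proof.
apply/mapP; exists N; last by rewrite subrr.
by rewrite mem_iota add0n leq0n ltnS leq_pmull.
Qed.

Lemma telescope_symmetric_range (T : int -> C) N :
  \sum_(n <- symmetric_range N) (T (n + 1) - T n) = T (N%:Z + 1) - T (- N%:Z).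
Proof.
rewrite big_map (_ : iota 0 _ = index_iota 0 (2 * N).+1); last by rewrite /index_iota subn0.
rewrite (eq_bigr (fun k => T (k.+1%:Z - N%:Z) - T (k%:Z - N%:Z))); last first.
  by move=> k _; congr (T _ - _); rewrite -addn1 PoszD addrAC.
rewrite (telescope_sumr (fun k => T (k%:Z - N%:Z)))//= sub0r.
congr (T _ - _); rewrite -addn1 mul2n -addnn !PoszD; ring.
Qed.

End Trigonometric.

(** * Completeness of the trigonometric system *)

Section Parseval.
Context {R : realType}.
Local Notation C := R[i].
Local Notation Re := complex.Re.
Local Notation Im := complex.Im.
Local Notation mu := (@lebesgue_measure R).
Local Notation I0 := (`]0, (pi : R)[%classic).
Implicit Types (m n : int) (t : R) (u w g : R -> C).

Let I0P x : I0 x -> 0 < x < pi.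
Proof. by rewrite /= in_itv. Qed.

Lemma invc_conj (z : C) : z^-1 = ((normc z)^-1 ^+ 2)%:C * z^*.
Proof.
have [->|z0] := eqVneq z 0; first by rewrite invr0 rmorph0 mulr0.
apply: (mulfI z0); rewrite divff// mulrCA mulcJ -rmorphM/= -exprMn mulVf ?expr1n//.
by apply/eqP => /eq0_normc/eqP; rewrite (negPf z0).
Qed.

Lemma cmeas_inv d (T : measurableType d) (f : T -> C) :
  cmeas f -> cmeas (fun x => (f x)^-1).
Proof.
move=> mf; under eq_fun do rewrite invc_conj.
apply: cmeasM; last exact: cmeas_conj.
apply: cmeas_real; apply: measurable_funX.
rewrite (_ : (fun _ => _) = (fun x => normc (f x) `^ (-1))).
  exact: measurableT_comp (measurable_powR (-1)) (measurable_normc mf).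
by apply/funext => x; rewrite powR_inv1// normc_ge0.
Qed.

Lemma le_of_cvg0 (e : nat -> R) (A B : R) : e k @[k --> \oo] --> 0 ->
  (forall k, A <= e k + B) -> A <= B.
Proof.
move=> e0 AB; apply/ler_addgt0Pr => eps eps0.
move/cvgrPdist_le : e0 => /(_ _ eps0)[K _ /(_ K (leqnn K))].
rewrite /= sub0r normrN => h.
have := AB K; have := ler_norm (e K); lra.
Qed.

Lemma normc_enB1 (x t : R) : I0 x -> I0 t ->
  Num.min `|t - x| (pi - `|t - x|) <= normc (en 1 t - en 1 x).
Proof.
move=> /I0P/andP[x0 xpi] /I0P/andP[t0 tpi].
have -> : en 1 t - en 1 x = en 1 x * (cexp ('i * (2 * (t - x))%:C) - 1).
  rewrite mulrBr mulr1; congr (_ - _); rewrite /en -cexpD -mulrDr -rmorphD/=.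
  by congr (cexp (_ * _%:C)); ring.
have dpi : `|t - x| <= pi by rewrite ler_norml; apply/andP; split; lra.
have sE : `|sin (t - x)| = sin `|t - x|.
  have s0 : 0 <= sin `|t - x| by apply: sin_ge0_pi; rewrite normr_ge0.
  have [d0|d0] := leP 0 (t - x).
    by move: s0; rewrite (ger0_norm d0) => /ger0_norm.
  by move: s0; rewrite (ltr0_norm d0) sinN => s0; rewrite ler0_norm//; lra.
rewrite normcM normc_en mul1r.
have -> : normc (cexp ('i * (2 * (t - x))%:C) - 1) = 2 * `|sin (t - x)|.
  apply/eqP; rewrite -(@eqrXn2 _ 2)// ?normc_ge0// normc_cexp2B1 exprMn.
  by rewrite real_normK ?num_real// -natrX.
have := @sin_ge_dist R `|t - x|; rewrite normr_ge0 dpi sE => /(_ isT).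
lra.
Qed.

Section Lipschitz.
Variables (w : R -> C) (L : R).
Hypothesis L0 : 0 <= L.
Hypothesis wL : forall x y, normc (w x - w y) <= L * `|x - y|.
Hypothesis w0 : forall x, ~ I0 x -> w x = 0.
Hypothesis mw : cmeas w.

Let wI t : w t = cind I0 t * w t.
Proof.
have [tI|/w0->] := pselect (I0 t); last by rewrite mulr0.
by rewrite cind1// mul1r.
Qed.

Let w_at0 : w 0 = 0.
Proof. by apply: w0; rewrite /= in_itv/= ltxx. Qed.

Let w_atpi : w pi = 0.
Proof. by apply: w0; rewrite /= in_itv/= ltxx andbF. Qed.

Let w_bnd t : normc (w t) <= L * pi.
Proof.
have pi0 := pi_ge0 R.
have [/I0P/andP[t0 tpi]|/w0->] := pselect (I0 t); last by rewrite normc0 mulr_ge0.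
have := wL t 0; rewrite w_at0 subr0 => /le_trans; apply.
by rewrite subr0 ler_wpM2l// gtr0_norm// ltW.
Qed.

Let hw : cL2 w.
Proof.
have := cL2_indM 0 pi mw w_bnd; congr cL2.
by apply/funext => t; rewrite -wI.
Qed.

Definition dirichlet_sum (N : nat) : R -> C :=
  trigpoly [seq - n | n <- symmetric_range N] (fun n => pi^-1%:C * fcoef w (- n)).

Section pointwise.
Variable x : R.
Hypothesis xI : I0 x.

Let g t : C := cind I0 t * ((w t - w x) * (en 1 t - en 1 x)^-1).

Let g_bnd t : normc ((w t - w x) * (en 1 t - en 1 x)^-1) <= L \/ ~ I0 t.
Proof.
have [tI|] := pselect (I0 t); [left|by right].
rewrite normcM normcV.
have := normc_enB1 xI tI.
have [->|tx] := eqVneq t x.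
  by rewrite !subrr normc0 mul0r.
have /andP[x0 xpi] := I0P xI; have /andP[t0 tpi] := I0P tI.
have d0 : 0 < `|t - x| by rewrite normr_gt0 subr_eq0.
have d1 : `|t - x| < pi by rewrite ltr_norml; apply/andP; split; lra.
set d := normc (en 1 t - en 1 x) => hd.
have dp : 0 < d.
  by apply: lt_le_trans hd; rewrite lt_min d0 subr_gt0.
rewrite ler_pdivrMr//; apply: le_trans (ler_wpM2l L0 hd).
rewrite minr_pMr// le_min wL/=.
have h1 := wL t 0; have h2 := wL x 0; have h3 := wL t pi; have h4 := wL x pi.
have := le_normcD (w t) (- w x); rewrite normcN => /le_trans; apply.
rewrite w_at0 !subr0 in h1 h2; rewrite w_atpi !subr0 in h3 h4.
rewrite (gtr0_norm t0) (gtr0_norm x0) in h1 h2.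
rewrite !ltr0_norm ?subr_lt0// in h3 h4.
by have [tx'|tx'] := leP x t; [rewrite ger0_norm; nra|rewrite ltr0_norm; nra].
Qed.

Let mg : cmeas g.
Proof.
apply: cmeasM; first exact: cmeas_ind.
apply: cmeasM; first by apply: cmeasB => //; exact: cmeas_cst.
by apply: cmeas_inv; apply: cmeasB; [exact: cmeas_en|exact: cmeas_cst].
Qed.

Let hg : cL2 g.
Proof.
apply: (cL2_bnd (M := L) mg (cL2_itv 0 pi)) => t; rewrite normcM mulrC.
have [h|h] := g_bnd t; first by rewrite ler_wpM2r// normc_ge0.
by rewrite cind0// normc0 !mulr0.
Qed.

Let fcoef_g_bnd n : normc (fcoef g n) <= L * pi.
Proof.
have pi0 := pi_ge0 R.
have i1 : cintble (fun t => g t * (cind I0 t * en n t)).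
  apply: cintbleM => //; apply: (@cL2_indM _ _ _ 1); first exact: cmeas_en.
  by move=> t; rewrite normc_en.
apply: (le_trans (normc_cint i1)).
have -> : L * pi = \int[mu]_t (L * \1_I0 t).
  rewrite RintegralZl//; last exact: integrable_indic_itv.
  congr (_ * _); rewrite -[LHS](subr0 pi) -(sqn_itv pi0); apply: eq_Rintegral => t _.
  by rewrite normc_real indicE; case: (_ \in _); rewrite ?normr1 ?normr0 ?expr1n ?expr0n.
apply: le_Rintegral => //.
- exact: (cintble_norm i1).
- exact: (integrableZl measurableT L (integrable_indic_itv 0 pi false true)).
- move=> t _; rewrite !normcM normc_en mulr1 indicE.
  have [tI|tI] := pselect (I0 t); last first.
    by rewrite cind0// normc0 mul0r mul0r memNset//= mulr0.
  rewrite cind1// normc1 mul1r mulr1 mem_set// -[L * _]/(L * 1) mulr1 -normcM.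
  by have [] := g_bnd t.
Qed.

(* Chernoff's argument: after division by en 1 - en 1 x the Fourier coefficients
   of w - w x are differences, so the partial sums at x telescope. *)
Let fcoef_w n : fcoef w n - w x * cint (fun t => cind I0 t * en n t) =
  fcoef g (n + 1) - en 1 x * fcoef g n.
Proof.
have hI m : cL2 (fun t => cind I0 t * en m t).
  by apply: (@cL2_indM _ _ _ 1); [exact: cmeas_en|move=> t; rewrite normc_en].
have i0 m : cintble (fun t => cind I0 t * en m t).
  by apply: (@cintble_indM _ _ _ 1); [exact: cmeas_en|move=> t; rewrite normc_en].
rewrite /fcoef -cintZ// -cintB; [|exact: cintbleM|exact: cintbleZ].
rewrite -cintZ; last exact: cintbleM.
rewrite -cintB; [|exact: cintbleM|by apply: cintbleZ; exact: cintbleM].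
apply: eq_cint => t; rewrite /g.
have [tI|tI] := pselect (I0 t); last by rewrite cind0//; ring.
rewrite cind1// enD !mul1r.
have [->|tx] := eqVneq t x; first by rewrite !subrr; ring.
suff : en 1 t - en 1 x != 0 by move=> h; field.
apply/eqP => /(congr1 (@normc R)); rewrite normc0 => h.
have := normc_enB1 xI tI; rewrite h; apply/negP; rewrite -ltNge lt_min.
have /andP[x0 xpi] := I0P xI; have /andP[t0 tpi] := I0P tI.
rewrite normr_gt0 subr_eq0 tx/= subr_gt0 ltr_norml; apply/andP; split; lra.
Qed.

Lemma dirichlet_sumE N : pi%:C * (dirichlet_sum N x - w x) =
  fcoef g (N%:Z + 1) * en (- N%:Z) x - fcoef g (- N%:Z) * en (N%:Z + 1) x.
Proof.
have pin0 : pi%:C != 0 :> C.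
  by apply/eqP => /(congr1 (@Re R))/= /eqP; rewrite gt_eqF// pi_gt0.
have e1 n : en 1 x * en (- n) x = en (1 - n) x by rewrite enD.
have := telescope_symmetric_range (fun n => fcoef g n * en (1 - n) x) N.
rewrite opprK opprD addrCA subrr addr0 [1 + _]addrC => <-.
rewrite (eq_bigr (fun n => (fcoef w n - w x * cint (fun t => cind I0 t * en n t)) * en (- n) x)); last first.
  move=> n _; rewrite fcoef_w mulrBl opprD addrCA subrr addr0 -e1; ring.
rewrite mulrBr /dirichlet_sum /trigpoly big_map mulr_sumr.
rewrite [X in X - _](eq_bigr (fun n => fcoef w n * en (- n) x)); last first.
  by move=> n _; rewrite opprK fmorphV !mulrA mulfV// mul1r.
under [in RHS]eq_bigr do rewrite mulrBl.
rewrite [RHS]sumrB; congr (_ - _).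
rewrite (bigD1_seq 0) ?mem0_symmetric_range ?symmetric_range_uniq//= big1 => [|n n0].
  by rewrite cint_en eqxx oppr0 en0 mulr1 addr0 mulrC.
by rewrite cint_en (negPf n0) mulr0 mul0r.
Qed.

Lemma dirichlet_sum_cvg : normc (dirichlet_sum N x - w x) @[N --> \oo] --> 0.
Proof.
have pi0 := pi_gt0 R.
have i1 : injective (fun k : nat => k%:Z + 1) by move=> a b /addIr [].
have i2 : injective (fun k : nat => - k%:Z) by move=> a b /oppr_inj [].
have c1 := fcoef_cvg0 hg i1; have c2 := fcoef_cvg0 hg i2.
apply: (@squeeze_cvgr _ _ _ _ (fun=> 0)
  (fun N => pi^-1 * (normc (fcoef g (N%:Z + 1)) + normc (fcoef g (- N%:Z))))).
- apply: nearW => N; rewrite normc_ge0 andTb -(ler_pM2l pi0) mulVKf ?gt_eqF//.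
  rewrite -[X in X * _](gtr0_norm pi0) -normc_real -normcM dirichlet_sumE.
  by apply: (le_trans (le_normcD _ _)); rewrite normcN !normcM !normc_en !mulr1.
- exact: cvg_cst.
- rewrite -[X in _ --> X](mulr0 pi^-1); apply: cvgMl_tmp.
  by rewrite -(addr0 0); apply: cvgD.
Qed.

Lemma dirichlet_sum_bnd N : normc (dirichlet_sum N x) <= L * pi + 2 * L.
Proof.
have pi0 := pi_gt0 R.
rewrite -[dirichlet_sum N x](subrK (w x)) addrC.
apply: (le_trans (le_normcD _ _)); apply: lerD => //.
rewrite -(ler_pM2l pi0) -[X in X * _](gtr0_norm pi0) -normc_real -normcM dirichlet_sumE.
apply: (le_trans (le_normcD _ _)); rewrite normcN !normcM !normc_en !mulr1.
have := fcoef_g_bnd (N%:Z + 1); have := fcoef_g_bnd (- N%:Z); lra.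
Qed.

End pointwise.

Variables (u : R -> C) (S : R).
Hypothesis hu : cL2 u.
Hypothesis u0 : forall x, ~ I0 x -> u x = 0.
Hypothesis uS : forall s : seq int, uniq s ->
  \sum_(n <- s) normc (fcoef u n) ^+ 2 <= S.

Lemma duality_lipschitz :
  normc (cint (fun t => u t * w t)) <= 2^-1 * (pi^-1 * S + sqn w).
Proof.
have pi0 := pi_gt0 R.
have mP N : cmeas (fun t => u t * (cind I0 t * dirichlet_sum N t)).
  apply: cmeasM; first exact: hu.1.
  by apply: cmeasM; [exact: cmeas_ind|exact: cmeas_trigpoly].
have uI t : u t = cind I0 t * u t.
  have [tI|/u0->] := pselect (I0 t); last by rewrite mulr0.
  by rewrite cind1// mul1r.
have iu : cintble u.
  by have := cintble_itv 0 pi hu; congr cintble; apply/funext => t; rewrite -uI.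
have lim : normc (cint (fun t => u t * (cind I0 t * dirichlet_sum N t)) -
    cint (fun t => u t * w t)) @[N --> \oo] --> 0.
  apply: (@cdominated_cvg _ _ _ (fun t => (L * pi + 2 * L) * normc (u t))) => //.
  - by apply: cmeasM => //; exact: hu.1.
  - apply: aeW => t; have [tI|tI] := pselect (I0 t); last first.
      by rewrite u0//; under eq_fun do rewrite !mul0r subr0 normc0; exact: cvg_cst.
    rewrite -[X in _ --> X](mulr0 (normc (u t))).
    under eq_fun do rewrite cind1// mul1r -mulrBr normcM.
    by apply: cvgMl_tmp; exact: dirichlet_sum_cvg.
  - exact: (integrableZl measurableT (L * pi + 2 * L) (cintble_norm iu)).
  - move=> N t; rewrite normcM mulrC ler_wpM2r ?normc_ge0//.
    have [tI|tI] := pselect (I0 t); last first.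
      by rewrite cind0// mul0r normc0 addr_ge0// mulr_ge0// ltW.
    by rewrite cind1// mul1r dirichlet_sum_bnd.
apply: (le_of_cvg0 lim) => N.
have h := ler_normcB (cint (fun t => u t * w t)) (cint (fun t => u t * (cind I0 t * dirichlet_sum N t))).
rewrite normcB in h.
suff : normc (cint (fun t => u t * (cind I0 t * dirichlet_sum N t))) <= 2^-1 * (pi^-1 * S + sqn w) by lra.
rewrite cint_trigpoly//.
have us : uniq [seq - n | n <- symmetric_range N] by rewrite map_inj_uniq ?symmetric_range_uniq//; exact: oppr_inj.
apply: (le_trans (normc_sum _ _)).
have bw : \sum_(n <- [seq - n | n <- symmetric_range N]) normc (fcoef w (- n)) ^+ 2 <= pi * sqn w.
  rewrite big_map; under eq_bigr do rewrite opprK.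
  exact: (bessel hw (symmetric_range_uniq N)).
have bu := uS us.
apply: (@le_trans _ _ (2^-1 * pi^-1 * (\sum_(n <- [seq - n | n <- symmetric_range N]) normc (fcoef u n) ^+ 2 +
   \sum_(n <- [seq - n | n <- symmetric_range N]) normc (fcoef w (- n)) ^+ 2))).
  rewrite -big_split mulr_sumr; apply: ler_sum => n _.
  rewrite !normcM normc_real gtr0_norm ?invr_gt0// [2^-1 * _]mulrC -!mulrA.
  rewrite ler_pM2l ?invr_gt0//= -/(fcoef u n).
  have := sqr_ge0 (normc (fcoef u n) - normc (fcoef w (- n))); lra.
rewrite -mulrA ler_pM2l// mulrDr lerD//.
  by rewrite ler_pM2l ?invr_gt0.
by rewrite mulrC ler_pdivrMr// mulrC.
Qed.

End Lipschitz.
End Parseval.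

Section ParsevalLowerBound.
Context {R : realType}.
Local Notation C := R[i].
Local Notation Re := complex.Re.
Local Notation Im := complex.Im.
Local Notation mu := (@lebesgue_measure R).
Local Notation I0 := (`]0, (pi : R)[%classic).
Implicit Types (m n : int) (t : R) (u w g : R -> C).

Lemma difference_quotient_cvg (f : R -> R) (h : nat -> R) :
  mu.-integrable setT (EFin \o f) -> h k @[k --> \oo] --> 0 ->
  (forall k, h k != 0) ->
  let F x := \int[mu]_t (\1_`]-oo, x] t * f t) in
  {ae mu, forall x, (F (x + h k) - F x) / h k @[k --> \oo] --> f x}.
Proof.
move=> jf h0 hn0 F.
have jy y : mu.-integrable `]-oo, y] (EFin \o f).
  by apply: integrableS jf => //; exact: measurableT.
have lf : locally_integrable setT f.
  by have := integrable_locally measurableT jf; rewrite patch_setT.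
have FE : F = (fun x => \int[mu]_(t in `]-oo, x]) f t).
  apply/funext => x; rewrite [RHS]Rintegral_mkcond; apply: eq_Rintegral => t _.
  by rewrite indicE patchE; case: (_ \in _); rewrite ?mul1r ?mul0r.
have := FTC1Ny jy lf; rewrite -FE; apply: ae_imp => x [dF F'].
have : (fun e => e^-1 *: ((F \o shift x) (e *: (1:R)) - F x)) @ 0^' --> f x.
  by rewrite -F' derive1E; exact: dF.
move=> H; apply/cvgrPdist_le => e e0.
move/cvgrPdist_le : H => /(_ _ e0); rewrite /dnbhs /within/=.
move=> /nbhs_ballP[d /= d0 dP].
move/cvgrPdist_lt : h0 => /(_ _ d0); apply: filterS => k hk.
have := dP (h k) hk (hn0 k); rewrite /= /shift/=.
by rewrite /GRing.scale/= mulr1 [h k + x]addrC mulrC.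
Qed.

Lemma cvg_sqr (e : nat -> R) (l : R) : e k @[k --> \oo] --> l ->
  e k ^+ 2 @[k --> \oo] --> l ^+ 2.
Proof. by move=> el; rewrite expr2; under eq_fun do rewrite expr2; apply: cvgM. Qed.

Section Bounded.
Variables (a M : R) (v : R -> C).
Hypothesis a0 : 0 < a.
Hypothesis mv : cmeas v.
Hypothesis vM : forall t, normc (v t) <= M.
Hypothesis v0 : forall t, ~ `]a, pi[%classic t -> v t = 0.

Let vI t : v t = cind `]a, pi[ t * v t.
Proof.
have [tI|/v0->] := pselect (`]a, pi[%classic t); last by rewrite mulr0.
by rewrite cind1// mul1r.
Qed.

Let hv : cL2 v.
Proof.
have := cL2_indM a pi mv vM; congr cL2.
by apply/funext => t; rewrite -vI.
Qed.

Let iv : cintble v.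
Proof.
have := cintble_itv a pi hv; congr cintble.
by apply/funext => t; rewrite -vI.
Qed.

Let cintble_indv D : measurable D -> cintble (fun t => cind D t * v t).
Proof.
move=> mD; apply: (cintble_le (h := fun t => normc (v t))).
- by apply: cmeasM => //; exact: cmeas_ind.
- exact: cintble_norm.
- by move=> t; rewrite normcM ler_piMl ?normc_ge0// normc_ind_le.
Qed.

Let V x : C := cint (fun t => cind `]-oo, x] t * v t).

Let VB x y : x <= y -> V y - V x = cint (fun t => cind `]x, y] t * v t).
Proof.
move=> xy; rewrite /V -cintB; [|exact: cintble_indv|exact: cintble_indv].
apply: eq_cint => t; rewrite -mulrBl; congr (_ * _).
rewrite !cindE !mem_setE !in_itv/=.
have [tx|tx] := leP t x; first by rewrite (le_trans tx xy) subrr.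
by rewrite subr0.
Qed.

Let V_lip x y : normc (V x - V y) <= M * `|x - y|.
Proof.
wlog xy : x y / x <= y => [hw|].
  have [/hw//|/ltW/hw] := leP x y.
  by rewrite normcB distrC.
rewrite normcB VB// distrC ger0_norm ?subr_ge0//.
apply: (le_trans (normc_cint (cintble_indv _))) => //.
have ii : mu.-integrable setT (EFin \o (\1_`]x, y] : R -> R)) := integrable_indic_itv x y false false.
have -> : M * (y - x) = \int[mu]_t (M * \1_`]x, y] t).
  rewrite RintegralZl//; congr (_ * _); rewrite /Rintegral integral_indic// setIT.
  have h := @lebesgue_measure_itv R `]x, y]; rewrite [X in fine X]h /= lte_fin.
  by case: ltP => //= ?; lra.
apply: le_Rintegral => //.
- by apply: cintble_norm; exact: cintble_indv.
- exact: (integrableZl measurableT M ii).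
- move=> t _; rewrite normcM normc_real mulrC ler_pM ?normc_ge0//.
  by rewrite ger0_norm.
Qed.

Let h (k : nat) : R := a / k.+1%:R.

Let h_gt0 k : 0 < h k.
Proof. by rewrite /h divr_gt0. Qed.

Let h_le k : h k <= a.
Proof. by rewrite /h ler_pdivrMr// ler_peMr ?ler1n// ltW. Qed.

Let h_cvg : h k @[k --> \oo] --> 0.
Proof.
rewrite -[X in _ --> X](mulr0 a); apply: cvgMl_tmp.
exact: cvg_harmonic.
Qed.

Let w (k : nat) (x : R) : C := (h k)^-1%:C * (V (x + h k) - V x).

Let w_lip k x y : normc (w k x - w k y) <= (2 * M / h k) * `|x - y|.
Proof.
rewrite /w -mulrBr normcM normc_real gtr0_norm ?invr_gt0//.
rewrite mulrAC [leRHS]mulrC ler_pM2l ?invr_gt0//.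
have -> : V (x + h k) - V x - (V (y + h k) - V y) =
  (V (x + h k) - V (y + h k)) - (V x - V y) by ring.
apply: (le_trans (le_normcD _ _)); rewrite normcN.
have := V_lip (x + h k) (y + h k); have := V_lip x y.
by rewrite (_ : x + h k - (y + h k) = x - y); [lra|ring].
Qed.

Let w0 k x : ~ I0 x -> w k x = 0.
Proof.
move=> xI; rewrite /w VB; last by rewrite lerDl ltW.
rewrite (_ : (fun _ => _) = (fun=> 0)) ?cint_cst0 ?mulr0//.
apply/funext => t.
have [tI|tI] := pselect (`]x, x + h k]%classic t); last by rewrite cind0// mul0r.
rewrite v0 ?mulr0//= in_itv/= => /andP[at1 tpi]; apply: xI; rewrite /= in_itv/=.
move: tI; rewrite /= in_itv/= => /andP[xt th]; have := h_le k.
by move=> hk; apply/andP; split; lra.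
Qed.

Let w_bnd k x : normc (w k x) <= M.
Proof.
rewrite /w normcM normc_real gtr0_norm ?invr_gt0// mulrC ler_pdivrMr//.
have := V_lip (x + h k) x; rewrite (_ : x + h k - x = h k); last by ring.
by rewrite gtr0_norm.
Qed.

Let M0 : 0 <= M.
Proof. exact: le_trans (normc_ge0 _) (vM 0). Qed.

Let lip_continuous (f : R -> R) : (forall x y, `|f x - f y| <= M * `|x - y|) ->
  continuous f.
Proof.
move=> fM x; apply/cvgrPdist_le => e e0; near=> y.
apply: (le_trans (fM x y)); apply: (@le_trans _ _ ((M + 1) * `|x - y|)).
  by rewrite ler_wpM2r// lerDl.
rewrite -ler_pdivlMl; last by rewrite ltr_wpDl.
near: y; apply: cvgr_dist_le; first exact: cvg_id.
by rewrite mulr_gt0// invr_gt0 ltr_wpDl.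
Unshelve. all: by end_near. Qed.

Let mV : cmeas V.
Proof.
split; apply: continuous_measurable_fun; apply: lip_continuous => x y.
  by have := Re_le_normc (V x - V y); rewrite cReD cReN => /le_trans; exact.
by have := Im_le_normc (V x - V y); rewrite cImD cImN => /le_trans; exact.
Qed.

Let mw k : cmeas (w k).
Proof.
apply: cmeasZ; apply: cmeasB => //; apply: cmeas_comp mV.
by apply: measurable_funD => //; exact: measurable_cst.
Qed.

Let w_cvg : {ae mu, forall x, normc (w k x - v x) @[k --> \oo] --> 0}.
Proof.
have hn0 k : h k != 0 by rewrite gt_eqF.
have c1 := difference_quotient_cvg (cintble_Re iv) h_cvg hn0.
have c2 := difference_quotient_cvg (cintble_Im iv) h_cvg hn0.
have VR x : Re (V x) = \int[mu]_t (\1_`]-oo, x] t * Re (v t)).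
  by apply: eq_Rintegral => t _; rewrite cReM/= mul0r subr0.
have VIm x : Im (V x) = \int[mu]_t (\1_`]-oo, x] t * Im (v t)).
  by apply: eq_Rintegral => t _; rewrite cImM/= mul0r addr0.
move: c1 c2; apply: ae_imp2 => x.
under eq_fun do rewrite -!VR.
move=> c1; under eq_fun do rewrite -!VIm.
move=> c2.
apply: (@squeeze_cvgr _ _ _ _ (fun=> 0)
  (fun k => `|(Re (V (x + h k)) - Re (V x)) / h k - Re (v x)| +
            `|(Im (V (x + h k)) - Im (V x)) / h k - Im (v x)|)).
- apply: nearW => k; rewrite normc_ge0 andTb.
  have := normc_le (w k x - v x).
  have -> : Re (w k x - v x) = (Re (V (x + h k)) - Re (V x)) / h k - Re (v x).
    by rewrite cReD cReN /w cReM cReD cReN [Im (_)%:C]/= mul0r subr0 mulrC.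
  have -> // : Im (w k x - v x) = (Im (V (x + h k)) - Im (V x)) / h k - Im (v x).
  by rewrite cImD cImN /w cImM cImD cImN [Im (_)%:C]/= mul0r addr0 mulrC.
- exact: cvg_cst.
- rewrite -[X in _ --> X](addr0 0); apply: cvgD.
    rewrite -(@normr0 _ R); apply: cvg_norm.
    by rewrite -(subrr (Re (v x))); apply: cvgB => //; exact: cvg_cst.
  rewrite -(@normr0 _ R); apply: cvg_norm.
  by rewrite -(subrr (Im (v x))); apply: cvgB => //; exact: cvg_cst.
Qed.

Variables (u : R -> C) (S : R).
Hypothesis hu : cL2 u.
Hypothesis u0 : forall x, ~ I0 x -> u x = 0.
Hypothesis uS : forall s : seq int, uniq s ->
  \sum_(n <- s) normc (fcoef u n) ^+ 2 <= S.

Lemma duality_bounded :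
  normc (cint (fun t => u t * v t)) <= 2^-1 * (pi^-1 * S + sqn v).
Proof.
have pi0 := pi_ge0 R.
have iu : cintble u.
  have := cintble_itv 0 pi hu; congr cintble; apply/funext => t.
  have [tI|/u0->] := pselect (I0 t); last by rewrite mulr0.
  by rewrite cind1// mul1r.
have L0 k : 0 <= 2 * M / h k by rewrite divr_ge0 ?mulr_ge0// ltW.
have H k := duality_lipschitz (L0 k) (w_lip k) (w0 k) (mw k) hu u0 uS.
have lim1 : normc (cint (fun t => u t * w k t) - cint (fun t => u t * v t)) @[k --> \oo] --> 0.
  apply: (@cdominated_cvg _ _ _ (fun t => M * normc (u t))).
  - by move=> k; apply: cmeasM => //; exact: hu.1.
  - by apply: cmeasM => //; exact: hu.1.
  - move: w_cvg; apply: ae_imp => t wt; rewrite -[X in _ --> X](mulr0 (normc (u t))).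
    by under eq_fun do rewrite -mulrBr normcM; apply: cvgMl_tmp.
  - exact: (integrableZl measurableT M (cintble_norm iu)).
  - by move=> k t; rewrite normcM mulrC ler_wpM2r ?normc_ge0.
have lim2 : sqn (w k) @[k --> \oo] --> sqn v.
  apply: (@Rdominated_cvg _ _ _ (fun t => M ^+ 2 * \1_I0 t)).
  - by move=> k; exact: measurable_normc_sqr.
  - exact: measurable_normc_sqr.
  - move: w_cvg; apply: ae_imp => t wt.
    apply: cvg_sqr; apply/cvgrPdist_le => e e0.
    move/cvgrPdist_le : wt => /(_ _ e0); apply: filterS => k.
    rewrite sub0r normrN (ger0_norm (normc_ge0 _)); apply: le_trans.
    by rewrite ler_norml; apply/andP; split;
      have := ler_normcB (v t) (w k t); have := ler_normcB (w k t) (v t);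
      rewrite [normc (v t - w k t)]normcB; lra.
  - exact: (integrableZl measurableT (M ^+ 2) (integrable_indic_itv 0 pi false true)).
  - move=> k t; rewrite ger0_norm ?sqr_ge0//.
    have [tI|tI] := pselect (I0 t); last first.
      by rewrite w0// normc0 expr0n mulr_ge0// sqr_ge0.
    rewrite indicE mem_set// -[leRHS]/(M ^+ 2 * 1) mulr1.
    by rewrite lerXn2r ?nnegrE ?normc_ge0.
have lim : normc (cint (fun t => u t * w k t) - cint (fun t => u t * v t)) +
    2^-1 * (sqn (w k) - sqn v) @[k --> \oo] --> 0.
  rewrite -[X in _ --> X](addr0 0); apply: cvgD => //.
  rewrite -[X in _ --> X](mulr0 2^-1); apply: cvgMl_tmp.
  by rewrite -(subrr (sqn v)); apply: cvgB => //; exact: cvg_cst.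
apply: (le_of_cvg0 lim) => k.
have := ler_normcB (cint (fun t => u t * v t)) (cint (fun t => u t * w k t)).
rewrite normcB; have := H k; lra.
Qed.

End Bounded.

Lemma parseval_ge (a S : R) u : 0 < a -> cL2 u ->
  (forall x, ~ `]a, pi[%classic x -> u x = 0) ->
  (forall s : seq int, uniq s -> \sum_(n <- s) normc (fcoef u n) ^+ 2 <= S) ->
  pi * sqn u <= S.
Proof.
move=> a0 hu u0 uS; have pi0 := pi_gt0 R.
have u0' x : ~ I0 x -> u x = 0.
  move=> xI; apply: u0; apply: contra_not xI; rewrite /= !in_itv/=.
  by move=> /andP[ax ->]; rewrite (lt_trans a0 ax).
pose D (k : nat) := [set x | normc (u x) <= k%:R].
have mD k : measurable (D k).
  have := measurable_fun_ler (measurable_normc hu.1) (@measurable_cst _ _ R R setT k%:R).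
  move=> /(_ measurableT [set true] I); rewrite setTI.
  by rewrite (_ : _ @^-1` _ = D k)//; apply/seteqP; split.
pose uk k x := cind (D k) x * u x.
have muk k : cmeas (uk k) by apply: cmeasM; [exact: cmeas_ind|exact: hu.1].
have uku k x : normc (uk k x) <= normc (u x).
  by rewrite normcM ler_piMl ?normc_ge0// normc_ind_le.
have huk k : cL2 (uk k).
  by apply: (cL2_bnd (M := 1) _ hu) => // x; rewrite mul1r.
have ukk k x : normc ((uk k x)^*) <= k%:R.
  rewrite normc_conj normcM; have [xD|xD] := pselect (D k x).
    by rewrite cind1// normc1 mul1r.
  by rewrite cind0// normc0 mul0r.
have uk0 k x : ~ `]a, pi[%classic x -> (uk k x)^* = 0.
  by move=> /u0 ux; rewrite /uk ux mulr0 rmorph0.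
have H k : sqn (uk k) <= pi^-1 * S.
  have := duality_bounded a0 (cmeas_conj (muk k)) (ukk k) (uk0 k) hu u0' uS.
  have -> : cint (fun t => u t * (uk k t)^*) = (sqn (uk k))%:C.
    rewrite sqn_cint//; apply: eq_cint => t.
    rewrite /uk rmorphM/= cindE; case: ifP => _; last by rewrite !mul0r rmorph0 mul0r mulr0.
    by rewrite !mul1r rmorph1 mul1r.
  have -> : sqn (fun t => (uk k t)^*) = sqn (uk k).
    by apply: eq_sqn => t; rewrite normc_conj.
  by rewrite normc_real ger0_norm ?sqn_ge0//; lra.
suff lim : sqn (uk k) @[k --> \oo] --> sqn u.
  rewrite mulrC -ler_pdivlMr// [leRHS]mulrC.
  apply: (@le_of_cvg0 _ (fun k => sqn u - sqn (uk k))) => [|k]; last by have := H k; lra.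
  by rewrite -(subrr (sqn u)); apply: cvgB => //; exact: cvg_cst.
apply: (@Rdominated_cvg _ _ _ (fun t => normc (u t) ^+ 2)).
- by move=> k; exact: measurable_normc_sqr.
- exact: measurable_normc_sqr hu.1.
- apply: aeW => t; apply: cvg_sqr.
  apply: cvg_near_cst; have [K _ hK] : \forall k \near \oo, normc (u t) <= k%:R.
    exact: nbhs_infty_ger.
  exists K => // k /hK uk'; rewrite /uk cind1// mul1r//.
- exact: hu.2.
- move=> k t; rewrite ger0_norm ?sqr_ge0//.
  by rewrite lerXn2r ?nnegrE ?normc_ge0.
Qed.

End ParsevalLowerBound.

(** * The sampling inequality *)

Section Sampling.
Context {R : realType}.
Local Notation C := R[i].
Local Notation Re := complex.Re.
Local Notation Im := complex.Im.
Local Notation mu := (@lebesgue_measure R).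
Implicit Types (n : int) (t a : R) (u : R -> C) (lam : C).

Lemma normc_i : normc ('i : C) = 1.
Proof. by rewrite /normc/= expr0n expr1n add0r sqrtr1. Qed.

(* e^12 = e^4 e^8 bounds |e^(i w x)| e^|(z - w) x| for |x| <= pi <= 4,
   |Im w| <= 1 and |z - w| <= 2. *)
Definition lip_const : R := 4 * expR 12.

Lemma lip_const_gt0 : 0 < lip_const.
Proof. by rewrite mulr_gt0// expR_gt0. Qed.

Lemma cexp_lipschitz (z w : C) (x : R) : `|x| <= pi -> `|Im w| <= 1 ->
  normc (z - w) <= 2 ->
  normc (cexp ('i * z * x%:C) - cexp ('i * w * x%:C)) <= lip_const * normc (z - w).
Proof.
move=> xpi w1 zw.
have pi4 : pi <= 4 :> R by have := pi_le (R := R); lra.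
have x4 : `|x| <= 4 by exact: le_trans xpi pi4.
have -> : 'i * z * x%:C = 'i * w * x%:C + 'i * (z - w) * x%:C by ring.
rewrite cexpD -[X in _ - X]mulr1 -mulrBr normcM.
have h1 : normc (cexp ('i * w * x%:C)) <= expR 4.
  rewrite normc_cexp ler_expR (le_trans (ler_norm _))//.
  rewrite cReM !mulr0 subr0 cReM mul0r mul1r sub0r normrM normrN.
  by rewrite -[leRHS]mul1r ler_pM.
have h2 : normc ('i * (z - w) * x%:C) <= 4 * normc (z - w).
  by rewrite !normcM normc_i mul1r normc_real mulrC ler_wpM2r// normc_ge0.
have h3 : normc (cexp ('i * (z - w) * x%:C) - 1) <= 4 * normc (z - w) * expR 8.
  apply: (le_trans (normc_cexpB1 _)); rewrite ler_pM ?normc_ge0 ?expR_ge0//.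
  by rewrite ler_expR (le_trans h2)//; lra.
apply: (le_trans (ler_pM (normc_ge0 _) (normc_ge0 _) h1 h3)).
have e : expR 12 = expR 4 * expR 8 :> R by rewrite -expRD; congr expR; ring.
by rewrite /lip_const e; lra.
Qed.

Definition fker a lam t : C := cexp ('i * lam * (pi + a - 2 * t)%:C).

Definition ftrans a u lam : C := cint (fun t => u t * fker a lam t).

Lemma cmeas_fker a lam : cmeas (fker a lam).
Proof.
apply: cmeas_cexp; apply: cmeasZ; apply: cmeas_real.
apply: measurable_funB; first exact: measurable_cst.
by apply: measurable_funM => //; exact: measurable_cst.
Qed.

Lemma fkerD a lam lam' t : fker a (lam + lam') t = fker a lam t * fker a lam' t.
Proof. by rewrite /fker -cexpD; congr cexp; ring. Qed.

Lemma normc_fker_real a (x : R) t : normc (fker a x%:C t) = 1.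
Proof.
rewrite /fker (_ : 'i * x%:C * _ = 'i * (x * (pi + a - 2 * t))%:C).
  by rewrite normc_cexp_im.
by rewrite rmorphM/= mulrA.
Qed.

Section Support.
Variables (a : R) (u : R -> C).
Hypothesis a0 : 0 < a < pi.
Hypothesis hu : cL2 u.
Hypothesis u0 : forall t, ~ `]a, pi[%classic t -> u t = 0.

Let uI t : u t = cind `]a, pi[ t * u t.
Proof.
have [tI|/u0->] := pselect (`]a, pi[%classic t); last by rewrite mulr0.
by rewrite cind1// mul1r.
Qed.

Let theta_le t : `]a, pi[%classic t -> `|pi + a - 2 * t| <= pi - a.
Proof.
rewrite /= in_itv/= => /andP[t1 t2]; rewrite ler_norml; apply/andP; split; lra.
Qed.

Lemma cintble_ftrans lam : cintble (fun t => u t * fker a lam t).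
Proof.
have h : cL2 (fun t => cind `]a, pi[ t * fker a lam t).
  apply: (cL2_bnd (M := expR (4 * normc lam)) _ (cL2_itv a pi)).
    by apply: cmeasM; [exact: cmeas_ind|exact: cmeas_fker].
  move=> t; rewrite normcM mulrC.
  have [tI|tI] := pselect (`]a, pi[%classic t); last by rewrite cind0// normc0 !mulr0.
  rewrite ler_wpM2r ?normc_ge0// /fker normc_cexp ler_expR.
  apply: (le_trans (ler_norm _)); apply: (le_trans (Re_le_normc _)).
  rewrite !normcM normc_real normc_i mul1r mulrC ler_wpM2r ?normc_ge0//.
  by apply: (le_trans (theta_le tI)); have := pi_le (R := R); case/andP: a0; lra.
have := cintbleM hu h; congr cintble; apply/funext => t.
by rewrite [in RHS]uI; ring.
Qed.

Lemma ftrans_lipschitz (z w : C) : `|Im w| <= 1 -> normc (z - w) <= 2 ->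
  normc (ftrans a u z - ftrans a u w) ^+ 2 <=
  sqn u * (pi * (lip_const * normc (z - w)) ^+ 2).
Proof.
move=> w1 zw; have lc := lip_const_gt0; have /andP[a1 a2] := a0.
pose d t := fker a z t - fker a w t.
have md : cmeas d by apply: cmeasB; exact: cmeas_fker.
have dI t : normc (cind `]a, pi[ t * d t) <= lip_const * normc (z - w) * normc (cind `]a, pi[ t).
  rewrite normcM mulrC.
  have [tI|tI] := pselect (`]a, pi[%classic t); last by rewrite cind0// normc0 !mulr0.
  rewrite ler_wpM2r ?normc_ge0// cexp_lipschitz//.
  by apply: (le_trans (theta_le tI)); lra.
have hd : cL2 (fun t => cind `]a, pi[ t * d t).
  apply: (cL2_bnd _ (cL2_itv a pi) dI).
  by apply: cmeasM => //; exact: cmeas_ind.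
rewrite /ftrans -cintB; [|exact: cintble_ftrans|exact: cintble_ftrans].
rewrite (@eq_cint _ _ (fun t => u t * (cind `]a, pi[ t * d t))); last first.
  by move=> t; rewrite /d [in LHS]uI; ring.
apply: (le_trans (normc_cintM_sqr hu hd)); rewrite ler_wpM2l ?sqn_ge0//.
apply: (le_trans (sqn_bnd hd (cL2_itv a pi) dI)).
rewrite mulrC sqn_itv ?(ltW a2)// ler_wpM2r ?sqr_ge0//; lra.
Qed.

Lemma int_theta_sqr :
  \int[mu]_t (\1_`]a, pi[ t * (pi + a - 2 * t) ^+ 2) = (pi - a) ^+ 3 / 3.
Proof.
have /andP[a1 a2] := a0.
pose F t : R := - ((pi + a - 2 * t) ^+ 3) / 6.
have dF t : is_derive t (1 : R) F ((pi + a - 2 * t) ^+ 2).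
  by apply: is_derive_eq; rewrite /GRing.scale/=; field.
have cf : continuous (fun t : R => (pi + a - 2 * t) ^+ 2).
  move=> t; apply: differentiable_continuous; apply/derivable1_diffP.
  exact: ex_derive.
by rewrite (RFTC (ltW a2) cf dF) /F; field.
Qed.

Variables (nu S : R) (kappa : int -> C).
Hypothesis a_ge : 2 * pi / 5 <= a.
Hypothesis kappa_le : forall s : seq int, uniq s ->
  \sum_(n <- s) normc (kappa n) ^+ 2 <= 4^-1.
Hypothesis hS : forall s : seq int, uniq s ->
  \sum_(n <- s) normc (ftrans a u (n%:~R + nu%:C + kappa n)) ^+ 2 <= S.

Lemma kappa_le_half n : normc (kappa n) <= 2^-1.
Proof.
have := @kappa_le [:: n] isT; rewrite big_seq1 => h.
rewrite -(@ler_pXn2r _ 2)// ?nnegrE ?normc_ge0 ?invr_ge0//.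
by rewrite (le_trans h)//; lra.
Qed.

Let u' t : C := u t * fker a nu%:C t.

Let hu' : cL2 u'.
Proof.
apply: (cL2_bnd (M := 1) _ hu); first by apply: cmeasM (hu.1) _; exact: cmeas_fker.
by move=> t; rewrite normcM normc_fker_real mulr1 mul1r.
Qed.

Let ftrans_base n : normc (ftrans a u (n%:~R + nu%:C)) = normc (fcoef u' (- n)).
Proof.
have e t : u t * fker a (n%:~R + nu%:C) t =
    cexp ('i * (n%:~R * (pi + a))%:C) * (u' t * (cind `]0, pi[ t * en (- n) t)).
  rewrite addrC fkerD /u' /fker /en mulrA.
  have -> : 'i * n%:~R * (pi + a - 2 * t)%:C =
      'i * (n%:~R * (pi + a))%:C + 'i * (2 * (- n)%:~R * t)%:C :> C.
    rewrite -mulrDr -rmorphD/= -mulrA; congr (_ * _).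
    rewrite -[n%:~R in LHS](rmorph_int (real_complex R)) -rmorphM/=; congr _%:C.
    by rewrite intrN; ring.
  rewrite cexpD; have [tI|/u0->] := pselect (`]a, pi[%classic t); last by rewrite !(mul0r, mulr0).
  rewrite cind1; first by ring.
  by move: tI; rewrite /= !in_itv/= => /andP[t1 ->]; case/andP: a0 => a1 _; rewrite (lt_trans a1 t1).
rewrite /ftrans (eq_cint e) cintZ; first by rewrite normcM normc_cexp_im mul1r.
apply: cintbleM => //; apply: (@cL2_indM _ _ _ 1); first exact: cmeas_en.
by move=> t; rewrite normc_en.
Qed.

Let ftrans_perturb n :
  normc (ftrans a u (n%:~R + nu%:C) - ftrans a u (n%:~R + nu%:C + kappa n)) ^+ 2 <=
  sqn u * (4 * normc (kappa n) ^+ 2 * ((pi - a) ^+ 3 / 3)).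
Proof.
have /andP[a1 a2] := a0; have pi3 := pi_le (R := R).
pose d t := fker a (n%:~R + nu%:C) t * (1 - fker a (kappa n) t).
have md : cmeas d.
  by apply: cmeasM; [exact: cmeas_fker|apply: cmeasB; [exact: cmeas_cst|exact: cmeas_fker]].
have nrE : (n%:~R + nu%:C : C) = (n%:~R + nu)%:C by rewrite rmorphD/= rmorph_int.
have dI t : normc (cind `]a, pi[ t * d t) ^+ 2 <=
    4 * normc (kappa n) ^+ 2 * (\1_`]a, pi[ t * (pi + a - 2 * t) ^+ 2).
  rewrite /d nrE !normcM normc_fker_real mul1r normcB.
  have [tI|tI] := pselect (`]a, pi[%classic t); last first.
    by rewrite cind0// normc0 mul0r expr0n indicE memNset// !mul0r mulr0.
  rewrite cind1// normc1 mul1r (_ : \1_`]a, pi[ t = 1 :> R) ?mul1r; last by rewrite indicE mem_set.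
  have hk : normc ('i * kappa n * (pi + a - 2 * t)%:C) = normc (kappa n) * `|pi + a - 2 * t|.
    by rewrite !normcM normc_i mul1r normc_real.
  have hk1 : normc (kappa n) * `|pi + a - 2 * t| <= 1.
    have h2 : pi - a <= 2 by move: a_ge pi3; move: (pi : R) => p q1 q2; lra.
    have h3 : 2^-1 * 2 <= 1 :> R by lra.
    apply: le_trans h3.
    exact: ler_pM (normc_ge0 _) (normr_ge0 _) (kappa_le_half n) (le_trans (theta_le tI) h2).
  have := @normc_cexpB1_small _ ('i * kappa n * (pi + a - 2 * t)%:C).
  rewrite hk => /(_ hk1) h.
  have -> : 4 * normc (kappa n) ^+ 2 * (pi + a - 2 * t) ^+ 2 =
      (2 * (normc (kappa n) * `|pi + a - 2 * t|)) ^+ 2.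
    by rewrite !exprMn real_normK ?num_real// -natrX mulrA.
  by rewrite lerXn2r ?nnegrE ?normc_ge0 ?mulr_ge0 ?normc_ge0.
have itheta : mu.-integrable setT (EFin \o (fun t => \1_`]a, pi[ t * (pi + a - 2 * t) ^+ 2)).
  apply: (le_integrable measurableT _ _ (integrableZl measurableT ((pi - a) ^+ 2) (integrable_indic_itv a pi false true))).
    apply/measurable_EFinP; apply: measurable_funM; first exact: measurable_indic.
    apply: measurable_funX; apply: measurable_funB; first exact: measurable_cst.
    by apply: measurable_funM => //; exact: measurable_cst.
  move=> t _; rewrite /= lee_fin.
  have [tI|tI] := pselect (`]a, pi[%classic t); last first.
    by rewrite indicE memNset// mul0r mulr0.
  rewrite (_ : \1_`]a, pi[ t = 1 :> R) ?mul1r ?mulr1; last by rewrite indicE mem_set.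
  rewrite !(ger0_norm (sqr_ge0 _)) -(real_normK (num_real (pi + a - _))).
  by rewrite lerXn2r ?nnegrE ?subr_ge0 ?(ltW a2)// theta_le.
have i4 := integrableZl measurableT (4 * normc (kappa n) ^+ 2) itheta.
have hd : cL2 (fun t => cind `]a, pi[ t * d t).
  apply: (cL2_le _ i4 dI); apply: cmeasM => //; exact: cmeas_ind.
rewrite /ftrans -cintB; [|exact: cintble_ftrans|exact: cintble_ftrans].
rewrite (@eq_cint _ _ (fun t => u t * (cind `]a, pi[ t * d t))); last first.
  by move=> t; rewrite /d (fkerD a (_ + _)) [in LHS]uI; ring.
apply: (le_trans (normc_cintM_sqr hu hd)); rewrite ler_wpM2l ?sqn_ge0//.
rewrite -int_theta_sqr -RintegralZl//.
exact: (le_sqn hd i4 dI).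
Qed.

(* parseval_ge gives pi sqn u <= (6/5) (4/5) pi sqn u + 6 S, and pi >= 2. *)
Lemma sampling : sqn u <= 75 * S.
Proof.
have /andP[a1 a2] := a0; have pi3 := pi_le (R := R); have pi2 := pi_ge2 R.
pose B := 6 / 5 * (sqn u * ((pi - a) ^+ 3 / 3)) + 6 * S.
have H : pi * sqn u' <= B.
  apply: (parseval_ge a1 hu') => [t /u0 ut|s us]; first by rewrite /u' ut mul0r.
  pose s' := [seq - n | n <- s].
  have us' : uniq s' by rewrite map_inj_uniq//; exact: oppr_inj.
  have -> : \sum_(n <- s) normc (fcoef u' n) ^+ 2 =
      \sum_(n <- s') normc (ftrans a u (n%:~R + nu%:C)) ^+ 2.
    by rewrite big_map; apply: eq_bigr => n _; rewrite ftrans_base opprK.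
  apply: (@le_trans _ _ (\sum_(n <- s') (6 / 5 * (sqn u * ((pi - a) ^+ 3 / 3) * 4) * normc (kappa n) ^+ 2
      + 6 * normc (ftrans a u (n%:~R + nu%:C + kappa n)) ^+ 2))).
    apply: ler_sum => n _; have := ftrans_perturb n.
    move: (ftrans a u (n%:~R + nu%:C)) (ftrans a u (n%:~R + nu%:C + kappa n)) => X Y.
    have := ler_normcB X Y; move: (normc_ge0 (X - Y)) (normc_ge0 X) (normc_ge0 Y).
    move: (normc (X - Y)) (normc X) (normc Y) => x y z x0 y0 z0 h1 h2.
    have h3 : y ^+ 2 <= (x + z) ^+ 2 by rewrite lerXn2r ?nnegrE ?addr_ge0//; lra.
    have h4 : 0 <= (x / 5 - z) ^+ 2 by exact: sqr_ge0.
    have : y ^+ 2 <= 6 / 5 * x ^+ 2 + 6 * z ^+ 2 by nra.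
    lra.
  rewrite big_split/= -!mulr_sumr /B; apply: lerD; last by rewrite ler_pM2l// hS.
  have := kappa_le us'; set K := \sum_(n <- s') _ => hK.
  have c0 : 0 <= sqn u * ((pi - a) ^+ 3 / 3).
    by rewrite mulr_ge0 ?sqn_ge0// divr_ge0// exprn_ge0//; lra.
  rewrite -[leLHS]mulrA ler_pM2l//.
  rewrite -mulrA ler_piMr//; lra.
have e1 : sqn u' = sqn u.
  by apply: eq_sqn => t; rewrite normcM normc_fker_real mulr1.
rewrite e1 /B in H.
have h3 : (pi - a) ^+ 3 / 3 <= 8 / 10 * pi.
  apply: (@le_trans _ _ ((3 * pi / 5) ^+ 3 / 3)).
    rewrite ler_pM2r// lerXn2r ?nnegrE//;
      by move: a_ge pi2 a2; move: (pi : R) => p ? ? ?; lra.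
  have -> : (3 * pi / 5 : R) ^+ 3 / 3 = 9 / 125 * pi ^+ 2 * pi by field.
  by rewrite ler_pM2r ?pi_gt0//; nra.
have q0 := sqn_ge0 u.
have : sqn u * ((pi - a) ^+ 3 / 3) <= sqn u * (8 / 10 * pi) by rewrite ler_wpM2l.
have : 2 * sqn u <= pi * sqn u by rewrite ler_wpM2r.
lra.
Qed.

End Support.
End Sampling.

(** * Variation of constants for absolutely continuous solutions *)

Section Duhamel.
Context {R : realType}.
Local Notation C := R[i].
Local Notation Re := complex.Re.
Local Notation Im := complex.Im.
Local Notation mu := (@lebesgue_measure R).
Implicit Types (t x : R).

Lemma abs_continuous_density (b : R) (f : R -> R) : 0 <= b -> abs_continuous b f ->
  exists2 g : R -> R, mu.-integrable setT (EFin \o g) &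
    (forall x, 0 <= x <= b -> f x = f 0 + \int[mu]_t (\1_`]0, x[ t * g t)) /\
    {ae mu, forall x, 0 < x < b -> derive1 f x = g x}.
Proof.
move=> b0 [g0 ig0 fE].
pose g t := \1_`]0, b[ t * g0 t.
have ig : mu.-integrable setT (EFin \o g).
  have : mu.-integrable `]0, b[ (EFin \o g0).
    by apply: integrableS ig0 => //; exact: subset_itv_oo_cc.
  move=> h; have := (integrable_mkcond (mu := mu) (EFin \o g0) (measurable_itv `]0, b[)).1 h.
  congr (_.-integrable _ _); apply/funext => t; rewrite patchE /g /= indicE.
  by case: (_ \in _); rewrite ?mul1r ?mul0r.
have mg : measurable_fun setT g by apply/measurable_EFinP; exact: measurable_int ig.
have gE x : 0 <= x <= b -> f x = f 0 + \int[mu]_t (\1_`]0, x[ t * g t).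
  move=> /andP[x0 xb]; rewrite fE ?x0//; congr (_ + _).
  rewrite Rintegral_ind//.
  have i1 : mu.-integrable `[0, x] (EFin \o g0).
    by apply: integrableS ig0 => //; apply: subset_itvl; rewrite bnd_simp.
  have m1 : measurable_fun `]0, x[ (EFin \o g0).
    by apply: measurable_int (integrableS _ _ _ i1) => //; exact: subset_itv_oo_cc.
  rewrite /Rintegral; congr fine.
  rewrite [LHS]integral_itv_bndoo// [RHS]integral_itv_bndoo; last first.
    by apply/measurable_EFinP; exact: measurable_funTS.
  apply: eq_integral => t; rewrite inE/= in_itv/= => /andP[t0 tx].
  rewrite /g indicE mem_set ?mul1r//= in_itv/= t0/=; exact: lt_le_trans tx xb.
exists g => //; split => //.
have jy y : mu.-integrable `]-oo, y] (EFin \o g).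
  by apply: integrableS ig => //; exact: measurableT.
have lf : locally_integrable setT g.
  by have := integrable_locally measurableT ig; rewrite patch_setT.
have := FTC1Ny jy lf; apply: ae_imp => x [dF F'] /andP[x0 xb].
rewrite -F'.
have fF y : 0 < y < b -> f y = f 0 + \int[mu]_(t in `]-oo, y]) g t.
  move=> /andP[y0 yb]; rewrite gE ?(ltW y0) ?(ltW yb)//; congr (_ + _).
  rewrite Rintegral_ind// [in RHS]Rintegral_mkcond Rintegral_mkcond.
  apply: eq_Rintegral => t _; rewrite !patchE !mem_setE !in_itv/=.
  have [t0|t0] := leP 0 t; first by [].
  by rewrite /g indicE memNset/= ?mul0r ?if_same// in_itv/= ltNge (ltW t0).
have nx : \forall y \near x, f y = f 0 + \int[mu]_(t in `]-oo, y]) g t.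
  near=> y; apply: fF; apply/andP; split; near: y.
    exact: lt_nbhsr.
  exact: lt_nbhsl.
rewrite !derive1E (near_eq_derive _ nx).
by rewrite deriveD// derive_cst add0r.
Unshelve. all: by end_near. Qed.


Lemma abs_continuousC_density (b : R) (f : R -> C) : 0 <= b -> abs_continuousC b f ->
  exists2 g : R -> C, cintble g &
    (forall x, 0 <= x <= b -> f x = f 0 + cint (fun t => cind `]0, x[ t * g t)) /\
    {ae mu, forall x, 0 < x < b -> Defs.derivC f x = g x}.
Proof.
move=> b0 [/(abs_continuous_density b0)[g1 i1 [e1 d1]]].
move=> /(abs_continuous_density b0)[g2 i2 [e2 d2]].
exists (fun t => g1 t +i* g2 t); first exact: cintbleP.
split => [x xb|].
  apply: eq_ReIm.
    rewrite cReD (e1 x xb); congr (_ + _); apply: eq_Rintegral => t _.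
    by rewrite cReM mul0r subr0.
  rewrite cImD (e2 x xb); congr (_ + _); apply: eq_Rintegral => t _.
  by rewrite cImM mul0r addr0.
move: d1 d2; apply: ae_imp2 => x h1 h2 xb.
by rewrite /Defs.derivC h1// h2.
Qed.

Lemma measurable_set_lt (f g : R * R -> R) : measurable_fun setT f ->
  measurable_fun setT g -> measurable [set z | f z < g z].
Proof.
move=> mf mg; have := measurable_fun_ltr mf mg.
move=> /(_ measurableT [set true] I); rewrite setTI.
by rewrite (_ : _ @^-1` _ = [set z | f z < g z])//; apply/seteqP; split.
Qed.

Lemma cmeas_ind_prod (D : set (R * R)) : measurable D ->
  cmeas (fun z => (\1_D z : R)%:C).
Proof. by move=> mD; apply: cmeas_real; exact: measurable_indic. Qed.

Lemma normc_cexpM_le (c : C) t (M : R) : `|t| <= M ->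
  normc (cexp (c * t%:C)) <= expR (normc c * M).
Proof.
move=> tM; rewrite normc_cexp ler_expR (le_trans (ler_norm _))//.
apply: (le_trans (Re_le_normc _)); rewrite normcM normc_real.
by rewrite ler_wpM2l// normc_ge0.
Qed.

Lemma cexpMN (c : C) t : cexp (- c * t%:C) * cexp (c * t%:C) = 1.
Proof. by rewrite -cexpD mulNr addNr cexp0. Qed.

Lemma cint_cexpN (c : C) (a b : R) : a <= b ->
  cint (fun t => cind `]a, b[ t * (c * cexp (- c * t%:C))) =
  cexp (- c * a%:C) - cexp (- c * b%:C).
Proof.
move=> ab; rewrite -[RHS]opprB -cint_cexp// -cintN.
  by apply: eq_cint => t; ring.
pose M := expR (normc c * (`|a| + `|b|)).
have h : cintble (fun t => cind `]a, b[ t * (cind `]a, b[ t * (- c * cexp (- c * t%:C)))).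
  apply: cintble_itv; apply: (cL2_bnd (M := normc c * M) _ (cL2_itv a b)).
    by apply: cmeasM; [exact: cmeas_ind|apply: cmeasZ; exact: cmeas_cexpM].
  move=> t; rewrite normcM mulrC.
  have [tI|tI] := pselect (`]a, b[%classic t); last by rewrite cind0// normc0 !mulr0.
  rewrite ler_wpM2r ?normc_ge0// normcM normcN ler_wpM2l ?normc_ge0//.
  rewrite /M -(normcN c); apply: normc_cexpM_le.
  move: tI; rewrite /= in_itv/= => /andP[t1 t2].
  have := ler_norm a; have := ler_norm b; have := ler_norm (- a); have := ler_norm (- b).
  by rewrite !normrN ler_norml => *; apply/andP; split; have := normr_ge0 a; have := normr_ge0 b; lra.
move: h; congr cintble; apply/funext => t.
by rewrite cindE; case: ifP; rewrite ?mul1r ?mul0r.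
Qed.

(* The product rule behind this is Fubini on a triangle. *)
Lemma duhamel (c w0 : C) (W g h : R -> C) x : 0 <= x -> cintble g -> cmeas h ->
  (forall t, 0 <= t <= x -> W t = w0 + cint (fun s => cind `]0, t[ s * g s)) ->
  {ae mu, forall t, 0 < t < x -> g t = c * W t + h t} ->
  W x = cexp (c * x%:C) * (w0 + cint (fun t => cind `]0, x[ t * (cexp (- c * t%:C) * h t))).
Proof.
move=> x0 ig mh WE gE.
pose D := `]0, x[%classic : set R.
have mD : measurable D by exact: measurable_itv.
pose gx t := cind D t * g t.
pose H t := cind D t * (c * cexp (- c * t%:C)).
pose M := normc c * expR (normc c * x).
have igx : cintble gx.
  apply: (cintble_le _ (cintble_norm ig)).
    by apply: cmeasM; [exact: (cmeas_ind mD)|exact: ig.1].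
  by move=> t; rewrite normcM ler_piMl ?normc_ge0// normc_ind_le.
have mH : cmeas H.
  by apply: cmeasM; [exact: (cmeas_ind mD)|apply: cmeasZ; exact: cmeas_cexpM].
have M0 : 0 <= M by rewrite mulr_ge0 ?normc_ge0 ?expR_ge0.
have eM t : D t -> normc (cexp (- c * t%:C)) <= expR (normc c * x).
  rewrite /D /= in_itv/= => /andP[t0 tx]; rewrite -(normcN c); apply: normc_cexpM_le.
  by rewrite gtr0_norm// ltW.
have HM t : normc (H t) <= M * \1_D t.
  rewrite /H normcM; have [tD|tD] := pselect (D t); last first.
    by rewrite cind0// normc0 mul0r indicE memNset// mulr0.
  rewrite cind1// normc1 mul1r (_ : \1_D t = 1 :> R) ?mulr1; last by rewrite indicE mem_set.
  by rewrite normcM ler_wpM2l ?normc_ge0// eM.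
pose lt (z : R * R) : C := (\1_[set z : R * R | z.2 < z.1] z : R)%:C.
have ltE t s : lt (t, s) = if s < t then 1 else 0.
  rewrite /lt indicE; case: ifPn => st; first by rewrite mem_set.
  by rewrite memNset//=; apply/negP.
pose K t s := H t * (lt (t, s) * gx s).
pose k t := M * \1_D t * \int[mu]_s normc (g s).
have mK : cmeas (fun z : R * R => K z.1 z.2).
  apply: cmeasM; first exact: cmeas_comp measurable_fst mH.
  apply: cmeasM.
    rewrite (_ : (fun _ => _) = lt); last by apply/funext => -[].
    by apply: cmeas_ind_prod; apply: measurable_set_lt.
  exact: cmeas_comp measurable_snd igx.1.
have iD : mu.-integrable setT (EFin \o \1_D) := integrable_indic_itv 0 x false true.
have jk : mu.-integrable setT (EFin \o k).
  have := integrableZl measurableT (M * \int[mu]_s normc (g s)) iD.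
  congr (_.-integrable _ _); apply/funext => t /=.
  by rewrite /k -EFinM mulrAC.
have Kk t : (\int[mu]_s (normc (K t s))%:E <= (k t)%:E)%E.
  have ik := integrableZl measurableT (M * \1_D t) (cintble_norm ig).
  rewrite /k -RintegralZl//; last exact: cintble_norm.
  rewrite /Rintegral fineK; last exact: (integrable_fin_num measurableT ik).
  apply: ge0_le_integral => //.
  - by move=> s _; rewrite lee_fin normc_ge0.
  - apply/measurable_EFinP; apply: measurable_normc.
    exact: cmeas_comp (pair1_measurable t) mK.
  - by apply/measurable_EFinP; apply/measurable_EFinP; exact: measurable_int ik.
  - move=> s _; rewrite lee_fin /K normcM.
    apply: ler_pM; rewrite ?normc_ge0 ?HM// normcM -[leRHS]mul1r.
    apply: ler_pM; rewrite ?normc_ge0// ?/gx ?normcM.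
      by rewrite normc_real indicE; case: (_ \in _); rewrite ?normr1 ?normr0.
    by rewrite ler_piMl ?normc_ge0// normc_ind_le.
have K1 t : cint (K t) = H t * (W t - w0).
  have [tD|tD] := pselect (D t); last first.
    rewrite /K /H cind0// !mul0r; under eq_cint do rewrite !mul0r; exact: cint_cst0.
  have /andP[t0 tx] : 0 < t < x by move: tD; rewrite /D /= in_itv.
  rewrite /K cintZ.
    congr (_ * _); rewrite WE ?(ltW t0) ?(ltW tx)// addrC addKr.
    apply: eq_cint => s; rewrite /gx ltE mulrA; congr (_ * _).
    rewrite !cindE !mem_setE !in_itv/=.
    have [s0|s0] := ltP 0 s; last by rewrite mulr0.
    have [st|st] /= := ltP s t; last by rewrite mul0r.
    by rewrite (lt_trans st tx) mulr1.
  apply: (cintble_le _ (cintble_norm igx)).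
    apply: cmeasM; last exact: igx.1.
    apply: (cmeas_comp (f := lt) (h := fun s => (t, s))); first exact: pair1_measurable.
    by apply: cmeas_ind_prod; apply: measurable_set_lt.
  move=> s; rewrite normcM ler_piMl ?normc_ge0// normc_real indicE.
  by case: (_ \in _); rewrite ?normr1 ?normr0.
have K2 s : cint (K ^~ s) = gx s * (cexp (- c * s%:C) - cexp (- c * x%:C)).
  have [sD|sD] := pselect (D s); last first.
    rewrite /K /gx cind0// !mul0r; under eq_cint do rewrite !mulr0; exact: cint_cst0.
  have /andP[s0 sx] : 0 < s < x by move: sD; rewrite /D /= in_itv.
  rewrite -cint_cexpN ?(ltW sx)// -cintZ.
    apply: eq_cint => t; rewrite /K /H.
    suff -> : cind `]s, x[ t = cind D t * lt (t, s) by ring.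
    rewrite !cindE !mem_setE !in_itv/= ltE.
    have [st|st] /= := ltP s t; last by rewrite mulr0.
    by rewrite (lt_trans s0 st)/= mulr1.
  apply: (cintble_le (h := fun t => M * \1_D t)).
  - by apply: cmeasM; [exact: cmeas_ind|apply: cmeasZ; exact: cmeas_cexpM].
  - exact: (integrableZl measurableT M iD).
  - move=> t; apply: le_trans (HM t); rewrite /H !normcM ler_wpM2r ?mulr_ge0 ?normc_ge0//.
    rewrite !normc_real !indicE !mem_setE /D !in_itv/=.
    have [st|st] /= := ltP s t; last by rewrite normr0.
    by rewrite (lt_trans s0 st).
have F := cfubini mK jk Kk.
have iK := cintble_cint1 mK jk Kk.
rewrite (eq_cint K1) (eq_cint K2) in F.
have {}iK : cintble (fun t => H t * (W t - w0)).
  by move: iK; congr cintble; apply/funext => t; rewrite K1.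
have iH : cintble H.
  by apply: (cintble_le mH (integrableZl measurableT M iD)).
have ieg : cintble (fun t => gx t * cexp (- c * t%:C)).
  apply: (cintble_le (h := fun t => expR (normc c * x) * normc (gx t))).
  - by apply: cmeasM; [exact: igx.1|exact: cmeas_cexpM].
  - exact: (integrableZl measurableT _ (cintble_norm igx)).
  - move=> t; rewrite normcM mulrC; have [tD|tD] := pselect (D t).
      by rewrite ler_wpM2r ?normc_ge0// eM.
    by rewrite /gx cind0// mul0r normc0 !mulr0.
have E : cint (fun t => cind D t * (cexp (- c * t%:C) * h t)) =
    cint (fun t => gx t * cexp (- c * t%:C) - (H t * (W t - w0) + w0 * H t)).
  apply: ae_eq_cint.
  - by apply: cmeasM; [exact: (cmeas_ind mD)|apply: cmeasM => //; exact: cmeas_cexpM].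
  - apply: cmeasB; first exact: ieg.1.
    by apply: cmeasD; [exact: iK.1|apply: cmeasZ].
  - move: gE; apply: ae_imp => t gt; rewrite /gx /H.
    have [tD|tD] := pselect (D t); last by rewrite !cind0//; ring.
    have tx : 0 < t < x by move: tD; rewrite /D /= in_itv.
    by rewrite gt//; ring.
rewrite E cintB ?cintD ?cintZ// ?F; [|exact: cintbleZ|by apply: cintbleD => //; exact: cintbleZ].
rewrite cint_cexpN// mulr0 cexp0.
have -> : cint (fun s => gx s * (cexp (- c * s%:C) - cexp (- c * x%:C))) =
    cint (fun s => gx s * cexp (- c * s%:C)) - cexp (- c * x%:C) * cint gx.
  rewrite -cintZ// -cintB//; last exact: cintbleZ.
  by apply: eq_cint => s; ring.
rewrite WE ?x0 ?lexx// -/gx.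
set G := cint gx; set G' := cint (fun t => _).
transitivity (cexp (- c * x%:C) * cexp (c * x%:C) * (w0 + G)); first by rewrite cexpMN mul1r.
ring.
Qed.

End Duhamel.

(** * The solution on (0, pi) *)

Section SolutionFormula.
Context {R : realType}.
Local Notation C := R[i].
Local Notation Re := complex.Re.
Local Notation Im := complex.Im.
Local Notation mu := (@lebesgue_measure R).
Local Notation pi := (@trigo.pi R).
Implicit Types (t x a : R) (al be : R -> C).

Lemma cL2_shift (d : R) (f : R -> C) : cL2 f -> cL2 (fun t => f (t + d)).
Proof.
move=> /(cL2_refl 0)/(cL2_refl (- d)); congr cL2.
by apply/funext => t; congr f; ring.
Qed.

Lemma sqn_shift (d : R) (f : R -> C) : cL2 f -> sqn (fun t => f (t + d)) = sqn f.
Proof.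
move=> hf; rewrite -(sqn_refl 0 hf.1) -(sqn_refl (- d) (cL2_refl 0 hf).1).
by congr sqn; apply/funext => t; congr f; ring.
Qed.

Definition delay_conv a al be (tau : R) : C :=
  cind `]3 * a / 2, pi[ tau * cint (fun t => al t * be (t + a / 2 - tau)).

Definition delay_kernel a al be (tau : R) : C := al tau + delay_conv a al be tau.

Section Conv.
Variables (a : R) (al be : R -> C).
Hypothesis hal : cL2 al.
Hypothesis hbe : cL2 be.

Lemma cint_delay_sqr (tau : R) :
  normc (cint (fun t => al t * be (t + a / 2 - tau))) ^+ 2 <= sqn al * sqn be.
Proof.
have h := normc_cintM_sqr hal (cL2_shift (a / 2 - tau) hbe).
rewrite sqn_shift// in h; apply: le_trans h.
by under eq_cint do rewrite -addrA.
Qed.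

Lemma cintble_delay (tau : R) : cintble (fun t => al t * be (t + a / 2 - tau)).
Proof.
have := cintbleM hal (cL2_shift (a / 2 - tau) hbe); congr cintble.
by apply/funext => t; rewrite addrA.
Qed.

Hypothesis ial : cintble al.
Hypothesis ibe : cintble be.
Variables (e : R -> C) (M : R).
Hypothesis me : cmeas e.
Hypothesis eM : forall tau, normc (cind `]3 * a / 2, pi[ tau * e tau) <= M.

Definition delay_fubini_kernel (t tau : R) : C :=
  al t * (be (t + a / 2 - tau) * (cind `]3 * a / 2, pi[ tau * e tau)).

Lemma cmeas_delay_fubini_kernel :
  cmeas (fun z : R * R => delay_fubini_kernel z.1 z.2).
Proof.
apply: cmeasM; first exact: cmeas_comp measurable_fst hal.1.
apply: cmeasM.
  apply: (cmeas_comp (f := be) (h := fun z : R * R => z.1 + a / 2 - z.2)) hbe.1.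
  apply: measurable_funB; last exact: measurable_snd.
  by apply: measurable_funD; [exact: measurable_fst|exact: measurable_cst].
apply: (cmeas_comp (f := fun tau => cind `]3 * a / 2, pi[ tau * e tau)) => //.
by apply: cmeasM => //; exact: cmeas_ind.
Qed.

Definition delay_fubini_bound (t : R) : R := normc (al t) * (M * \int[mu]_s normc (be s)).

Lemma integrable_delay_fubini_bound : mu.-integrable setT (EFin \o delay_fubini_bound).
Proof.
have := integrableZl measurableT (M * \int[mu]_s normc (be s)) (cintble_norm ial).
by congr (_.-integrable _ _); apply/funext => t /=; rewrite -EFinM mulrC.
Qed.

Lemma delay_fubini_bound_le t :
  (\int[mu]_tau (normc (delay_fubini_kernel t tau))%:E <= (delay_fubini_bound t)%:E)%E.
Proof.
have M0 : 0 <= M by exact: le_trans (normc_ge0 _) (eM 0).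
have ib := cintble_norm (cintble_refl (t + a / 2) ibe).
rewrite /delay_fubini_bound mulrA.
rewrite -(Rintegral_refl (t + a / 2) (measurable_normc ibe.1)) -RintegralZl//.
have iZ := integrableZl measurableT (normc (al t) * M) ib.
rewrite /Rintegral fineK; last exact: (integrable_fin_num measurableT iZ).
apply: ge0_le_integral => //.
- by move=> s _; rewrite lee_fin normc_ge0.
- apply/measurable_EFinP; apply: measurable_normc.
  exact: cmeas_comp (pair1_measurable t) cmeas_delay_fubini_kernel.
- by apply/measurable_EFinP; apply/measurable_EFinP; exact: measurable_int iZ.
- move=> s _; rewrite lee_fin /delay_fubini_kernel !(normcM (al t)) -[leRHS]mulrA.
  by rewrite ler_wpM2l ?normc_ge0// normcM mulrC ler_wpM2r ?normc_ge0.
Qed.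

Lemma cint_delay_fubini_kernel (tau : R) :
  cint (delay_fubini_kernel ^~ tau) = delay_conv a al be tau * e tau.
Proof.
rewrite /delay_conv mulrAC -cintZ; last exact: cintble_delay.
by apply: eq_cint => t; rewrite /delay_fubini_kernel; ring.
Qed.

Lemma delay_fubini : cint (fun t => cint (delay_fubini_kernel t)) =
  cint (fun tau => delay_conv a al be tau * e tau).
Proof.
rewrite (cfubini cmeas_delay_fubini_kernel integrable_delay_fubini_bound delay_fubini_bound_le).
by apply: eq_cint => tau; exact: cint_delay_fubini_kernel.
Qed.

Lemma cintble_delay_fubini : cintble (fun t => cint (delay_fubini_kernel t)).
Proof.
exact: (cintble_cint1 cmeas_delay_fubini_kernel integrable_delay_fubini_bound delay_fubini_bound_le).
Qed.

Lemma cmeas_delay_conv_mul : cmeas (fun tau => delay_conv a al be tau * e tau).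
Proof.
have := cmeas_cint2 cmeas_delay_fubini_kernel integrable_delay_fubini_bound delay_fubini_bound_le.
by congr cmeas; apply/funext => tau; exact: cint_delay_fubini_kernel.
Qed.

End Conv.

Lemma cL2_cintble (a : R) (f : R -> C) : cL2 f ->
  (forall t, ~ `]a, pi[%classic t -> f t = 0) -> cintble f.
Proof.
move=> hf f0; have := cintble_itv a pi hf; congr cintble; apply/funext => t.
have [tI|/f0->] := pselect (`]a, pi[%classic t); last by rewrite mulr0.
by rewrite cind1// mul1r.
Qed.

Lemma cmeas_delay_conv a al be : cL2 al -> cL2 be -> cintble al -> cintble be ->
  cmeas (delay_conv a al be).
Proof.
move=> hal hbe ial ibe.
have h tau : normc (cind `]3 * a / 2, pi[ tau * (1 : C)) <= 1.
  by rewrite mulr1 normc_ind_le.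
have := cmeas_delay_conv_mul hal hbe ial ibe (cmeas_cst 1) h.
by congr cmeas; apply/funext => tau; rewrite mulr1.
Qed.

Lemma cL2_delay_conv a al be : cL2 al -> cL2 be -> cintble al -> cintble be ->
  cL2 (delay_conv a al be).
Proof.
move=> hal hbe ial ibe; have [mi ii] := cL2_itv (3 * a / 2) (pi : R).
apply: (cL2_le (h := fun t => sqn al * sqn be * normc (cind `]3 * a / 2, pi[ t) ^+ 2)).
- exact: cmeas_delay_conv.
- exact: (integrableZl measurableT (sqn al * sqn be) ii).
- move=> t; rewrite normcM exprMn mulrC ler_wpM2r ?sqr_ge0//.
  exact: cint_delay_sqr.
Qed.

Section Formula.
Variables (a : R) (c : C) (al be W Z gW gZ : R -> C).
Hypothesis a0 : 0 < a.
Hypothesis a_le : 2 * a <= pi.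
Hypothesis a_ge : pi <= 3 * a.
Hypothesis hal : cL2 al.
Hypothesis hbe : cL2 be.
Hypothesis al0 : forall t, ~ `]a, pi[%classic t -> al t = 0.
Hypothesis be0 : forall t, ~ `]a, pi[%classic t -> be t = 0.
Hypothesis igW : cintble gW.
Hypothesis igZ : cintble gZ.
Hypothesis WE : forall t, 0 <= t <= pi -> W t = 1 + cint (fun s => cind `]0, t[ s * gW s).
Hypothesis ZE : forall t, 0 <= t <= pi -> Z t = 1 + cint (fun s => cind `]0, t[ s * gZ s).
Hypothesis gWE : {ae mu, forall t, 0 < t < pi -> gW t = c * W t + al t * Z (t - a)}.
Hypothesis gZE : {ae mu, forall t, 0 < t < pi -> gZ t = - c * Z t + be t * W (t - a)}.

Lemma solution_first_step x : 0 <= x <= a -> W x = cexp (c * x%:C).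
Proof.
move=> /andP[x0 xa]; have api : a <= pi by move: a_le; move: (pi : R) => p; lra.
have h : {ae mu, forall t, 0 < t < x -> gW t = c * W t + (fun=> 0) t}.
  move: gWE; apply: ae_imp => t gt /andP[t0 tx].
  have tp : 0 < t < pi by rewrite t0 (lt_le_trans tx (le_trans xa api)).
  rewrite gt// al0 ?mul0r// => /=; rewrite in_itv/= => /andP[at1 _].
  by have := lt_trans at1 tx; rewrite ltNge xa.
have WE' t : 0 <= t <= x -> W t = 1 + cint (fun s => cind `]0, t[ s * gW s).
  by move=> /andP[t0 tx]; apply: WE; rewrite t0 (le_trans tx (le_trans xa api)).
rewrite (duhamel x0 igW (cmeas_cst 0) WE' h).
under eq_cint do rewrite !mulr0.
by rewrite cint_cst0 addr0 mulr1.
Qed.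

Lemma solution_second_step x : 0 <= x <= 2 * a ->
  Z x = cexp (- c * x%:C) * (1 + cint (fun t => cind `]0, x[ t *
    (cexp (c * t%:C) * (be t * cexp (c * (t - a)%:C))))).
Proof.
move=> /andP[x0 xa].
have mh : cmeas (fun t => be t * cexp (c * (t - a)%:C)).
  apply: cmeasM; first exact: hbe.1.
  apply: cmeas_cexp; apply: cmeasZ; apply: cmeas_real.
  by apply: measurable_funB => //; exact: measurable_cst.
have h : {ae mu, forall t, 0 < t < x -> gZ t = - c * Z t + be t * cexp (c * (t - a)%:C)}.
  move: gZE; apply: ae_imp => t gt /andP[t0 tx].
  rewrite gt ?t0 ?(lt_le_trans tx (le_trans xa a_le))//.
  have [ta|ta] := leP t a.
    by rewrite be0 ?mul0r// => /=; rewrite in_itv/= ltNge ta.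
  rewrite solution_first_step//; apply/andP; split; lra.
have ZE' t : 0 <= t <= x -> Z t = 1 + cint (fun s => cind `]0, t[ s * gZ s).
  by move=> /andP[t0 tx]; apply: ZE; rewrite t0 (le_trans tx (le_trans xa a_le)).
by rewrite (duhamel x0 igZ mh ZE' h) opprK.
Qed.

Let E t : C := cexp (c * (pi + a - 2 * t)%:C).

Let mE : cmeas E.
Proof.
apply: cmeas_cexp; apply: cmeasZ; apply: cmeas_real.
apply: measurable_funB; first exact: measurable_cst.
by apply: measurable_funM => //; exact: measurable_cst.
Qed.

Let E_bnd t : normc (cind `]a, pi[ t * E t) <= expR (normc c * pi).
Proof.
have [tI|tI] := pselect (`]a, pi[%classic t); last by rewrite cind0// mul0r normc0 expR_ge0.
rewrite cind1// mul1r; apply: normc_cexpM_le; rewrite ler_norml.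
move: tI; rewrite /= in_itv/= => /andP[t1 t2].
by move: a0 a_le t1 t2; move: (pi : R) => p q0 q1 q2 q3; apply/andP; split; lra.
Qed.

Let E_bnd' t : normc (cind `]3 * a / 2, pi[ t * E t) <= expR (normc c * pi).
Proof.
have q : a < 3 * a / 2.
  by move: a0; move: (a) => b b0; lra.
apply: le_trans (E_bnd t); rewrite !normcM ler_wpM2r ?normc_ge0// !normc_real !indicE.
rewrite !mem_setE !in_itv/=; have [h|h] /= := ltP (3 * a / 2) t; last by rewrite normr0.
by rewrite (lt_trans q h).
Qed.

Let J := delay_fubini_kernel a al be E.

Let third_step t : `]a, pi[%classic t ->
  cexp (c * (pi - t)%:C) * (al t * Z (t - a)) = al t * E t + cint (J t).
Proof.
rewrite /= in_itv/= => /andP[at1 tpi].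
have cD (x y : R) : cexp (c * x%:C) * cexp (c * y%:C) = cexp (c * (x + y)%:C).
  by rewrite -cexpD -mulrDr -rmorphD.
have at0 : 0 <= t - a by rewrite subr_ge0 ltW.
have t2a : t - a <= 2 * a by move: a_ge tpi; move: (pi : R) => p q1 q2; lra.
rewrite solution_second_step ?at0//.
pose f s := cind `]0, t - a[ s * (cexp (c * s%:C) * (be s * cexp (c * (s - a)%:C))).
rewrite -/f.
have mf : cmeas f.
  apply: cmeasM; first exact: cmeas_ind.
  apply: cmeasM; first exact: cmeas_cexpM.
  apply: cmeasM; first exact: hbe.1.
  apply: cmeas_cexp; apply: cmeasZ; apply: cmeas_real.
  by apply: measurable_funB => //; exact: measurable_cst.
pose B := expR (normc c * pi).
have jf : cintble f.
  apply: (cintble_le (h := fun s => B * B * normc (be s)) mf).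
    exact: (integrableZl measurableT (B * B) (cintble_norm (cL2_cintble hbe be0))).
  move=> s; rewrite normcM; have [sI|sI] := pselect (`]0, t - a[%classic s); last first.
    by rewrite cind0// normc0 mul0r !mulr_ge0 ?normc_ge0 ?expR_ge0.
  rewrite cind1// normc1 mul1r !normcM [normc (be s) * _]mulrC mulrA.
  move: sI; rewrite /= in_itv/= => /andP[s1 s2].
  rewrite ler_wpM2r ?normc_ge0//; apply: ler_pM; rewrite ?normc_ge0//; apply: normc_cexpM_le;
    by rewrite ler_norml; move: a_ge a_le a0 s1 s2 tpi; move: (pi : R) (a) => p b *; apply/andP; split; lra.
have e1 : cexp (c * (pi - t)%:C) * cexp (- c * (t - a)%:C) = E t.
  have -> : - c * (t - a)%:C = c * (- (t - a))%:C by rewrite rmorphN/= mulrN mulNr.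
  by rewrite cD; congr (cexp (c * _%:C)); ring.
transitivity (al t * E t + al t * E t * cint f); first by rewrite -e1; ring.
congr (_ + _); rewrite -(cint_refl (t + a / 2) mf) -cintZ; last exact: cintble_refl.
apply: eq_cint => tau; rewrite /J /delay_fubini_kernel /f.
set s := t + a / 2 - tau.
have [sI|/be0->] := pselect (`]a, pi[%classic s); last by ring.
have e2 : E t * (cexp (c * s%:C) * cexp (c * (s - a)%:C)) = E tau.
  by rewrite /E !cD; congr (cexp (c * _%:C)); rewrite /s; field.
have e3 : cind `]0, t - a[ s = cind `]3 * a / 2, pi[ tau.
  move: sI; rewrite /= in_itv/= => /andP[s1 s2]; rewrite !cindE !mem_setE !in_itv/=.
  have -> : (0 < s) = true by apply/idP; exact: lt_trans a0 s1.
  have -> : (tau < pi) = true.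
    by apply/idP; move: a0 tpi s1; rewrite /s; move: (pi : R) (a) => p b *; lra.
  have -> // : (s < t - a) = (3 * a / 2 < tau) by apply/idP/idP; rewrite /s; move: (a) => b; lra.
by rewrite andbT.
by rewrite e3 -e2; ring.
Qed.

Lemma solution_formula : W pi = cexp (c * pi%:C) +
  cint (fun t => delay_kernel a al be t * cexp (c * (pi + a - 2 * t)%:C)).
Proof.
have pi0 := pi_ge0 R.
have ial := cL2_cintble hal al0; have ibe := cL2_cintble hbe be0.
have iJ := cintble_delay_fubini hal hbe ial ibe mE E_bnd'.
have ialE : cintble (fun t => al t * E t).
  apply: (cintble_le (h := fun t => expR (normc c * pi) * normc (al t))).
  - by apply: cmeasM => //; exact: hal.1.
  - exact: (integrableZl measurableT _ (cintble_norm ial)).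
  - move=> t; rewrite normcM mulrC.
    have [tI|/al0->] := pselect (`]a, pi[%classic t); last by rewrite normc0 !mulr0.
    rewrite ler_wpM2r ?normc_ge0//; apply: le_trans (E_bnd t).
    by rewrite cind1// mul1r.
pose h t := cexp (- c * (pi - t)%:C) * (al t * E t + cint (J t)).
have mh : cmeas h.
  apply: cmeasM; last by apply: cmeasD; [exact: ialE.1|exact: iJ.1].
  apply: cmeas_cexp; apply: cmeasZ; apply: cmeas_real.
  by apply: measurable_funB => //; exact: measurable_cst.
have J0 t : ~ `]a, pi[%classic t -> cint (J t) = 0.
  move=> tI; rewrite /J /delay_fubini_kernel al0//.
  by under eq_cint do rewrite mul0r; exact: cint_cst0.
have gh : {ae mu, forall t, 0 < t < pi -> gW t = c * W t + h t}.
  move: gWE; apply: ae_imp => t gt t0; rewrite gt//; congr (_ + _).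
  have [tI|tI] := pselect (`]a, pi[%classic t); last first.
    by rewrite /h J0// al0// !mul0r addr0 mulr0.
  by rewrite /h -third_step// mulrA cexpMN mul1r.
rewrite (duhamel pi0 igW mh WE gh) mulrDr mulr1; congr (_ + _).
have iT : cintble (fun t => al t * E t + cint (J t)) by exact: cintbleD.
have e1 t : cind `]0, pi[ t * (cexp (- c * t%:C) * h t) =
    cexp (- c * pi%:C) * (al t * E t + cint (J t)).
  have e2 : cexp (- c * t%:C) * cexp (- c * (pi - t)%:C) = cexp (- c * pi%:C).
    by rewrite -cexpD -mulrDr -rmorphD/=; congr (cexp (_ * _%:C)); ring.
  have [tI|tI] := pselect (`]a, pi[%classic t); last first.
    by rewrite /h J0// al0// mul0r addr0 !mulr0.
  rewrite cind1 ?mul1r /h ?mulrA ?e2//.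
  by move: tI; rewrite /= !in_itv/= => /andP[t1 ->]; rewrite (lt_trans a0 t1).
rewrite (eq_cint e1) cintZ// mulrA [cexp _ * _]mulrC cexpMN mul1r cintD//.
rewrite (delay_fubini hal hbe ial ibe mE E_bnd') -cintD//.
  by apply: eq_cint => t; rewrite /delay_kernel mulrDl.
have h2 : cintble (fun t => delay_conv a al be t * (cind `]3 * a / 2, pi[ t * E t)).
  apply: cintbleM; first exact: cL2_delay_conv.
  apply: (cL2_bnd (M := expR (normc c * pi)) _ (cL2_itv (3 * a / 2) pi)).
    by apply: cmeasM => //; exact: cmeas_ind.
  move=> t; have [tI|tI] := pselect (`]3 * a / 2, pi[%classic t); last first.
    by rewrite cind0// mul0r normc0 mulr0.
  by rewrite [in leRHS]cind1// normc1 mulr1 E_bnd'.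
move: h2; congr cintble; apply/funext => t; rewrite /delay_conv.
by rewrite cindE; case: ifP => _; rewrite ?mul1r ?mul0r.
Qed.

End Formula.
End SolutionFormula.

(** * Inversion of the kernels and stability *)

Section KernelInversion.
Context {R : realType}.
Local Notation C := R[i].
Local Notation Re := complex.Re.
Local Notation Im := complex.Im.
Local Notation mu := (@lebesgue_measure R).
Local Notation pi := (@trigo.pi R).
Implicit Types (t x a : R) (al be : R -> C).

Lemma sqn_ind_le (D : set R) (f : R -> C) : measurable D -> cL2 f ->
  sqn (fun t => cind D t * f t) <= sqn f.
Proof.
move=> mD hf.
have h t : normc (cind D t * f t) <= 1 * normc (f t).
  by rewrite normcM ler_wpM2r ?normc_ge0// normc_ind_le.
have := sqn_bnd (cL2_bnd (cmeasM (cmeas_ind mD) hf.1) hf h) hf h.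
by rewrite expr1n mul1r.
Qed.

Lemma cL2_ind (D : set R) (f : R -> C) : measurable D -> cL2 f ->
  cL2 (fun t => cind D t * f t).
Proof.
move=> mD hf; apply: (cL2_bnd (M := 1) _ hf); first by apply: cmeasM (cmeas_ind mD) hf.1.
by move=> t; rewrite normcM ler_wpM2r ?normc_ge0// normc_ind_le.
Qed.

Definition hi a (f : R -> C) t : C := cind `]pi - a / 2, pi[ t * f t.
Definition lo a (f : R -> C) t : C := cind `]a, 3 * a / 2[ t * f t.

Section One.
Variables (a : R) (al be : R -> C).
Hypothesis a_ge : 2 * pi / 5 <= a.
Hypothesis a_lt : a < pi / 2.
Hypothesis al0 : forall t, ~ `]a, pi[%classic t -> al t = 0.
Hypothesis be0 : forall t, ~ `]a, pi[%classic t -> be t = 0.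

Lemma delay_conv_lo t : t <= 3 * a / 2 -> delay_conv a al be t = 0.
Proof.
move=> h; rewrite /delay_conv cind0 ?mul0r//= in_itv/= => /andP[h1 _].
by move: h1; rewrite ltNge h.
Qed.

Lemma delay_conv_hi t : pi - a / 2 <= t -> delay_conv a al be t = 0.
Proof.
move=> h; rewrite /delay_conv; under eq_cint => s.
  rewrite (_ : _ * _ = 0); first by over.
  have [sI|/al0->] := pselect (`]a, pi[%classic s); last by rewrite mul0r.
  rewrite be0 ?mulr0//= in_itv/= => /andP[h1 h2].
  move: sI; rewrite /= in_itv/= => /andP[s1 s2].
  by move: h h1 s2; move: pi (a) => p b *; lra.
by rewrite cint_cst0 mulr0.
Qed.

Lemma delay_kernel_supp t : ~ `]a, pi[%classic t -> delay_kernel a al be t = 0.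
Proof.
move=> tI; rewrite /delay_kernel al0// add0r /delay_conv cind0 ?mul0r// => tI'.
apply: tI; move: tI'; rewrite /= !in_itv/= => /andP[h ->]; rewrite andbT.
have pi0 := pi_gt0 R.
by move: a_ge h pi0; move: pi (a) => p b *; lra.
Qed.

Lemma hi_kernel : hi a (delay_kernel a al be) = hi a al.
Proof.
apply/funext => t; rewrite /hi /delay_kernel.
have [tI|tI] := pselect (`]pi - a / 2, pi[%classic t); last by rewrite cind0// !mul0r.
rewrite delay_conv_hi ?addr0//.
by move: tI; rewrite /= in_itv/= => /andP[/ltW].
Qed.

Lemma lo_kernel : lo a (delay_kernel a al be) = lo a al.
Proof.
apply/funext => t; rewrite /lo /delay_kernel.
have [tI|tI] := pselect (`]a, 3 * a / 2[%classic t); last by rewrite cind0// !mul0r.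
rewrite delay_conv_lo ?addr0//.
by move: tI; rewrite /= in_itv/= => /andP[_ /ltW].
Qed.

(* Since 2a >= pi - a/2 and pi - a <= 3a/2, the integrand only sees al near pi
   and be near a, where they coincide with the kernels. *)
Lemma delay_conv_cut : delay_conv a al be = delay_conv a (hi a al) (lo a be).
Proof.
apply/funext => tau; rewrite /delay_conv.
have [tauI|tauI] := pselect (`]3 * a / 2, pi[%classic tau); last by rewrite cind0// !mul0r.
congr (_ * _); apply: eq_cint => t; rewrite /hi /lo.
have [tI|/al0->] := pselect (`]a, pi[%classic t); last by rewrite mulr0 !mul0r.
have [sI|/be0->] := pselect (`]a, pi[%classic (t + a / 2 - tau)); last by rewrite !mulr0.
move: tauI tI sI; rewrite /= !in_itv/= => /andP[h1 h2] /andP[h3 h4] /andP[h5 h6].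
rewrite !cind1 ?mul1r//= in_itv/=.
  by rewrite h5/=; move: a_ge h1 h4; move: pi (a) => p b *; lra.
by rewrite h4 andbT; move: a_ge h1 h5; move: pi (a) => p b *; lra.
Qed.

Hypothesis hal : cL2 al.
Hypothesis hbe : cL2 be.

Lemma cL2_delay_kernel : cL2 (delay_kernel a al be).
Proof.
apply: cL2D => //; apply: cL2_delay_conv => //; [exact: cL2_cintble hal al0|exact: cL2_cintble hbe be0].
Qed.

End One.

Lemma delay_conv_diff_sqr a (A B A' B' : R -> C) (tau K E : R) :
  cL2 A -> cL2 B -> cL2 A' -> cL2 B' -> sqn B <= K -> sqn A' <= K ->
  sqn (fun t => A t - A' t) <= E -> sqn (fun t => B t - B' t) <= E ->
  normc (delay_conv a A B tau - delay_conv a A' B' tau) ^+ 2 <=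
    4 * E * K * normc (cind `]3 * a / 2, pi[ tau) ^+ 2.
Proof.
move=> hA hB hA' hB' BK AK AE BE.
have -> : delay_conv a A B tau - delay_conv a A' B' tau = cind `]3 * a / 2, pi[ tau *
    (cint (fun t => (A t - A' t) * B (t + a / 2 - tau)) +
     cint (fun t => A' t * (B (t + a / 2 - tau) - B' (t + a / 2 - tau)))).
  rewrite /delay_conv -mulrBr; congr (_ * _).
  rewrite -cintB; [|exact: cintble_delay|exact: cintble_delay].
  rewrite -cintD; last 2 first.
  - exact: (@cintble_delay _ a (fun t => A t - A' t) B (cL2B hA hA') hB tau).
  - exact: (@cintble_delay _ a A' (fun t => B t - B' t) hA' (cL2B hB hB') tau).
  by apply: eq_cint => t; ring.
rewrite normcM exprMn mulrC ler_wpM2r ?sqr_ge0//.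
apply: (le_trans (normcD_sqr _ _)).
have h1 := cint_delay_sqr a (cL2B hA hA') hB tau.
have h2 := cint_delay_sqr a hA' (cL2B hB hB') tau.
have p1 : sqn (fun t => A t - A' t) * sqn B <= E * K by apply: ler_pM; rewrite ?sqn_ge0.
have p2 : sqn A' * sqn (fun t => B t - B' t) <= K * E by apply: ler_pM; rewrite ?sqn_ge0.
by move: (le_trans h1 p1) (le_trans h2 p2); lra.
Qed.

Let delay_itv_le (P b : R) : 2 * P / 5 <= b -> b < P / 2 -> 0 < P -> P <= 10 / 3 ->
  3 * b / 2 <= P /\ P - 3 * b / 2 <= 10 / 3.
Proof. by move=> *; split; lra. Qed.

Let inverse_bound_le (x y E K : R) : 0 <= E * K -> y <= 4 * E * K * (10 / 3) -> x <= E ->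
  2 * x + 2 * y <= (2 + 27 * K) * E.
Proof. by move=> *; lra. Qed.

Lemma delay_kernel_inverse a (al be al' be' : R -> C) (K E : R) :
  2 * pi / 5 <= a < pi / 2 ->
  (forall t, ~ `]a, pi[%classic t -> al t = 0) ->
  (forall t, ~ `]a, pi[%classic t -> be t = 0) ->
  (forall t, ~ `]a, pi[%classic t -> al' t = 0) ->
  (forall t, ~ `]a, pi[%classic t -> be' t = 0) ->
  cL2 al -> cL2 be -> cL2 al' -> cL2 be' ->
  sqn (delay_kernel a be al) <= K -> sqn (delay_kernel a al' be') <= K ->
  sqn (fun t => delay_kernel a al be t - delay_kernel a al' be' t) <= E ->
  sqn (fun t => delay_kernel a be al t - delay_kernel a be' al' t) <= E ->
  sqn (fun t => al t - al' t) <= (2 + 27 * K) * E.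
Proof.
move=> /andP[a1 a2] al0 be0 al0' be0' hal hbe hal' hbe' vbK vK' vE vbE.
have pi0 := pi_gt0 R; have pi3 := pi_le (R := R).
set v := delay_kernel a al be in vE *; set vb := delay_kernel a be al in vbK vbE *.
set v' := delay_kernel a al' be' in vE vK' *; set vb' := delay_kernel a be' al' in vbE *.
have hv : cL2 v := cL2_delay_kernel al0 be0 hal hbe.
have hvb : cL2 vb := cL2_delay_kernel be0 al0 hbe hal.
have hv' : cL2 v' := cL2_delay_kernel al0' be0' hal' hbe'.
have hvb' : cL2 vb' := cL2_delay_kernel be0' al0' hbe' hal'.
have hhi f : cL2 f -> cL2 (hi a f) by apply: cL2_ind; exact: measurable_itv.
have hlo f : cL2 f -> cL2 (lo a f) by apply: cL2_ind; exact: measurable_itv.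
have c1 : delay_conv a al be = delay_conv a (hi a v) (lo a vb).
  by rewrite (hi_kernel al0 be0) lo_kernel (delay_conv_cut a1 al0 be0).
have c2 : delay_conv a al' be' = delay_conv a (hi a v') (lo a vb').
  by rewrite (hi_kernel al0' be0') lo_kernel (delay_conv_cut a1 al0' be0').
pose D tau := delay_conv a al be tau - delay_conv a al' be' tau.
have hD : cL2 D.
  have h1 := cL2_delay_conv a hal hbe (cL2_cintble hal al0) (cL2_cintble hbe be0).
  have h2 := cL2_delay_conv a hal' hbe' (cL2_cintble hal' al0') (cL2_cintble hbe' be0').
  exact: cL2B h1 h2.
have DE tau : normc (D tau) ^+ 2 <= 4 * E * K * normc (cind `]3 * a / 2, pi[ tau) ^+ 2.
  rewrite /D c1 c2; apply: delay_conv_diff_sqr; [exact: hhi|exact: hlo|exact: hhi|exact: hlo|..].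
  - by apply: le_trans vbK; apply: sqn_ind_le.
  - by apply: le_trans vK'; apply: sqn_ind_le.
  - apply: le_trans vE; rewrite (_ : (fun t => _) = hi a (fun t => v t - v' t)).
      by apply: sqn_ind_le => //; exact: cL2B.
    by apply/funext => t; rewrite /hi mulrBr.
  - apply: le_trans vbE; rewrite (_ : (fun t => _) = lo a (fun t => vb t - vb' t)).
      by apply: sqn_ind_le => //; exact: cL2B.
    by apply/funext => t; rewrite /lo mulrBr.
have K0 : 0 <= K by exact: le_trans (sqn_ge0 _) vbK.
have E0 : 0 <= E by exact: le_trans (sqn_ge0 _) vE.
have sD : sqn D <= 4 * E * K * (10 / 3).
  have ii := (cL2_itv (3 * a / 2) pi).2.
  apply: (le_trans (le_sqn hD (integrableZl measurableT (4 * E * K) ii) DE)).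
  rewrite RintegralZl// ler_wpM2l ?mulr_ge0//.
  have [h1 h2] := delay_itv_le a1 a2 pi0 pi3.
  by rewrite -/(sqn _) sqn_itv.
have -> : (fun t => al t - al' t) = (fun t => (v t - v' t) - D t).
  by apply/funext => t; rewrite /v /v' /D /delay_kernel; ring.
apply: (le_trans (sqnB (cL2B hv hv') hD)).
exact: inverse_bound_le (mulr_ge0 E0 K0) sD vE.
Qed.

End KernelInversion.

Section Stability.
Context {R : realType}.
Local Notation C := R[i].
Local Notation Re := complex.Re.
Local Notation Im := complex.Im.
Local Notation mu := (@lebesgue_measure R).
Local Notation pi := (@trigo.pi R).
Local Notation L := (@lip_const R).

Definition ctrig (k eps lam : C) : C :=
  k * (cexp ('i * lam * pi%:C) + eps * cexp ('i * lam * (- pi)%:C)).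

Lemma ctrig_lipschitz (k eps z w : C) : normc k = 2^-1 -> normc eps = 1 ->
  `|Im w| <= 1 -> normc (z - w) <= 2 ->
  normc (ctrig k eps z - ctrig k eps w) <= L * normc (z - w).
Proof.
move=> k1 e1 w1 zw; have pi0 := pi_ge0 R.
rewrite /ctrig -mulrBr normcM k1.
have h1 := @cexp_lipschitz R z w pi; have h2 := @cexp_lipschitz R z w (- pi).
rewrite normrN ger0_norm// in h1 h2.
have {h1} := h1 (lexx _) w1 zw; have {h2} := h2 (lexx _) w1 zw.
set x1 := cexp _; set y1 := cexp _; set x2 := cexp _; set y2 := cexp _ => h2 h1.
have -> : x2 + eps * x1 - (y2 + eps * y1) = (x2 - y2) + eps * (x1 - y1) by ring.
have := le_normcD (x2 - y2) (eps * (x1 - y1)); rewrite normcM e1 mul1r; lra.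
Qed.

Section OneProblem.
Variables (a nu : R) (k eps : C).
Hypothesis a_ge : 2 * pi / 5 <= a.
Hypothesis a_lt : a < pi / 2.
Hypothesis k1 : normc k = 2^-1.
Hypothesis eps1 : normc eps = 1.
Hypothesis ctrig0 : forall n : int, ctrig k eps (n%:~R + nu%:C) = 0.

Let a0 : 0 < a < pi.
Proof.
have pi0 := pi_gt0 R; move: a_ge a_lt; move: pi pi0 (a) => p p0 b q1 q2.
by apply/andP; split; lra.
Qed.

Definition perturbed (kappa : int -> C) (n : int) : C := n%:~R + nu%:C + kappa n.

Let Im_base n : Im (n%:~R + nu%:C : C) = 0.
Proof. by rewrite -(rmorph_int (real_complex R)) cImD/= addr0. Qed.

Let half_sum (kappa : int -> C) :
  (forall s : seq int, uniq s -> \sum_(n <- s) normc (kappa n) ^+ 2 <= 4^-1) ->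
  forall n, normc (kappa n) <= 2^-1.
Proof. by move=> h n; apply: kappa_le_half. Qed.

Lemma sqn_from_zeros (u : R -> C) (kappa : int -> C) : cL2 u ->
  (forall t, ~ `]a, pi[%classic t -> u t = 0) ->
  (forall s : seq int, uniq s -> \sum_(n <- s) normc (kappa n) ^+ 2 <= 4^-1) ->
  (forall n, ctrig k eps (perturbed kappa n) + ftrans a u (perturbed kappa n) = 0) ->
  sqn u <= 75 * (L ^+ 2 / 4).
Proof.
move=> hu u0 hk hz; have hk1 := half_sum hk.
apply: (sampling a0 hu u0 (nu := nu) (kappa := kappa)) => // s us.
apply: (@le_trans _ _ (\sum_(n <- s) L ^+ 2 * normc (kappa n) ^+ 2)).
  apply: ler_sum => n _; rewrite -exprMn lerXn2r ?nnegrE ?normc_ge0//.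
    by rewrite mulr_ge0 ?normc_ge0// ltW// lip_const_gt0.
  have -> : ftrans a u (n%:~R + nu%:C + kappa n) =
      ctrig k eps (n%:~R + nu%:C) - ctrig k eps (perturbed kappa n).
    rewrite ctrig0 sub0r; apply/eqP; rewrite -addr_eq0 addrC; exact/eqP/hz.
  rewrite normcB (_ : kappa n = perturbed kappa n - (n%:~R + nu%:C)).
    apply: ctrig_lipschitz => //; first by rewrite Im_base normr0.
    by rewrite /perturbed addrC addKr (le_trans (hk1 n))//; lra.
  by rewrite /perturbed addrC addKr.
by rewrite -mulr_sumr ler_wpM2l ?sqr_ge0// hk.
Qed.

Definition stab_const : R := 75 * (2 * L ^+ 2 + 2 * (75 * (L ^+ 2 / 4) * (pi * L ^+ 2))).

Lemma sqn_diff_from_zeros (u u' : R -> C) (kappa kappa' : int -> C) (S : R) :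
  cL2 u -> cL2 u' ->
  (forall t, ~ `]a, pi[%classic t -> u t = 0) ->
  (forall t, ~ `]a, pi[%classic t -> u' t = 0) ->
  (forall s : seq int, uniq s -> \sum_(n <- s) normc (kappa n) ^+ 2 <= 4^-1) ->
  (forall s : seq int, uniq s -> \sum_(n <- s) normc (kappa' n) ^+ 2 <= 4^-1) ->
  (forall n, ctrig k eps (perturbed kappa n) + ftrans a u (perturbed kappa n) = 0) ->
  (forall n, ctrig k eps (perturbed kappa' n) + ftrans a u' (perturbed kappa' n) = 0) ->
  (forall s : seq int, uniq s ->
    \sum_(n <- s) normc (perturbed kappa n - perturbed kappa' n) ^+ 2 <= S) ->
  sqn (fun t => u t - u' t) <= stab_const * S.
Proof.
move=> hu hu' u0 u0' hk hk' hz hz' hS.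
have hk1 := half_sum hk; have hk1' := half_sum hk'.
have su' := sqn_from_zeros hu' u0' hk' hz'.
have L0 := lip_const_gt0 (R := R); have pi0 := pi_ge0 R.
set D := 2 * L ^+ 2 + 2 * (75 * (L ^+ 2 / 4) * (pi * L ^+ 2)).
have D0 : 0 <= D.
  by rewrite /D addr_ge0 ?mulr_ge0 ?divr_ge0 ?exprn_ge0 ?(ltW L0).
rewrite /stab_const -/D -mulrA.
apply: (sampling a0 (cL2B hu hu') _ (nu := nu) (kappa := kappa)) => //.
  by move=> t tI; rewrite u0// u0'// subrr.
move=> s us; apply: le_trans (ler_wpM2l D0 (hS s us)).
rewrite mulr_sumr; apply: ler_sum => n _; rewrite -/(perturbed kappa n).
set z := perturbed kappa n; set w := perturbed kappa' n.
have w1 : `|Im w| <= 1.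
  rewrite /w /perturbed cImD Im_base add0r (le_trans (Im_le_normc _))//.
  by rewrite (le_trans (hk1' n))//; lra.
have zw : normc (z - w) <= 2.
  have -> : z - w = kappa n - kappa' n by rewrite /z /w /perturbed; ring.
  by apply: (le_trans (le_normcD _ _)); rewrite normcN; have := hk1 n; have := hk1' n; lra.
have fE : ftrans a (fun t => u t - u' t) z = ftrans a u z - ftrans a u' z.
  rewrite /ftrans -cintB; [|exact: cintble_ftrans|exact: cintble_ftrans].
  by apply: eq_cint => t; rewrite mulrBl.
have e1 : ftrans a u z = - ctrig k eps z by apply/eqP; rewrite -addr_eq0 addrC; exact/eqP/hz.
have e2 : ctrig k eps w = - ftrans a u' w by apply/eqP; rewrite -addr_eq0; exact/eqP/hz'.
have -> : ftrans a (fun t => u t - u' t) z =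
    - (ctrig k eps z - ctrig k eps w) - (ftrans a u' z - ftrans a u' w).
  by rewrite fE e1 e2; ring.
apply: (le_trans (normcD_sqr _ _)); rewrite !normcN.
have h1 := ctrig_lipschitz k1 eps1 w1 zw.
have h2 := ftrans_lipschitz a0 hu' u0' w1 zw.
have {}h1 : normc (ctrig k eps z - ctrig k eps w) ^+ 2 <= (L * normc (z - w)) ^+ 2.
  by rewrite lerXn2r ?nnegrE ?normc_ge0// mulr_ge0 ?normc_ge0// ltW.
have h3 : sqn u' * (pi * (L * normc (z - w)) ^+ 2) <= 75 * (L ^+ 2 / 4) * (pi * (L * normc (z - w)) ^+ 2).
  by rewrite ler_wpM2r// mulr_ge0// sqr_ge0.
rewrite exprMn in h1 h2 h3; rewrite /D.
by move: (le_trans h2 h3) h1; move: (normc (z - w) ^+ 2) (L ^+ 2) => x l; lra.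
Qed.

End OneProblem.
End Stability.

(** * The Dirac system *)

Section Norms.
Context {R : realType}.
Local Notation C := R[i].
Local Notation Re := complex.Re.
Local Notation Im := complex.Im.
Local Notation mu := (@lebesgue_measure R).
Local Notation pi := (@trigo.pi R).

Lemma L2norm_integral (D : set R) (f : R -> C) :
  L2norm D f = ((\int[mu]_x (normc (cind D x * f x) ^+ 2)%:E) `^ 2^-1)%E.
Proof.
rewrite /L2norm unlock; congr (_ `^ _)%E; apply: eq_integral => x _.
rewrite poweR_EFin powR_mulrn//; congr (_ ^+ 2)%:E.
rewrite /= patchE cindE; case: ifP => _; last by rewrite mul0r normr0 normc0.
by rewrite mul1r ger0_norm// normc_ge0.
Qed.

Lemma L2normE (D : set R) (f : R -> C) : cL2 (fun t => cind D t * f t) ->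
  L2norm D f = (Num.sqrt (sqn (fun t => cind D t * f t)))%:E.
Proof.
move=> [mf jf]; rewrite L2norm_integral -powR12_sqrt ?sqn_ge0// -poweR_EFin.
congr (_ `^ _)%E; rewrite /sqn /Rintegral fineK//.
exact: (integrable_fin_num measurableT jf).
Qed.

Lemma in_L2_cL2 (D D' : set R) (f : R -> C) : measurable D -> measurable D' ->
  D `<=` D' -> in_L2 D' f -> cL2 (fun t => cind D t * f t).
Proof.
move=> mD mD' DD' [m1 m2]; rewrite L2norm_integral => /lty_poweRy h.
have m0 (E : set R) : measurable E -> E `<=` D' -> cmeas (fun t => cind E t * f t).
  move=> mE EE; split.
    rewrite (_ : (fun _ => _) = (fun x => Re (f x)) \_ E).
      by apply/(measurable_restrictT _ _).1 => //; exact: measurable_funS m1.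
    apply/funext => x; rewrite patchE cReM cindE; case: ifP => _ /=.
      by rewrite mul1r mul0r subr0.
    by rewrite !mul0r subr0.
  rewrite (_ : (fun _ => _) = (fun x => Im (f x)) \_ E).
    by apply/(measurable_restrictT _ _).1 => //; exact: measurable_funS m2.
  apply/funext => x; rewrite patchE cImM cindE; case: ifP => _ /=.
    by rewrite mul1r mul0r addr0.
  by rewrite !mul0r addr0.
have hD' : cL2 (fun t => cind D' t * f t).
  split; first exact: m0.
  apply/integrableP; split.
    by apply/measurable_EFinP; apply: measurable_normc_sqr; exact: m0.
  under eq_integral => x _ do rewrite /= ger0_norm ?sqr_ge0//.
  by apply: h; rewrite invr_eq0 pnatr_eq0.
apply: (cL2_bnd (M := 1) (m0 _ mD DD') hD') => t; rewrite mul1r !normcM.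
rewrite ler_wpM2r ?normc_ge0//; have [tD|tD] := pselect (D t).
  by rewrite !cind1//; exact: DD'.
by rewrite cind0// normc0 normc_ge0.
Qed.

Lemma l2norm_bound (u : int -> C) : l2norm u = +oo%E \/
  exists S : R, [/\ 0 <= S, l2norm u = (Num.sqrt S)%:E &
    forall s : seq int, uniq s -> \sum_(n <- s) normc (u n) ^+ 2 <= S].
Proof.
set a := fun n => (normc (u n) ^+ 2)%:E.
have a0 n : (0 <= a n)%E by rewrite lee_fin sqr_ge0.
have e0 : (0 <= \esum_(n in [set: int]) a n)%E by apply: esum_ge0 => n _; exact: a0.
have h s : uniq s -> ((\sum_(n <- s) normc (u n) ^+ 2)%:E <= \esum_(n in [set: int]) a n)%E.
  move=> us; apply: esum_ge; exists [set` s].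
    by split => //; exact: finite_seq.
  by rewrite -fsbig_seq// -sumEFin.
rewrite /l2norm; move: e0 h; rewrite -/a; case: (\esum_(n in _) a n)%E => [S||//].
  rewrite lee_fin => S0 h; right; exists S; split => //.
  by rewrite poweR_EFin powR12_sqrt.
by move=> _ _; left; apply: poweRyr; rewrite invr_eq0 pnatr_eq0.
Qed.

Lemma l2norm_le_half (u : int -> C) (r : R) : r < 2^-1 -> (l2norm u <= r%:E)%E ->
  forall s : seq int, uniq s -> \sum_(n <- s) normc (u n) ^+ 2 <= 4^-1.
Proof.
move=> r2; have [->|[S [S0 -> hS]]] := l2norm_bound u; first by rewrite leye_eq.
rewrite lee_fin => Sr s /hS /le_trans; apply.
have sS := sqrtr_ge0 S; rewrite -(sqr_sqrtr S0); nra.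
Qed.

End Norms.

Section Dirac.
Context {R : realType}.
Local Notation C := R[i].
Local Notation Re := complex.Re.
Local Notation Im := complex.Im.
Local Notation mu := (@lebesgue_measure R).
Local Notation pi := (@trigo.pi R).
Implicit Types (q p : R -> C).

Definition alpha a q p (t : R) : C := cind `]a, pi[ t * (p t - 'i * q t).
Definition beta a q p (t : R) : C := cind `]a, pi[ t * (p t + 'i * q t).

Lemma alpha_supp a q p t : ~ `]a, pi[%classic t -> alpha a q p t = 0.
Proof. by move=> h; rewrite /alpha cind0// mul0r. Qed.

Lemma beta_supp a q p t : ~ `]a, pi[%classic t -> beta a q p t = 0.
Proof. by move=> h; rewrite /beta cind0// mul0r. Qed.

Section Admissible.
Variables (a : R) (q p : R -> C).
Hypothesis a0 : 0 < a.
Hypothesis hqp : admissible a q p.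

Lemma cL2_potential_q : cL2 (fun t => cind `]a, pi[ t * q t).
Proof.
case: hqp => hq _ _; apply: in_L2_cL2 hq => //.
by apply: subset_itvr; rewrite bnd_simp ltW.
Qed.

Lemma cL2_potential_p : cL2 (fun t => cind `]a, pi[ t * p t).
Proof.
case: hqp => _ hp _; apply: in_L2_cL2 hp => //.
by apply: subset_itvr; rewrite bnd_simp ltW.
Qed.

Lemma cL2_alpha : cL2 (alpha a q p).
Proof.
have := cL2B cL2_potential_p (cL2Z 'i cL2_potential_q).
by congr cL2; apply/funext => t; rewrite /alpha; ring.
Qed.

Lemma cL2_beta : cL2 (beta a q p).
Proof.
have := cL2D cL2_potential_p (cL2Z 'i cL2_potential_q).
by congr cL2; apply/funext => t; rewrite /beta; ring.
Qed.

Lemma mx22E (x y z t : C) : [/\ mx22 x y z t 0 0 = x, mx22 x y z t 0 1 = y,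
  mx22 x y z t 1 0 = z & mx22 x y z t 1 1 = t].
Proof. by split; rewrite mxE. Qed.

Lemma system_entries (lambda : C) (D Y Y' : 'M[C]_2) t :
  Bmx *m D + Qmx q p t *m Y' = lambda *: Y ->
  D 1 0 + (q t * Y' 0 0 + p t * Y' 1 0) = lambda * Y 0 0 /\
  - D 0 0 + (p t * Y' 0 0 - q t * Y' 1 0) = lambda * Y 1 0.
Proof.
move=> /matrixP h; have := h 0 0; have := h 1 0.
have [b1 b2 b3 b4] := mx22E 0 1 (-1) 0.
have [q1 q2 q3 q4] := mx22E (q t) (p t) (p t) (- q t).
rewrite !mxE !big_ord_recl !big_ord0 /=.
have -> : lift ord0 ord0 = 1 :> 'I_2 by apply/val_inj.
have -> : ord0 = 0 :> 'I_2 by apply/val_inj.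
rewrite /Bmx /Qmx b1 b2 b3 b4 q1 q2 q3 q4 => h1 h0.
by split; [rewrite -h0; ring|rewrite -h1; ring].
Qed.

Variables (lambda : C) (Y : R -> 'M[C]_2).
Hypothesis a_le : 2 * a <= pi.
Hypothesis a_ge : pi <= 3 * a.
Hypothesis hY : is_solution a q p lambda Y.
Hypothesis Y0 : Y 0 = 1%:M.

Let W t := Y t 0 0 + 'i * Y t 1 0.
Let Z t := Y t 0 0 - 'i * Y t 1 0.

Lemma dirac_solution :
  W pi = cexp ('i * lambda * pi%:C) +
    ftrans a (delay_kernel a (alpha a q p) (beta a q p)) lambda /\
  Z pi = cexp ('i * lambda * (- pi)%:C) +
    ftrans a (fun t => delay_kernel a (beta a q p) (alpha a q p) (pi + a - t)) lambda.
Proof.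
have [ac eqY] := hY; have pi0 := pi_ge0 R.
have [g1 ig1 [e1 d1]] := abs_continuousC_density pi0 (ac 0 0).
have [g2 ig2 [e2 d2]] := abs_continuousC_density pi0 (ac 1 0).
pose gW t := g1 t + 'i * g2 t; pose gZ t := g1 t - 'i * g2 t.
have igW : cintble gW by apply: cintbleD => //; exact: cintbleZ.
have igZ : cintble gZ by apply: cintbleB => //; exact: cintbleZ.
have icut x (g : R -> C) : cintble g -> cintble (fun s => cind `]0, x[ s * g s).
  move=> ig; apply: (cintble_le _ (cintble_norm ig)).
    by apply: cmeasM; [exact: cmeas_ind|exact: ig.1].
  by move=> t; rewrite normcM ler_piMl ?normc_ge0// normc_ind_le.
have Y00 : Y 0 0 0 = 1 by rewrite Y0 mxE.
have Y10 : Y 0 1 0 = 0 by rewrite Y0 mxE.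
have WE t : 0 <= t <= pi -> W t = 1 + cint (fun s => cind `]0, t[ s * gW s).
  move=> tpi; rewrite /W e1// e2// Y00 Y10 add0r -addrA; congr (_ + _).
  rewrite -cintZ -?cintD; [|exact: icut|by apply: cintbleZ; exact: icut|exact: icut].
  by apply: eq_cint => s; rewrite /gW; ring.
have ZE t : 0 <= t <= pi -> Z t = 1 + cint (fun s => cind `]0, t[ s * gZ s).
  move=> tpi; rewrite /Z e1// e2// Y00 Y10 add0r -addrA; congr (_ + _).
  rewrite -cintZ -?cintB; [|exact: icut|by apply: cintbleZ; exact: icut|exact: icut].
  by apply: eq_cint => s; rewrite /gZ; ring.
have i2 : 'i * 'i = -1 :> C by rewrite -expr2 sqr_i.
have ode : {ae mu, forall t, 0 < t < pi ->
    gW t = 'i * lambda * W t + alpha a q p t * Z (t - a) /\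
    gZ t = - ('i * lambda) * Z t + beta a q p t * W (t - a)}.
  case: hqp => _ _ qp0.
  have aa : {ae mu, forall x : R, x <> a}.
    exists [set a]; split => //; first exact: lebesgue_measure_set1.
    by move=> x /= /contrapT.
  have H1 : {ae mu, forall t, (0 < t < pi -> g1 t = Defs.derivC (fun s => Y s 0 0) t) /\
      (0 < t < pi -> g2 t = Defs.derivC (fun s => Y s 1 0) t)}.
    by move: d1 d2; apply: ae_imp2 => t h1 h2; split => tp; rewrite ?h1 ?h2.
  have H2 : {ae mu, forall t, (0 < t < a -> q t = 0 /\ p t = 0) /\ t <> a}.
    by move: qp0 aa; apply: ae_imp2.
  have H3 : {ae mu, forall t, [/\ 0 < t < pi -> g1 t = Defs.derivC (fun s => Y s 0 0) t,
      0 < t < pi -> g2 t = Defs.derivC (fun s => Y s 1 0) t,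
      0 < t < a -> q t = 0 /\ p t = 0 & t <> a]}.
    by move: H1 H2; apply: ae_imp2 => t [? ?] [? ?].
  move: eqY H3; apply: ae_imp2 => t ht [h1 h2 h3 ta] tp.
  have := system_entries (ht tp); rewrite !mxE => -[s1 s2].
  rewrite -(h2 tp) in s1; rewrite -(h1 tp) in s2.
  have G2 : g2 t = lambda * Y t 0 0 - (q t * Y (t - a) 0 0 + p t * Y (t - a) 1 0).
    by rewrite -s1; ring.
  have G1 : g1 t = - (lambda * Y t 1 0) + (p t * Y (t - a) 0 0 - q t * Y (t - a) 1 0).
    by rewrite -s2; ring.
  have [tlea|alet] := ltP t a.
    have [q0 p0] : q t = 0 /\ p t = 0 by apply: h3; rewrite tlea andbT; case/andP: tp.
    have tI : ~ `]a, pi[%classic t by rewrite /= in_itv/= => /andP[]; rewrite ltNge (ltW tlea).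
    rewrite alpha_supp// beta_supp// /gW /gZ G1 G2 q0 p0 /W /Z.
    split; apply/eqP; rewrite -subr_eq0; apply/eqP.
      transitivity (- (1 + 'i * 'i) * (lambda * Y t 1 0)); first by ring.
      by rewrite i2 subrr oppr0 mul0r.
    transitivity (- (1 + 'i * 'i) * (lambda * Y t 1 0)); first by ring.
    by rewrite i2 subrr oppr0 mul0r.
  have tI : `]a, pi[%classic t.
    rewrite /= in_itv/= lt_neqAle alet andbT; case/andP: tp => _ ->; rewrite andbT.
    by apply/eqP => at'; exact: ta.
  rewrite /alpha /beta cind1// !mul1r /gW /gZ G1 G2 /W /Z.
  split; apply/eqP; rewrite -subr_eq0; apply/eqP.
    transitivity (- (1 + 'i * 'i) * (lambda * Y t 1 0 + q t * Y (t - a) 1 0)); first by ring.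
    by rewrite i2 subrr oppr0 mul0r.
  transitivity (- (1 + 'i * 'i) * (lambda * Y t 1 0 + q t * Y (t - a) 1 0)); first by ring.
  by rewrite i2 subrr oppr0 mul0r.
have odeW : {ae mu, forall t, 0 < t < pi -> gW t = 'i * lambda * W t + alpha a q p t * Z (t - a)}.
  by move: ode; apply: ae_imp => t h /h[].
have odeZ : {ae mu, forall t, 0 < t < pi -> gZ t = - ('i * lambda) * Z t + beta a q p t * W (t - a)}.
  by move: ode; apply: ae_imp => t h /h[].
have hW := solution_formula a0 a_le a_ge cL2_alpha cL2_beta (@alpha_supp a q p) (@beta_supp a q p)
  igW igZ WE ZE odeW odeZ.
have odeW' : {ae mu, forall t, 0 < t < pi -> gW t = - - ('i * lambda) * W t + alpha a q p t * Z (t - a)}.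
  by move: odeW; apply: ae_imp => t h tp; rewrite opprK h.
have hZ := solution_formula a0 a_le a_ge cL2_beta cL2_alpha (@beta_supp a q p) (@alpha_supp a q p)
  igZ igW ZE WE odeZ odeW'.
split; first exact: hW.
rewrite hZ; congr (_ + _); first by rewrite rmorphN/= mulrN mulNr.
have hk := cL2_delay_kernel (@beta_supp a q p) (@alpha_supp a q p) cL2_beta cL2_alpha.
rewrite -(cint_refl (pi + a)); last first.
  apply: cmeasM; first exact: hk.1.
  apply: cmeas_cexp; apply: cmeasZ; apply: cmeas_real.
  apply: measurable_funB; first exact: measurable_cst.
  by apply: measurable_funM => //; exact: measurable_cst.
apply: eq_cint => t; congr (_ * cexp _).
have -> : pi + a - 2 * (pi + a - t) = - (pi + a - 2 * t) by ring.
by rewrite rmorphN/= mulrN mulNr opprK.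
Qed.

End Admissible.
End Dirac.

(** * Characteristic functions *)

Section CharacteristicFunction.
Context {R : realType}.
Local Notation C := R[i].
Local Notation Re := complex.Re.
Local Notation Im := complex.Im.
Local Notation pi := (@trigo.pi R).
Implicit Types (a : R) (q p : R -> C) (j : nat).

Lemma lists_zerosE (f : C -> C) (lam : int -> C) n : lists_zeros f lam -> f (lam n) = 0.
Proof.
move=> /(_ (lam n))[m [fm _] hm]; case: m fm hm => [_|m fm _]; last exact: fm 0%N isT.
rewrite II0 card_eq0 => /eqP h.
by have : [set k | lam k = lam n] n by []; rewrite h.
Qed.

(* The boundary conditions j = 1, 2 select (W + Z) / 2 and (W - Z) / (2i). *)
Definition bc_coef j : C := if j == 1%N then 2^-1 else (2 * 'i)^-1.
Definition bc_sign j : C := if j == 1%N then 1 else -1.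

Lemma normc2V : normc (2^-1 : C) = 2^-1.
Proof.
rewrite (_ : 2^-1 = (2^-1 : R)%:C :> C); last by rewrite fmorphV rmorph_nat.
by rewrite normc_real ger0_norm// invr_ge0.
Qed.

Lemma normc_bc_coef j : normc (bc_coef j) = 2^-1.
Proof.
rewrite /bc_coef; case: ifP => _; first exact: normc2V.
by rewrite invfM normcM normc2V normcV normc_i invr1 mulr1.
Qed.

Lemma normc_bc_sign j : normc (bc_sign j) = 1.
Proof. by rewrite /bc_sign; case: ifP => _; rewrite ?normcN normc1. Qed.

Definition kernelW a q p := delay_kernel a (alpha a q p) (beta a q p).
Definition kernelZ a q p := delay_kernel a (beta a q p) (alpha a q p).
Definition bc_kernel a q p j (t : R) : C :=
  bc_coef j * (kernelW a q p t + bc_sign j * kernelZ a q p (pi + a - t)).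

Section Range.
Variables (a : R) (q p : R -> C).
Hypothesis a_ge : 2 * pi / 5 <= a.
Hypothesis a_lt : a < pi / 2.
Hypothesis hqp : admissible a q p.

Let a0 : 0 < a < pi.
Proof.
have pi0 := pi_gt0 R; move: a_ge a_lt; move: pi pi0 (a) => P P0 b q1 q2.
by apply/andP; split; lra.
Qed.

Let hal : cL2 (alpha a q p). Proof. by apply: cL2_alpha => //; case/andP: a0. Qed.
Let hbe : cL2 (beta a q p). Proof. by apply: cL2_beta => //; case/andP: a0. Qed.

Lemma cL2_kernelW : cL2 (kernelW a q p).
Proof. exact: cL2_delay_kernel (@alpha_supp _ a q p) (@beta_supp _ a q p) hal hbe. Qed.

Lemma cL2_kernelZ : cL2 (kernelZ a q p).
Proof. exact: cL2_delay_kernel (@beta_supp _ a q p) (@alpha_supp _ a q p) hbe hal. Qed.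

Lemma kernelW_supp t : ~ `]a, pi[%classic t -> kernelW a q p t = 0.
Proof.
by move=> tI; rewrite /kernelW delay_kernel_supp// => s; exact: alpha_supp.
Qed.

Lemma kernelZr_supp t : ~ `]a, pi[%classic t -> kernelZ a q p (pi + a - t) = 0.
Proof.
move=> tI; rewrite /kernelZ delay_kernel_supp// => [s|tI']; first exact: beta_supp.
apply: tI.
move: tI'; rewrite /= !in_itv/= => /andP[h1 h2].
by move: h1 h2; move: pi (a) => P b h1 h2; apply/andP; split; lra.
Qed.

Lemma cL2_bc_kernel j : cL2 (bc_kernel a q p j).
Proof.
by apply: cL2Z; apply: cL2D (cL2_kernelW) (cL2Z _ _); exact: cL2_refl cL2_kernelZ.
Qed.

Lemma bc_kernel_supp j t : ~ `]a, pi[%classic t -> bc_kernel a q p j t = 0.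
Proof.
by move=> tI; rewrite /bc_kernel kernelW_supp// kernelZr_supp// mulr0 addr0 mulr0.
Qed.

Lemma charfunE (Y : R -> C -> 'M[C]_2) j (lam : C) : j \in [:: 1; 2]%N ->
  is_fundamental_solution a q p Y ->
  charfun Y 2 j lam = ctrig (bc_coef j) (bc_sign j) lam + ftrans a (bc_kernel a q p j) lam.
Proof.
move=> hj /(_ lam)[hY hY0]; have /andP[a1 a2] := a0.
have q1 : 2 * a <= pi by move: a_lt; move: pi (a) => P b; lra.
have q2 : pi <= 3 * a.
  by have pi0 := pi_gt0 R; move: a_ge; move: pi pi0 (a) => P P0 b; lra.
have [hW hZ] := dirac_solution a1 hqp q1 q2 hY hY0.
have -> : ftrans a (bc_kernel a q p j) lam = bc_coef j * (ftrans a (kernelW a q p) lam +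
    bc_sign j * ftrans a (fun t => kernelZ a q p (pi + a - t)) lam).
  have iW := cintble_ftrans a0 cL2_kernelW kernelW_supp lam.
  have iZ := cintble_ftrans a0 (cL2_refl (pi + a) cL2_kernelZ) kernelZr_supp lam.
  rewrite /ftrans -cintZ// -cintD//; last exact: cintbleZ.
  rewrite -cintZ; last by apply: cintbleD => //; exact: cintbleZ.
  by apply: eq_cint => t; rewrite /bc_kernel; ring.
rewrite /ctrig -mulrDr addrACA -mulrDr -hW -[X in bc_sign j * X]hZ /charfun.
have i0 : (inord (3 - 2 - 1) : 'I_2) = 0 by apply/val_inj; rewrite /= inordK.
have i1 : (inord (1 - 1) : 'I_2) = 0 by apply/val_inj; rewrite /= inordK.
have i2 : (inord (2 - 1) : 'I_2) = 1 by apply/val_inj; rewrite /= inordK.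
have ni : 'i != 0 :> C.
  by apply/eqP => h; have /eqP := @normc_i R; rewrite h normc0 eq_sym oner_eq0.
rewrite i0 /bc_coef /bc_sign; move: hj; rewrite !inE => /orP[|] /eqP ->.
  by rewrite i1 eqxx; field.
by rewrite i2 /=; field.
Qed.

End Range.

Lemma ctrig_base j (n : int) : j \in [:: 1; 2]%N ->
  ctrig (bc_coef j) (bc_sign j) (n%:~R + (- (j%:R / 2))%:C) = 0.
Proof.
move=> hj; set l : C := n%:~R + _.
rewrite /ctrig.
have -> : 'i * l * pi%:C = 'i * l * (- pi)%:C + 'i * l * (2 * pi)%:C.
  by rewrite rmorphN rmorphM/= rmorph_nat; ring.
suff h : cexp ('i * l * (2 * pi)%:C) = - bc_sign j.
  by rewrite cexpD h; ring.
have -> : 'i * l * (2 * pi)%:C = 'i * (2 * n%:~R * pi)%:C + 'i * (- (j%:R * pi))%:C.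
  rewrite /l !(rmorphN, rmorphM)/= !rmorph_nat (rmorph_int (real_complex R)) fmorphV rmorph_nat.
  by field.
rewrite cexpD -/(en n pi) en_pi mul1r.
have -> : cexp ('i * (- (j%:R * pi))%:C) = cos (j%:R * pi) +i* (- sin (j%:R * pi)) :> C.
  by apply: eq_ReIm; rewrite ?(Re_cexpM, Im_cexpM)/= mul0r expR0 !mul1r ?cosN ?sinN.
rewrite /bc_sign; move: hj; rewrite !inE => /orP[|] /eqP ->.
  by rewrite eqxx mul1r cospi sinpi; apply: eq_ReIm; rewrite /= ?oppr0.
rewrite /= opprK [2 * pi]mulrC mulr_natr cos2pi sin2pi.
by apply: eq_ReIm; rewrite /= ?oppr0.
Qed.

Definition spectral_bound : R := 75 * (lip_const ^+ 2 / 4).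

Definition potential_const : R :=
  (2 + 27 * (4 * spectral_bound)) * (4 * stab_const).

End CharacteristicFunction.

Lemma mulr4_assoc (R : realType) (x y z : R) : x * (4 * y) * z = x * (2 * (2 * (y * z))).
Proof. by ring. Qed.

Section Estimate.
Context {R : realType}.
Local Notation C := R[i].
Local Notation pi := (@trigo.pi R).
Variables (a : R) (q p qt pt : R -> C).
Hypothesis a_ge : 2 * pi / 5 <= a.
Hypothesis a_lt : a < pi / 2.
Hypothesis hqp : admissible a q p.
Hypothesis hqpt : admissible a qt pt.

Let a_gt0 : 0 < a.
Proof.
have pi0 := pi_gt0 R; move: a_ge a_lt; move: pi pi0 (a) => P P0 b q1 q2; lra.
Qed.

Lemma kernelW_bc (q' p' : R -> C) t : kernelW a q' p' t =
  bc_kernel a q' p' 1 t + 'i * bc_kernel a q' p' 2 t.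
Proof.
have ni : 'i != 0 :> C.
  by apply/eqP => h; have /eqP := @normc_i R; rewrite h normc0 eq_sym oner_eq0.
by rewrite /bc_kernel /bc_coef /bc_sign /=; field.
Qed.

Lemma kernelZr_bc (q' p' : R -> C) t : kernelZ a q' p' (pi + a - t) =
  bc_kernel a q' p' 1 t - 'i * bc_kernel a q' p' 2 t.
Proof.
have ni : 'i != 0 :> C.
  by apply/eqP => h; have /eqP := @normc_i R; rewrite h normc0 eq_sym oner_eq0.
by rewrite /bc_kernel /bc_coef /bc_sign /=; field.
Qed.

Lemma sqn_combine (f1 f2 : R -> C) (B : R) : cL2 f1 -> cL2 f2 ->
  sqn f1 + sqn f2 <= B ->
  sqn (fun t => f1 t + 'i * f2 t) <= 2 * B /\ sqn (fun t => f1 t - 'i * f2 t) <= 2 * B.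
Proof.
move=> h1 h2 hB; have h2' := cL2Z 'i h2.
have e : sqn (fun t => 'i * f2 t) = sqn f2 by rewrite sqnZ// normc_i expr1n mul1r.
by split; [apply: (le_trans (sqnD h1 h2'))|apply: (le_trans (sqnB h1 h2'))]; rewrite e; lra.
Qed.

Lemma potential_estimate (K S : R) :
  (forall j : nat, j \in [:: 1; 2]%N -> sqn (bc_kernel a q p j) <= K) ->
  (forall j : nat, j \in [:: 1; 2]%N -> sqn (bc_kernel a qt pt j) <= K) ->
  sqn (fun t => bc_kernel a q p 1 t - bc_kernel a qt pt 1 t) +
  sqn (fun t => bc_kernel a q p 2 t - bc_kernel a qt pt 2 t) <= 2 * (stab_const * S) ->
  sqn (fun t => alpha a q p t - alpha a qt pt t) <= (2 + 27 * (4 * K)) * (4 * stab_const) * S /\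
  sqn (fun t => beta a q p t - beta a qt pt t) <= (2 + 27 * (4 * K)) * (4 * stab_const) * S.
Proof.
move=> hK hKt hS.
have hu j := cL2_bc_kernel a_ge a_lt hqp j.
have hut j := cL2_bc_kernel a_ge a_lt hqpt j.
have i1 : 1%N \in [:: 1; 2]%N by []. have i2 : 2%N \in [:: 1; 2]%N by [].
have kE (q' p' : R -> C) : (forall j, cL2 (bc_kernel a q' p' j)) -> cL2 (kernelZ a q' p') ->
    (forall j : nat, j \in [:: 1; 2]%N -> sqn (bc_kernel a q' p' j) <= K) ->
    sqn (kernelW a q' p') <= 4 * K /\ sqn (kernelZ a q' p') <= 4 * K.
  move=> hu' hZ hK'; have hB : sqn (bc_kernel a q' p' 1) + sqn (bc_kernel a q' p' 2) <= 2 * K.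
    by rewrite mulr_natl mulr2n; apply: lerD; exact: hK'.
  have [b1 b2] := sqn_combine (hu' _) (hu' _) hB.
  rewrite -(sqn_refl (pi + a) hZ.1).
  have -> : kernelW a q' p' = (fun t => bc_kernel a q' p' 1 t + 'i * bc_kernel a q' p' 2 t).
    by apply/funext => t; exact: kernelW_bc.
  have -> : (fun t => kernelZ a q' p' (pi + a - t)) =
      (fun t => bc_kernel a q' p' 1 t - 'i * bc_kernel a q' p' 2 t).
    by apply/funext => t; exact: kernelZr_bc.
  have e : 2 * (2 * K) = 4 * K by rewrite mulrA -natrM.
  by rewrite -e.
have hZ := cL2_kernelZ a_ge a_lt hqp; have hZt := cL2_kernelZ a_ge a_lt hqpt.
have [KW KZ] := kE q p hu hZ hK; have [KWt KZt] := kE qt pt hut hZt hKt.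
have [D1 D2] := sqn_combine (cL2B (hu 1%N) (hut 1%N)) (cL2B (hu 2%N) (hut 2%N)) hS.
have dW : sqn (fun t => kernelW a q p t - kernelW a qt pt t) <= 2 * (2 * (stab_const * S)).
  rewrite (_ : (fun t => _) = (fun t => bc_kernel a q p 1 t - bc_kernel a qt pt 1 t +
    'i * (bc_kernel a q p 2 t - bc_kernel a qt pt 2 t)))//.
  by apply/funext => t; rewrite !kernelW_bc; ring.
have dZ : sqn (fun t => kernelZ a q p t - kernelZ a qt pt t) <= 2 * (2 * (stab_const * S)).
  rewrite -(sqn_refl (pi + a) (cL2B hZ hZt).1).
  rewrite (_ : (fun t => _) = (fun t => bc_kernel a q p 1 t - bc_kernel a qt pt 1 t -
    'i * (bc_kernel a q p 2 t - bc_kernel a qt pt 2 t)))//.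
  by apply/funext => t; rewrite !kernelZr_bc; ring.
have ar : 2 * pi / 5 <= a < pi / 2 by rewrite a_ge a_lt.
have a1 := cL2_alpha a_gt0 hqp; have a2 := cL2_beta a_gt0 hqp.
have a3 := cL2_alpha a_gt0 hqpt; have a4 := cL2_beta a_gt0 hqpt.
have s1 := @alpha_supp R a q p; have s2 := @beta_supp R a q p.
have s3 := @alpha_supp R a qt pt; have s4 := @beta_supp R a qt pt.
rewrite mulr4_assoc; split.
  exact: (delay_kernel_inverse ar s1 s2 s3 s4 a1 a2 a3 a4 KZ KWt dW dZ).
exact: (delay_kernel_inverse ar s2 s1 s4 s3 a2 a1 a4 a3 KW KZt dZ dW).
Qed.

Lemma potential_L2norm (X : R) :
  sqn (fun t => alpha a q p t - alpha a qt pt t) <= X ->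
  sqn (fun t => beta a q p t - beta a qt pt t) <= X ->
  (L2norm `]a, pi[ (fun x => (q x - qt x)%R) <= (Num.sqrt X)%:E)%E /\
  (L2norm `]a, pi[ (fun x => (p x - pt x)%R) <= (Num.sqrt X)%:E)%E.
Proof.
move=> hA hB.
have hq := cL2B (cL2_potential_q a_gt0 hqp) (cL2_potential_q a_gt0 hqpt).
have hp := cL2B (cL2_potential_p a_gt0 hqp) (cL2_potential_p a_gt0 hqpt).
have ni : 'i != 0 :> C.
  by apply/eqP => h; have /eqP := @normc_i R; rewrite h normc0 eq_sym oner_eq0.
have dA := cL2B (cL2_alpha a_gt0 hqp) (cL2_alpha a_gt0 hqpt).
have dB := cL2B (cL2_beta a_gt0 hqp) (cL2_beta a_gt0 hqpt).
have eq_q : (fun t => cind `]a, pi[ t * q t - cind `]a, pi[ t * qt t) =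
   (fun t => cind `]a, pi[ t * (q t - qt t)) by apply/funext => t; rewrite mulrBr.
have eq_p : (fun t => cind `]a, pi[ t * p t - cind `]a, pi[ t * pt t) =
   (fun t => cind `]a, pi[ t * (p t - pt t)) by apply/funext => t; rewrite mulrBr.
rewrite eq_q in hq; rewrite eq_p in hp.
rewrite !L2normE// !lee_fin; split; apply: ler_wsqrtr.
  have -> : (fun t => cind `]a, pi[ t * (q t - qt t)) = (fun t => (2 * 'i)^-1 *
      ((beta a q p t - beta a qt pt t) - (alpha a q p t - alpha a qt pt t))).
    by apply/funext => t; rewrite /alpha /beta; field.
  rewrite sqnZ; last exact: cL2B.
  rewrite (@normc_bc_coef R 2); have := sqnB dB dA; lra.
have -> : (fun t => cind `]a, pi[ t * (p t - pt t)) = (fun t => 2^-1 *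
    ((beta a q p t - beta a qt pt t) + (alpha a q p t - alpha a qt pt t))).
  by apply/funext => t; rewrite /alpha /beta; field.
rewrite sqnZ; last exact: cL2D.
rewrite normc2V; have := sqnD dB dA; lra.
Qed.

End Estimate.

Lemma stab_const_ge0 (R : realType) : 0 <= stab_const :> R.
Proof.
have L0 := ltW (lip_const_gt0 (R := R)); have pi0 := pi_ge0 R.
by rewrite /stab_const mulr_ge0// addr_ge0 ?mulr_ge0 ?divr_ge0 ?exprn_ge0.
Qed.

Lemma final_const_ge0 (R : realType) : 0 <= potential_const :> R.
Proof.
apply: mulr_ge0; last by rewrite mulr_ge0// stab_const_ge0.
by rewrite addr_ge0// mulr_ge0// mulr_ge0// mulr_ge0// divr_ge0// sqr_ge0.
Qed.

Section Spectra.
Context {R : realType}.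
Local Notation C := R[i].
Local Notation pi := (@trigo.pi R).
Variables (a : R) (q p : R -> C) (lam : int -> C) (j : nat).
Hypothesis a_ge : 2 * pi / 5 <= a.
Hypothesis a_lt : a < pi / 2.
Hypothesis hqp : admissible a q p.
Hypothesis hj : j \in [:: 1; 2]%N.
Hypothesis hlam : is_spectrum a q p 2 j lam.

Definition shift (n : int) : C := lam n - n%:~R + j%:R / 2.

Lemma shiftE n : perturbed (- (j%:R / 2)) shift n = lam n.
Proof.
rewrite /perturbed /shift rmorphN rmorphM/= fmorphV !rmorph_nat; ring.
Qed.

Lemma spectrum_zero n :
  ctrig (bc_coef j) (bc_sign j) (perturbed (- (j%:R / 2)) shift n) +
  ftrans a (bc_kernel a q p j) (perturbed (- (j%:R / 2)) shift n) = 0.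
Proof.
have [[Y hY hz] _] := hlam.
by rewrite shiftE -(charfunE a_ge a_lt hqp _ hj hY); exact: lists_zerosE hz.
Qed.

End Spectra.

Theorem theorem5p2 (R : realType) (r : R) :
  0 < r < 2^-1 ->
  exists2 C : R, 0 < C &
  forall a : R, 2 * pi / 5 <= a < pi / 2 ->
  forall q p qt pt : R -> R[i],
  admissible a q p -> admissible a qt pt ->
  forall lam lamt : nat -> int -> R[i],
  (forall j : nat, j \in [:: 1; 2]%N ->
     is_spectrum a q p 2 j (lam j) /\ is_spectrum a qt pt 2 j (lamt j)) ->
  (forall j : nat, j \in [:: 1; 2]%N ->
     (l2norm (fun n => (lam j n - n%:~R + j%:R / 2)%R) <= r%:E)%E /\
     (l2norm (fun n => (lamt j n - n%:~R + j%:R / 2)%R) <= r%:E)%E) ->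
  (L2norm `]a, pi[ (fun x => (q x - qt x)%R)
     + L2norm `]a, pi[ (fun x => (p x - pt x)%R)
   <= C%:E * (l2norm (fun n => (lam 1%N n - lamt 1%N n)%R)
              + l2norm (fun n => (lam 2%N n - lamt 2%N n)%R)))%E.
Proof.
move=> /andP[r0 r2].
pose c : R := Num.sqrt potential_const.
have c0 : 0 <= c by exact: sqrtr_ge0.
exists (2 * c + 1); first by rewrite ltr_wpDl// mulr_ge0.
move=> a /andP[a_ge a_lt] q p qt pt hqp hqpt lam lamt hs hl.
have g0 (u : int -> R[i]) : (0 <= l2norm u)%E by exact: poweR_ge0.
have cpos : (0 < (2 * c + 1)%:E)%E by rewrite lte_fin ltr_wpDl// mulr_ge0.
set d1 := fun n => (lam 1%N n - lamt 1%N n)%R.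
set d2 := fun n => (lam 2%N n - lamt 2%N n)%R.
have [e1|[S1 [S10 e1 hS1]]] := l2norm_bound d1.
  by rewrite e1 addye ?gt0_muley ?leey// gt_eqF// (lt_le_trans _ (g0 d2)).
have [e2|[S2 [S20 e2 hS2]]] := l2norm_bound d2.
  by rewrite e2 addey ?gt0_muley ?leey// e1.
have sc := stab_const_ge0 R.
have K1 j (hj : j \in [:: 1; 2]%N) := l2norm_le_half r2 (hl j hj).1.
have K2 j (hj : j \in [:: 1; 2]%N) := l2norm_le_half r2 (hl j hj).2.
have z1 j (hj : j \in [:: 1; 2]%N) := spectrum_zero a_ge a_lt hqp hj (hs j hj).1.
have z2 j (hj : j \in [:: 1; 2]%N) := spectrum_zero a_ge a_lt hqpt hj (hs j hj).2.
have hu j := cL2_bc_kernel a_ge a_lt hqp j.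
have hut j := cL2_bc_kernel a_ge a_lt hqpt j.
have su j := @bc_kernel_supp _ a q p a_ge j.
have sut j := @bc_kernel_supp _ a qt pt a_ge j.
have B1 j (hj : j \in [:: 1; 2]%N) : sqn (bc_kernel a q p j) <= spectral_bound.
  exact: (sqn_from_zeros a_ge a_lt (normc_bc_coef j) (normc_bc_sign j)
    (fun n => ctrig_base n hj) (hu j) (su j) (K1 j hj) (z1 j hj)).
have B2 j (hj : j \in [:: 1; 2]%N) : sqn (bc_kernel a qt pt j) <= spectral_bound.
  exact: (sqn_from_zeros a_ge a_lt (normc_bc_coef j) (normc_bc_sign j)
    (fun n => ctrig_base n hj) (hut j) (sut j) (K2 j hj) (z2 j hj)).
have D j (hj : j \in [:: 1; 2]%N) (S : R) :
    (forall s : seq int, uniq s -> \sum_(n <- s) normc (lam j n - lamt j n) ^+ 2 <= S) ->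
    sqn (fun t => bc_kernel a q p j t - bc_kernel a qt pt j t) <= stab_const * S.
  move=> hS; apply: (sqn_diff_from_zeros a_ge a_lt (normc_bc_coef j) (normc_bc_sign j)
    (fun n => ctrig_base n hj) (hu j) (hut j) (su j) (sut j) (K1 j hj) (K2 j hj)
    (z1 j hj) (z2 j hj)) => s us.
  by under eq_bigr do rewrite !shiftE; exact: hS.
have i1 : 1%N \in [:: 1; 2]%N by []. have i2 : 2%N \in [:: 1; 2]%N by [].
have hS : sqn (fun t => bc_kernel a q p 1 t - bc_kernel a qt pt 1 t) +
    sqn (fun t => bc_kernel a q p 2 t - bc_kernel a qt pt 2 t) <= 2 * (stab_const * (S1 + S2)).
  apply: (le_trans (lerD (D _ i1 _ hS1) (D _ i2 _ hS2))).
  by rewrite -mulrDr ler_peMl ?ler1n//; apply: mulr_ge0 => //; exact: addr_ge0.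
have [hA hB] := potential_estimate a_ge a_lt hqp hqpt B1 B2 hS.
have [Lq Lp] := potential_L2norm a_ge a_lt hqp hqpt hA hB.
apply: (le_trans (leeD Lq Lp)).
rewrite -/potential_const sqrtrM ?final_const_ge0// -/c e1 e2 -!EFinD -EFinM lee_fin.
have h : Num.sqrt (S1 + S2) <= Num.sqrt S1 + Num.sqrt S2.
  rewrite -(@ler_pXn2r _ 2)// ?nnegrE ?addr_ge0 ?sqrtr_ge0//.
  rewrite sqr_sqrtr ?addr_ge0// sqrrD !sqr_sqrtr//.
  have : 0 <= Num.sqrt S1 * Num.sqrt S2 by rewrite mulr_ge0 ?sqrtr_ge0.
  lra.
have h1 : c * Num.sqrt (S1 + S2) <= c * (Num.sqrt S1 + Num.sqrt S2) by rewrite ler_wpM2l.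
have := sqrtr_ge0 S1; have := sqrtr_ge0 S2; lra.
Qed.
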